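(* Let $a\in(0,1)$ and $b>1-a$ be fixed real constants. For $\varepsilon\in(0,1)$ let $(\eta_n)_{n\ge 0}$ be independent random variables with $P(\eta_n=1)=1-\varepsilon$ and $P(\eta_n=0)=\varepsilon$, let $X_0=1$, $X_1=a$, $X_{n+1}=aX_n+b\,\eta_{n-1}X_{n-1}$ for $n\ge 1$, and let $$W_n:=\frac{1}{X_n}\sum_{k=0}^{n-1}X_k,\qquad n\ge 1.$$ Then the following holds. (a) There exists $\varepsilon^*\in(0,1)$ such that: (i) If $\varepsilon\in(0,\varepsilon^* )$, then $W_n$ converges in distribution, as $n\to\infty$, to a non-degenerate random variable $W^{(\varepsilon)}$. (ii) If $\varepsilon\in[\varepsilon^*,1)$, then $\lim_{n\to\infty}P(W_n>x)=1$ for every $x>0$ (that is, $W^{(\varepsilon)}=+\infty$). (iii) For every $\varepsilon\in(0,\varepsilon^* )$ there exist reals $s_\varepsilon\in(0,\infty)$ and $K_\varepsilon\in(0,\infty)$ such that $$\lim_{x\to\infty}P\bigl(W^{(\varepsilon)}>x\bigr)\,x^{s_\varepsilon}=K_\varepsilon.$$ (b) Furthermore, $s_\varepsilon$ is a continuous strictly decreasing function of $\varepsilon$ on $(0,\varepsilon^* )$, and $$\lim_{\varepsilon\downarrow 0}s_\varepsilon=\infty,\qquad \lim_{\varepsilon\uparrow\varepsilon^*}s_\varepsilon=0.$$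
   Context: The constants $a,b$ are held fixed while $\varepsilon$ varies. Non-degenerate means a (finite) real-valued random variable that is not almost surely constant. *)

(* Defs.v *)
From HB Require Import structures.
From mathcomp Require Import all_boot all_order all_algebra.
From mathcomp Require Import finmap.
From mathcomp Require Import all_classical all_reals all_analysis.
From mathcomp Require Import measurable_realfun.

Set Implicit Arguments.
Unset Strict Implicit.
Unset Printing Implicit Defensive.

Import Order.TTheory GRing.Theory Num.Theory.
Import numFieldNormedType.Exports.

Local Open Scope classical_set_scope.
Local Open Scope ring_scope.

Section probability_notions.
Context {R : realType}.

Definition mutually_independent {d : measure_display} {T : measurableType d}
    {P : probability T R} {I : choiceType} (X : I -> {RV P >-> R}) : Prop :=
  forall (J : {fset I}) (B : I -> set R),
    (forall i, i \in J -> measurable (B i)) ->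
    P (\bigcap_(i in [set` J]) (X i @^-1` B i)) =
    (\prod_(i <- J) P (X i @^-1` B i))%E.

(* [X n] and [Y] may live on different probability spaces; convergence of the
   distribution functions at every continuity point of that of [Y] *)
Definition cvg_in_distribution
    {d d' : measure_display} {T : measurableType d} {T' : measurableType d'}
    {P : probability T R} {Q : probability T' R}
    (X : nat -> {RV P >-> R}) (Y : {RV Q >-> R}) : Prop :=
  forall x : R, {for x, continuous (cdf Y)} ->
    cdf (X n) x @[n --> \oo] --> cdf Y x.

Definition non_degenerate {d : measure_display} {T : measurableType d}
    {P : probability T R} (X : {RV P >-> R}) : Prop :=
  forall c : R, ~ {ae P, forall w, X w = c}.

End probability_notions.

Lemma measurable_inv {R : realType} : measurable_fun [set: R] (@GRing.inv R).
Proof.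
have m0 : measurable [set (0 : R)] by exact: measurable_set1.
rewrite -(setUv [set (0 : R)]); apply/measurable_funU => //.
  exact: measurableC.
split; first exact: measurable_fun_set1.
apply: open_continuous_measurable_fun.
  by rewrite openC; exact: closed_eq.
by move=> x; rewrite inE => /= /eqP x0; exact: inv_continuous.
Qed.

Section recursion.
Context {R : realType}.
Variables (a b : R).

(* X_0 = 1, X_1 = a and X_(k+2) = a X_(k+1) + b u_k X_k: the driving sequence
   carries the index of the older of the two terms, so X_2 uses u_0 *)
Fixpoint Xrec (u : nat -> R) (n : nat) : R :=
  match n with
  | 0 => 1
  | m.+1 => match m with
            | 0 => a
            | k.+1 => a * Xrec u m + b * u k * Xrec u k
            end
  end.

Context {d : measure_display} {T : measurableType d} {P : probability T R}.
Variable eta : nat -> {RV P >-> R}.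

Definition Xn (n : nat) (w : T) : R := Xrec (fun k => eta k w) n.

(* Xn n w > 0 as soon as 0 < a, 0 < b and all the eta k w are in {0, 1}, so the
   division by zero convention only matters on a negligible set; Wn 0 = 0 is a
   dummy value *)
Definition Wn (n : nat) (w : T) : R :=
  (Xn n w)^-1 * \sum_(0 <= k < n) Xn k w.

Lemma measurable_Xn n : measurable_fun [set: T] (Xn n).
Proof.
suff: measurable_fun [set: T] (Xn n) /\ measurable_fun [set: T] (Xn n.+1).
  by case.
elim: n => [|n [IH0 IH1]]; first by split; exact: measurable_cst.
split=> //.
rewrite (_ : Xn n.+2 = (fun w => a * Xn n.+1 w + b * eta n w * Xn n w)) //.
apply: measurable_funD; apply: measurable_funM => //.
exact: measurable_funM.
Qed.

Lemma measurable_Wn n : measurable_fun [set: T] (Wn n).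
Proof.
apply: measurable_funM.
  exact: (measurableT_comp measurable_inv (measurable_Xn n)).
by apply: measurable_sum => k; exact: measurable_Xn.
Qed.

HB.instance Definition _ (n : nat) :=
  isMeasurableFun.Build _ _ T R (Wn n) (measurable_Wn n).

Definition W_RV (n : nat) : {RV P >-> R} := Wn n.

End recursion.

(* Main.v *)
(* Read backwards from time n, the bits eta split into runs of N ones closed by
   a zero, N geometric. Since X restarts as a multiple of (1, a) after each zero,
   W satisfies in law W = B_N + A_N W with A_N = 1 / x_{N+1}, B_N = (x_0 + ... +
   x_N) / x_{N+1}, where x is the sequence X driven by ones only. Put
   phi(sig, e) = E[A_N^sig].

   - Since A_{k+l+1} <= theta A_k A_l with theta < 1, phi(sig, e) <= 1 implies
     phi(sig, e') < 1 for e' < e. Hence the e admitting a sig > 0 with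
     phi(sig, e) < 1 form an interval (0, estar); there s(e) is the second root
     of the convex equation phi(., e) = 1, and its regularity and its limits
     follow from this monotonicity.
   - If phi(sig, e) >= 1 for all sig > 0, the bounded function P(W <= x) is
     dominated by 2 (1 - (x / x0)^(-sig)) for every sig > 0, hence vanishes.
   - If phi(s, e) = 1, put f(x) = x^s P(W > x) and Phi(x) = E[min(W, x)^s]. Under
     the weights p_N A_N^s, Psi(x) = Phi(x) - sum_N p_N A_N^s Phi(x / A_N) is
     nondecreasing and bounded, and f is bounded by Wald's argument. If
     f(u_k) tends to the upper (or lower) limit M of f, then by the maximum
     principle f(u_k / A_N) does too; the group generated by the ln A_N being
     dense, f(h u_k) tends to M for all h > 0, so that Psi(u_k) tends to s m M
     with m = sum_N p_N A_N^s ln A_N > 0. As Psi converges, the upper and lower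
     limits of f agree. *)

Require Import Defs.
From HB Require Import structures.
From mathcomp Require Import all_boot all_order all_algebra.
From mathcomp Require Import finmap.
From mathcomp Require Import all_classical all_reals all_analysis.
From mathcomp Require Import ring lra.

Set Implicit Arguments.
Unset Strict Implicit.
Unset Printing Implicit Defensive.

Import Order.TTheory GRing.Theory Num.Theory.
Import numFieldNormedType.Exports.

Local Open Scope classical_set_scope.
Local Open Scope ring_scope.

(** * Means under a geometric distribution *)

(** The law of W_{n+1} is a finite recursion over n bits. If the run still open when the bits are
    exhausted is given the value 0, the mean of every nondecreasing function becomes nondecreasing
    in n, so the limit law exists in both regimes without building a random series. Only convergence
    in distribution needs an error estimate, by a moment of order at most 1.

    The sequence A_N need not decrease (for b = 1 and a = 1/10, A_2 > A_1), so raising the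
    probability of a one gives no pathwise comparison. The factor theta stands in for it: x_{k+l+2}
    = x_{k+1} x_{l+1} + b x_k x_l, and the last term is at least a fixed proportion of the first.

    Phi is truncated because W^s has infinite mean at the critical s. As B is bounded, replacing B +
    A W by A W costs only a moment of some order kap < s with kap >= s - 1.

    The logarithms of the A_N generate a dense group because x_{n+2} x_n / x_{n+1}^2 tends to 1
    without ever being 1, by an identity of Cassini type. *)

Section geometric_mean.
Context {R : realType}.
Variable q : R.
Hypotheses (q_gt0 : 0 < q) (q_lt1 : q < 1).
Implicit Types h g : nat -> R.

(** [limn] of a divergent series is a default value, hence the uniform bounds on [h] below. The
    parameter is explicit because [phi_difference] nests the means of two parameters. *)
Definition gmean (p : R) h : R :=
  limn (series (fun N => (1 - p) * p ^+ N * h N)).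

Local Notation gm := (gmean q).

Let p_ge0 N : 0 <= (1 - q) * q ^+ N.
Proof. by rewrite mulr_ge0 ?exprn_ge0 ?subr_ge0 // ltW. Qed.

Lemma cvg_geometric_weight :
  series (fun N => (1 - q) * q ^+ N) @ \oo --> (1 : R).
Proof.
have q1 : `|q| < 1 by rewrite ger0_norm // ltW.
have := @cvg_geometric_series R (1 - q) q q1.
by rewrite divff // subr_eq0 eq_sym lt_eqF.
Qed.

Lemma is_cvg_gmean h K : (forall N, `|h N| <= K) ->
  cvgn (series (fun N => (1 - q) * q ^+ N * h N)).
Proof.
move=> hK; apply: normed_cvg.
apply: (@series_le_cvg _ _ (fun N => K *: ((1 - q) * q ^+ N))).
- by move=> n /=.
- by move=> n /=; rewrite /GRing.scale /= mulr_ge0 // (le_trans _ (hK 0%N)).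
- move=> n /=; rewrite normrM ger0_norm // /GRing.scale /= mulrC.
  by rewrite ler_wpM2r.
- apply: (@is_cvg_seriesZ R (fun N => (1 - q) * q ^+ N) K).
  by apply/cvg_ex; exists 1; exact: cvg_geometric_weight.
Qed.

Lemma gmean_cst c : gm (fun=> c) = c.
Proof.
rewrite /gmean (_ : (fun N => _) = c *: (fun N => (1 - q) * q ^+ N)); last first.
  by apply/funext => N; rewrite mulrC.
rewrite lim_seriesZ; last by apply/cvg_ex; exists 1; exact: cvg_geometric_weight.
by rewrite (cvg_lim _ cvg_geometric_weight) // /GRing.scale /= mulr1.
Qed.

Lemma gmeanD h g K L : (forall N, `|h N| <= K) -> (forall N, `|g N| <= L) ->
  gm (fun N => h N + g N) = gm h + gm g.
Proof.
move=> hK gL; rewrite /gmean -lim_seriesD; try exact: is_cvg_gmean.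
by congr (limn (series _)); apply/funext => N /=; rewrite mulrDr.
Qed.

Lemma gmeanZ c h K : (forall N, `|h N| <= K) ->
  gm (fun N => c * h N) = c * gm h.
Proof.
move=> hK; rewrite /gmean -[RHS]/(c *: _) -lim_seriesZ; last exact: is_cvg_gmean.
by congr (limn (series _)); apply/funext => N /=; rewrite mulrCA.
Qed.

Lemma gmeanB h g K L : (forall N, `|h N| <= K) -> (forall N, `|g N| <= L) ->
  gm (fun N => h N - g N) = gm h - gm g.
Proof.
move=> hK gL; under [X in gm X]funext => N do rewrite -mulN1r.
have gL' N : `|-1 * g N| <= L by rewrite normrM normrN1 mul1r.
by rewrite (gmeanD hK gL') (gmeanZ _ gL) mulN1r.
Qed.

Lemma gmean_le h g K L : (forall N, `|h N| <= K) -> (forall N, `|g N| <= L) ->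
  (forall N, h N <= g N) -> gm h <= gm g.
Proof.
move=> hK gL hg; apply: lim_series_le; try exact: is_cvg_gmean.
by move=> n; rewrite ler_wpM2l.
Qed.

Lemma gmean_norm h K : (forall N, `|h N| <= K) -> `|gm h| <= K.
Proof.
move=> hK; rewrite ler_norml; apply/andP; split.
  rewrite -[X in X <= _]gmean_cst; apply: (gmean_le (K := K) (L := K)) => // N.
    by rewrite normrN ger0_norm // (le_trans _ (hK 0%N)).
  by have := hK N; rewrite ler_norml => /andP[].
rewrite -[X in _ <= X]gmean_cst; apply: (gmean_le (K := K) (L := K)) => // N.
  by rewrite ger0_norm // (le_trans _ (hK 0%N)).
by have := hK N; rewrite ler_norml => /andP[].
Qed.

Lemma gmean_psum h K n : (forall N, `|h N| <= K) -> (forall N, 0 <= h N) ->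
  \sum_(N < n) (1 - q) * q ^+ N * h N <= gm h.
Proof.
move=> hK h0; rewrite -(big_mkord xpredT (fun N => (1 - q) * q ^+ N * h N)).
rewrite -[X in X <= _]/(series (fun N => (1 - q) * q ^+ N * h N) n).
apply: nondecreasing_cvgn_le; last exact: is_cvg_gmean.
by apply/nondecreasing_seqP => k; rewrite seriesSr lerDl mulr_ge0.
Qed.

Lemma gmean_term h K n : (forall N, `|h N| <= K) -> (forall N, 0 <= h N) ->
  (1 - q) * q ^+ n * h n <= gm h.
Proof.
move=> hK h0; apply: le_trans (gmean_psum n.+1 hK h0).
rewrite big_ord_recr /= lerDr sumr_ge0 // => i _; exact: mulr_ge0.
Qed.

Lemma gmean_ge0 h K : (forall N, `|h N| <= K) -> (forall N, 0 <= h N) ->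
  0 <= gm h.
Proof. by move=> hK h0; have := gmean_psum 0 hK h0; rewrite big_ord0. Qed.

(** Memorylessness: once the first bit is a one, the number of further ones has the same law. *)
Lemma gmean_recl h K : (forall N, `|h N| <= K) ->
  gm h = (1 - q) * h 0%N + q * gm (fun N => h N.+1).
Proof.
move=> hK; apply: cvg_lim => //; rewrite -(cvg_shiftn 1) /=.
rewrite (_ : (fun n => _) = (fun n => (1 - q) * h 0%N +
    q * series (fun N => (1 - q) * q ^+ N * h N.+1) n)); last first.
  apply/funext => n; rewrite addn1 /series /= big_nat_recl // expr0 mulr1.
  congr (_ + _); rewrite mulr_sumr; apply: eq_bigr => i _.
  by rewrite exprS; ring.
apply: cvgD; first exact: cvg_cst.
by apply: cvgMl_tmp; exact: (@is_cvg_gmean (fun N => h N.+1) K).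
Qed.

(** [gmean_recl] peels off m terms, each eventually at most e; the remainder has weight q^m and is
    bounded by K. *)
Let gmean_cvg0 (h : nat -> nat -> R) K m :
  (forall n N, `|h n N| <= K) -> (forall N, h n N @[n --> \oo] --> (0 : R)) ->
  forall e, 0 < e -> \forall n \near \oo, `|gm (h n)| <= e + q ^+ m * K.
Proof.
elim: m h => [|m IH] h hK h0 e e0.
  near=> n; rewrite expr0 mul1r; apply: (le_trans (gmean_norm (hK n))).
  by rewrite lerDr ltW.
have := IH (fun n N => h n N.+1) (fun n N => hK n N.+1) (fun N => h0 N.+1) e e0.
have := h0 0%N => /cvgrPdist_le /(_ e e0) H1 H2; near=> n.
rewrite (gmean_recl (hK n)); apply: (le_trans (ler_normD _ _)).
rewrite !normrM (ger0_norm (ltW q_gt0)).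
rewrite (ger0_norm (_ : 0 <= 1 - q)); last by rewrite subr_ge0 ltW.
have A : `|h n 0%N| <= e by near: n; apply: filterS H1 => n; rewrite sub0r normrN.
have B : `|gm (fun N => h n N.+1)| <= e + q ^+ m * K by near: n.
apply: (@le_trans _ _ ((1 - q) * e + q * (e + q ^+ m * K))).
  by apply: lerD; apply: ler_wpM2l => //; rewrite ?subr_ge0 ltW.
by rewrite le_eqVlt; apply/orP; left; apply/eqP; rewrite exprS; ring.
Unshelve. all: by end_near. Qed.

Lemma gmean_tannery (h : nat -> nat -> R) (l : nat -> R) K :
  (forall n N, `|h n N| <= K) -> (forall N, h n N @[n --> \oo] --> l N) ->
  gm (h n) @[n --> \oo] --> gm l.
Proof.
move=> hK hl.
have lK N : `|l N| <= K.
  have H : `|h n N| @[n --> \oo] --> `|l N| by apply: cvg_norm; exact: hl.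
  by apply: (cvgr_to_le H); near=> n; exact: hK.
have dK n N : `|h n N - l N| <= K + K.
  by rewrite (le_trans (ler_normB _ _)) // lerD.
apply/cvgrPdist_le => e e0.
have e2 : 0 < e / 2 by rewrite divr_gt0.
have qn : (K + K) * q ^+ m @[m --> \oo] --> (0 : R).
  have q1 : `|q| < 1 by rewrite ger0_norm // ltW.
  exact: (cvg_geometric (K + K) q1).
have /cvgrPdist_le /(_ _ e2) [m _ /(_ m (leqnn m))] := qn.
rewrite /= sub0r normrN => mK.
have d0 N : h n N - l N @[n --> \oo] --> (0 : R).
  by rewrite -(subrr (l N)); apply: cvgB (hl N) _; exact: cvg_cst.
have H := @gmean_cvg0 (fun n N => h n N - l N) (K + K) m dK d0 _ e2.
near=> n; rewrite -normrN opprB -(gmeanB (hK n) lK).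
have A : `|gm (fun N => h n N - l N)| <= e / 2 + q ^+ m * (K + K) by near: n.
apply: (le_trans A); rewrite [leRHS]splitr lerD2l mulrC.
exact: (le_trans (ler_norm _) mK).
Unshelve. all: by end_near. Qed.

End geometric_mean.

(** * Backward iteration of the affine recursion *)

Section chain.
Context {R : realType}.
Variables (q : R) (A B : nat -> R) (alpha beta : R).
Hypotheses (q_gt0 : 0 < q) (q_lt1 : q < 1).
Hypotheses (A_gt0 : forall N, 0 < A N) (A_le : forall N, A N <= alpha).
Hypotheses (B_ge0 : forall N, 0 <= B N) (B_le : forall N, B N <= beta).
Implicit Types (e : nat -> R) (f g : R -> R).

Local Notation gm := (gmean q).

(* Mean of [f] over [n] random bits, read from the most recent one: [k] is the
   length of the current run of ones, each zero closes a run and composes with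
   [y |-> B k + A k * y], and [e k] is the value given to an unfinished run. *)
Fixpoint chain_mean e n k f : R :=
  match n with
  | 0 => f (e k)
  | m.+1 => q * chain_mean e m k.+1 f +
            (1 - q) * chain_mean e m 0 (fun y => f (B k + A k * y))
  end.

(** The value 0 for the open run makes the means monotone in n; the value [B] gives the exact law
    ([bit_mean_chain]). *)
Local Notation low := (chain_mean (fun=> 0)).

Let q_ge0 : 0 <= q. Proof. exact: ltW. Qed.
Let q'_ge0 : 0 <= 1 - q. Proof. by rewrite subr_ge0 ltW. Qed.
Let aff_ge0 k y : 0 <= y -> 0 <= B k + A k * y.
Proof. by move=> y0; rewrite addr_ge0 // mulr_ge0 // ltW. Qed.

Lemma chain_mean_le e n k f g : (forall i, 0 <= e i) ->
  (forall y, 0 <= y -> f y <= g y) -> chain_mean e n k f <= chain_mean e n k g.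
Proof.
move=> e0; elim: n k f g => [|n IH] k f g fg /=; first exact: fg.
by apply: lerD; apply: ler_wpM2l => //; apply: IH => // y y0; exact/fg/aff_ge0.
Qed.

Lemma chain_mean_ext e n k f g : (forall i, 0 <= e i) ->
  (forall y, 0 <= y -> f y = g y) -> chain_mean e n k f = chain_mean e n k g.
Proof.
by move=> e0 fg; apply/le_anti/andP; split; apply: chain_mean_le => // y y0;
  rewrite fg.
Qed.

Lemma chain_mean_lin e n k c f g :
  chain_mean e n k (fun y => c * f y + g y) =
  c * chain_mean e n k f + chain_mean e n k g.
Proof.
elim: n k f g => [|n IH] k f g //=.
by rewrite !IH; ring.
Qed.

Lemma chain_mean_cst e n k c : chain_mean e n k (fun=> c) = c.
Proof. by elim: n k => [|n IH] k //=; rewrite !IH; ring. Qed.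

Lemma chain_meanZ e n k c f :
  chain_mean e n k (fun y => c * f y) = c * chain_mean e n k f.
Proof.
have := chain_mean_lin e n k c f (fun=> 0); rewrite chain_mean_cst addr0 => <-.
by congr chain_mean; apply/funext => y; rewrite addr0.
Qed.

Lemma chain_meanB e n k f g :
  chain_mean e n k (fun y => f y - g y) =
  chain_mean e n k f - chain_mean e n k g.
Proof.
rewrite [RHS]addrC -mulN1r -chain_mean_lin.
by congr chain_mean; apply/funext => y; rewrite mulN1r addrC.
Qed.

(** One more bit either keeps the value 0 of the open run or, being a zero, turns it into B k >=
    0. *)
Lemma low_monoS n k f : (forall y z, 0 <= y -> y <= z -> f y <= f z) ->
  low n k f <= low n.+1 k f.
Proof.
elim: n k f => [|n IH] k f fnd.
  rewrite /= mulr0 addr0.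
  have := fnd 0 (B k) (lexx _) (B_ge0 k) => H.
  by have := ler_wpM2l q'_ge0 H; nra.
rewrite [leLHS]/= [leRHS]/=; apply: lerD; apply: ler_wpM2l => //; first exact: IH.
apply: IH => y z y0 yz; apply: fnd; first exact: aff_ge0.
by rewrite lerD2l ler_wpM2l // ltW.
Qed.

Lemma low_mono n m k f : (forall y z, 0 <= y -> y <= z -> f y <= f z) ->
  (n <= m)%N -> low n k f <= low m k f.
Proof.
move=> fnd; elim: m => [|m IH]; first by rewrite leqn0 => /eqP ->.
rewrite leq_eqVlt ltnS => /predU1P[->//|/IH /le_trans]; apply.
exact: low_monoS.
Qed.

Lemma low_le_chain n k f : (forall y z, 0 <= y -> y <= z -> f y <= f z) ->
  low n k f <= chain_mean B n k f.
Proof.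
elim: n k f => [|n IH] k f fnd; first exact: fnd.
rewrite /=; apply: lerD; apply: ler_wpM2l => //; first exact: IH.
apply: IH => y z y0 yz; apply: fnd; first exact: aff_ge0.
by rewrite lerD2l ler_wpM2l // ltW.
Qed.

(** Conditioning on the first zero, met after N further ones; the last term is the event that all n
    bits are ones. *)
Lemma low_block n k f : low n k f =
  \sum_(N < n) (1 - q) * q ^+ N *
     low (n - N.+1) 0 (fun y => f (B (k + N)%N + A (k + N)%N * y)) + q ^+ n * f 0.
Proof.
elim: n k => [|n IH] k; first by rewrite big_ord0 add0r expr0 mul1r.
rewrite [LHS]/= IH big_ord_recl /= subSS subn0 addn0 expr0 mulr1.
rewrite mulrDr mulr_sumr.
have -> : \sum_(i < n) q * ((1 - q) * q ^+ i * low (n - i.+1) 0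
      (fun y => f (B (k.+1 + i)%N + A (k.+1 + i)%N * y))) =
    \sum_(i < n) (1 - q) * q ^+ bump 0 i * low (n.+1 - (bump 0 i).+1) 0
      (fun y => f (B (k + bump 0 i)%N + A (k + bump 0 i)%N * y)).
  apply: eq_bigr => i _; rewrite /bump /= add1n subSS addSnnS exprS.
  by rewrite !mulrA [q * (1 - q)]mulrC.
by rewrite exprS; ring.
Qed.

Lemma powA_le kap N : 0 <= kap -> `|A N `^ kap| <= alpha `^ kap.
Proof.
move=> k0; rewrite ger0_norm ?powR_ge0 // ge0_ler_powR ?nnegrE ?(ltW (A_gt0 N)) //.
by rewrite (le_trans (ltW (A_gt0 N))).
Qed.

(** The part of the mean of A^kap due to a run, already of length k, that closes within n bits. For
    k = 0 it is a partial sum of the full mean. *)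
Definition run_sum kap n k : R := \sum_(N < n) (1 - q) * q ^+ N * A (k + N)%N `^ kap.

Lemma run_sumS kap n k :
  run_sum kap n.+1 k = (1 - q) * A k `^ kap + q * run_sum kap n k.+1.
Proof.
rewrite /run_sum big_ord_recl /= expr0 mulr1 addn0 mulr_sumr; congr (_ + _).
apply: eq_bigr => i _; rewrite /bump /= add1n exprS addSnnS.
by rewrite !mulrA [q * (1 - q)]mulrC.
Qed.

Lemma run_sum_le kap n : 0 < kap -> run_sum kap n 0 <= gm (fun N => A N `^ kap).
Proof.
move=> /ltW k0; have bd N := powA_le N k0.
exact: (gmean_psum q_gt0 q_lt1 n bd (fun N => powR_ge0 _ _)).
Qed.

(** Each closed run multiplies the moment by phi < 1 in mean; the room below 1 absorbs the additive
    term B for every kap, without a triangle inequality. *)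
Lemma low_moment kap : 0 < kap -> gm (fun N => A N `^ kap) < 1 ->
  exists2 C, 0 <= C & forall n, low n 0 (fun y => y `^ kap) <= C.
Proof.
move=> k0; set phi := gm _ => phi1.
have beta0 : 0 <= beta by rewrite (le_trans (B_ge0 0)).
have phi0 : 0 <= phi by apply: (gmean_ge0 q_gt0 q_lt1 (fun N => powA_le N (ltW k0))) => N; exact: powR_ge0.
(* 1 / r is the midpoint of phi and 1, so r > 1 and still r phi < 1. *)
pose r := 2 / (1 + phi).
have r1 : 1 < r by rewrite /r ltr_pdivlMr; lra.
have rphi : r * phi < 1 by rewrite /r mulrAC ltr_pdivrMr; lra.
have r0 : 0 < r by lra.
pose th := r `^ kap^-1 - 1.
have th0 : 0 < th.
  rewrite subr_gt0 -[X in X < _](powRr0 r) /powR gt_eqF // ltr_expR mul0r.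
  by rewrite mulr_gt0 ?invr_gt0 // ln_gt0.
have thE : (1 + th) `^ kap = r.
  by rewrite addrC subrK -powRrM mulVf ?gt_eqF // powRr1 // ltW.
pose c := (beta + beta / th) `^ kap.
have c0 : 0 <= c by exact: powR_ge0.
(* Either B <= th A y, at the cost of the factor (1 + th)^kap = r, or A y < beta / th and the whole
   is at most c. *)
have step k y : 0 <= y ->
    (B k + A k * y) `^ kap <= r * A k `^ kap * y `^ kap + c.
  move=> y0; have Ay0 : 0 <= A k * y by rewrite mulr_ge0 // ltW.
  have [le|lt] := leP beta (th * (A k * y)).
    apply: (@le_trans _ _ (((1 + th) * (A k * y)) `^ kap)).
      rewrite ge0_ler_powR ?nnegrE ?aff_ge0 ?(ltW k0) //.
        by rewrite mulr_ge0 // addr_ge0 // ltW.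
      by rewrite mulrDl mul1r addrC lerD2l (le_trans (B_le k)).
    have th1 : 0 <= 1 + th by apply: addr_ge0 => //; exact: ltW.
    by rewrite (powRM _ th1 Ay0) thE (powRM _ (ltW (A_gt0 k)) y0) mulrA lerDl.
  apply: (@le_trans _ _ c); last first.
    by rewrite lerDr mulr_ge0 ?powR_ge0 // mulr_ge0 ?powR_ge0 // ltW.
  rewrite ge0_ler_powR ?nnegrE ?aff_ge0 ?(ltW k0) //.
    by rewrite addr_ge0 // divr_ge0 // ltW.
  by rewrite lerD // ler_pdivlMr // mulrC ltW.
pose U := run_sum kap.
have US n k : U n.+1 k = (1 - q) * A k `^ kap + q * U n k.+1 by exact: run_sumS.
have U0 n : U n 0%N <= phi by exact: run_sum_le.
(* The fixed point of C = c + r phi C: the bound reproduces itself each time a run closes. *)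
pose C := c / (1 - r * phi).
have C0 : 0 <= C by rewrite divr_ge0 // subr_ge0 ltW.
have CE : c + C * (r * phi) = C.
  rewrite /C; field; by rewrite gt_eqF // subr_gt0.
have H n k : low n k (fun y => y `^ kap) <= c + C * r * U n k.
  elim: n k => [|n IH] k.
    by rewrite /= /U /run_sum big_ord0 mulr0 addr0 powR0 // gt_eqF.
  rewrite /= US.
  have h1 : low n 0 (fun y => (B k + A k * y) `^ kap) <= r * A k `^ kap * C + c.
    apply: (@le_trans _ _ (low n 0 (fun y => r * A k `^ kap * y `^ kap + c))).
      by apply: chain_mean_le => // y y0; exact: step.
    rewrite chain_mean_lin chain_mean_cst lerD2r ler_wpM2l //.
      by rewrite mulr_ge0 ?powR_ge0 // ltW.
    apply: (le_trans (IH 0%N)); rewrite -[leRHS]CE lerD2l -mulrA ler_wpM2l //.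
    by rewrite ler_wpM2l ?U0 // ltW.
  have h2 := IH k.+1.
  have h3 := ler_wpM2l q'_ge0 h1.
  have h4 := ler_wpM2l q_ge0 h2.
  by apply: (le_trans (lerD h4 h3)); rewrite le_eqVlt; apply/orP; left;
    apply/eqP; ring.
exists C => // n; apply: (le_trans (H n 0%N)).
by rewrite -[leRHS]CE lerD2l -mulrA ler_wpM2l // ler_wpM2l ?U0 // ltW.
Qed.

(** Mean of the kap-th power of the product of [A] over the closed runs times [B] of the open run,
    that is, of the distance between the chains ended with 0 and with [B]. *)
Fixpoint run_gap kap n k : R :=
  match n with
  | 0 => B k `^ kap
  | m.+1 => q * run_gap kap m k.+1 + (1 - q) * A k `^ kap * run_gap kap m 0
  end.

Lemma run_gap_ge0 kap n k : 0 <= run_gap kap n k.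
Proof.
elim: n k => [|n IH] k /=; first exact: powR_ge0.
by rewrite addr_ge0 // mulr_ge0 // mulr_ge0 // powR_ge0.
Qed.

(** Composing with y -> B k + A k y multiplies the Hoelder constant by A k^kap, the factor met in
    [run_gap]. *)
Lemma chain_le_low kap n k f L : 0 < kap -> 0 <= L ->
  (forall y z, 0 <= y -> y <= z -> f z - f y <= L * (z - y) `^ kap) ->
  chain_mean B n k f <= low n k f + L * run_gap kap n k.
Proof.
move=> k0; elim: n k f L => [|n IH] k f L L0 hf.
  by have := hf 0 (B k) (lexx _) (B_ge0 k); rewrite subr0 /= lerBlDl.
rewrite /=.
have h1 := IH k.+1 f L L0 hf.
have h2 : chain_mean B n 0 (fun y => f (B k + A k * y)) <=
    low n 0 (fun y => f (B k + A k * y)) + (L * A k `^ kap) * run_gap kap n 0.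
  apply: IH => [|y z y0 yz]; first by rewrite mulr_ge0 // powR_ge0.
  apply: (le_trans (hf _ _ (aff_ge0 k y0) _)).
    by rewrite lerD2l ler_wpM2l // ltW.
  rewrite -mulrA -powRM ?(ltW (A_gt0 k)) // ?subr_ge0 //.
  rewrite (_ : _ - _ = A k * (z - y)) //; ring.
have h3 := ler_wpM2l q_ge0 h1.
have h4 := ler_wpM2l q'_ge0 h2.
by apply: (le_trans (lerD h3 h4)); rewrite le_eqVlt; apply/orP; left;
  apply/eqP; ring.
Qed.

(** The terms are summable over n: an open run costs at most beta^kap during a mean time 1 / (1 -
    q), and j closed runs weigh phi^j, whence the total bound D. *)
Lemma cvg_run_gap kap : 0 < kap -> gm (fun N => A N `^ kap) < 1 ->
  run_gap kap n 0 @[n --> \oo] --> (0 : R).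
Proof.
move=> k0; set phi := gm _ => phi1.
have beta0 : 0 <= beta by rewrite (le_trans (B_ge0 0)).
pose U := run_sum kap.
have US n k : U n.+1 k = (1 - q) * A k `^ kap + q * U n k.+1 by exact: run_sumS.
have U0 n : U n 0%N <= phi by exact: run_sum_le.
have q'0 : 0 < 1 - q by rewrite subr_gt0.
have phi'0 : 0 < 1 - phi by rewrite subr_gt0.
pose c := beta `^ kap / (1 - q).
have c0 : 0 <= c by rewrite divr_ge0 ?powR_ge0.
pose D := c / (1 - phi).
have D0 : 0 <= D by rewrite divr_ge0 // ltW.
have DE : c + D * phi = D by rewrite /D; field; rewrite gt_eqF.
pose S K k := \sum_(n < K) run_gap kap n k.
have SS K k : S K.+1 k =
    B k `^ kap + q * S K k.+1 + (1 - q) * A k `^ kap * S K 0%N.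
  rewrite /S big_ord_recl /= -addrA; congr (_ + _).
  by rewrite !mulr_sumr -big_split; apply: eq_bigr => i _.
have H K k : S K k <= c + D * U K k.
  elim: K k => [|K IH] k.
    by rewrite /S /U /run_sum !big_ord0 mulr0 addr0.
  rewrite SS US.
  have h1 : S K 0%N <= D.
    by apply: (le_trans (IH 0%N)); rewrite -[leRHS]DE lerD2l ler_wpM2l.
  have h2 : B k `^ kap <= (1 - q) * c.
    rewrite /c mulrCA divff ?gt_eqF // mulr1.
    by rewrite ge0_ler_powR ?nnegrE // ltW.
  have h3 := ler_wpM2l q_ge0 (IH k.+1).
  have h4 := ler_wpM2l (mulr_ge0 q'_ge0 (powR_ge0 (A k) kap)) h1.
  apply: (le_trans (lerD (lerD h2 h3) h4)); rewrite le_eqVlt; apply/orP; left;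
    apply/eqP; ring.
apply: cvg_series_cvg_0; apply: nondecreasing_is_cvgn.
  by apply/nondecreasing_seqP => n; rewrite seriesSr lerDl run_gap_ge0.
exists D => _ [n _ <-]; rewrite /series /= big_mkord -/(S n 0%N).
by apply: (le_trans (H n 0%N)); rewrite -[leRHS]DE lerD2l ler_wpM2l.
Qed.

(** * Limits along the increasing approximation *)

Definition nonneg_nd K f :=
  (forall y, 0 <= y -> 0 <= f y <= K) /\
  (forall y z, 0 <= y -> y <= z -> f y <= f z).

(** For bounded nondecreasing [f], mass escaping to infinity counts with the supremum of [f]; this
    is how [tail] can equal 1 everywhere. *)
Definition low_lim f := limn (fun n => low n 0 f).

Lemma low_bound K f n k : nonneg_nd K f -> 0 <= low n k f <= K.
Proof.
move=> [fK fnd]; apply/andP; split.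
  rewrite -[X in X <= _](chain_mean_cst (fun=> 0) n k).
  by apply: chain_mean_le => // y /fK/andP[].
rewrite -[X in _ <= X](chain_mean_cst (fun=> 0) n k).
by apply: chain_mean_le => // y /fK/andP[].
Qed.

Lemma cvg_low K f : nonneg_nd K f -> low n 0 f @[n --> \oo] --> low_lim f.
Proof.
move=> fK; apply: nondecreasing_is_cvgn.
  by move=> n m nm; apply: low_mono => //; case: fK.
by exists K => _ [n _ <-]; have /andP[] := low_bound n 0 fK.
Qed.

Lemma low_le_lim K f n : nonneg_nd K f -> low n 0 f <= low_lim f.
Proof.
move=> fK; apply: nondecreasing_cvgn_le.
  by move=> i m im; apply: low_mono => //; case: fK.
by apply/cvg_ex; exists (low_lim f); exact: cvg_low fK.
Qed.

Lemma low_lim_bound K f : nonneg_nd K f -> 0 <= low_lim f <= K.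
Proof.
move=> fK; have H := cvg_low fK; apply/andP; split.
  by apply: (cvgr_to_ge H); apply: nearW => n; have /andP[] := low_bound n 0 fK.
by apply: (cvgr_to_le H); apply: nearW => n; have /andP[] := low_bound n 0 fK.
Qed.

Lemma nonneg_nd_aff K f c d : 0 <= c -> 0 <= d -> nonneg_nd K f ->
  nonneg_nd K (fun y => f (c + d * y)).
Proof.
move=> c0 d0 [fK fnd]; split=> [y y0|y z y0 yz].
  by apply: fK; rewrite addr_ge0 // mulr_ge0.
by apply: fnd; rewrite ?addr_ge0 ?mulr_ge0 // lerD2l ler_wpM2l.
Qed.

Lemma low_lim_le K f g : nonneg_nd K f -> nonneg_nd K g ->
  (forall y, 0 <= y -> f y <= g y) -> low_lim f <= low_lim g.
Proof.
move=> fK gK fg; apply: (ler_cvg_to (cvg_low fK) (cvg_low gK)).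
by apply: nearW => n; exact: chain_mean_le.
Qed.

(** The identity W = B_N + A_N W in law, from [low_block] by dominated convergence. *)
Lemma low_lim_fix K f : nonneg_nd K f ->
  low_lim f = gm (fun N => low_lim (fun y => f (B N + A N * y))).
Proof.
move=> fK; pose g N y := f (B N + A N * y).
have gK N : nonneg_nd K (g N) by apply: nonneg_nd_aff => //; exact: ltW.
(* The cut at N < n turns the finite sum of [low_block] into a geometric mean, to which
   [gmean_tannery] applies. *)
pose h n N := if (N < n)%N then low (n - N.+1) 0 (g N) else 0.
have K0 : 0 <= K.
  by have /andP[+ +] := fK.1 0 (lexx 0); exact: le_trans.
have hK n N : `|h n N| <= K.
  rewrite /h; case: ifP => _; last by rewrite normr0.
  by have /andP[l0 lK] := low_bound (n - N.+1) 0 (gK N); rewrite ger0_norm.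
have hE n : low n 0 f = gm (h n) + q ^+ n * f 0.
  rewrite low_block; congr (_ + _).
  have -> : gm (h n) = \sum_(N < n) (1 - q) * q ^+ N * h n N; last first.
    by apply: eq_bigr => i _; rewrite /h ltn_ord.
  apply: cvg_lim => //; apply: cvg_near_cst; exists n => // m /= nm.
  rewrite /series /= (big_cat_nat _ nm) //= big_mkord [X in _ + X]big_nat_cond.
  rewrite [X in _ + X]big1 ?addr0 //.
  by move=> i /andP[/andP[ni _] _]; rewrite /h ltnNge ni /= mulr0.
have lim2 : low n 0 f @[n --> \oo] --> gm (fun N => low_lim (g N)) + 0 * f 0.
  under eq_fun do rewrite hE.
  apply: cvgD.
    apply: (gmean_tannery q_gt0 q_lt1 hK) => N.
    rewrite -(cvg_shiftn N.+1) /=.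
    rewrite (_ : (fun n => _) = (fun n => low n 0 (g N))); first exact: (cvg_low (gK N)).
    by apply/funext => n; rewrite /h addnS ltnS leq_addl subSS addnK.
  apply: cvgMr_tmp; apply: cvg_expr; by rewrite ger0_norm.
by rewrite -[RHS]addr0 -[X in _ + X](mul0r (f 0)); apply: cvg_lim.
Qed.

End chain.

(** * Dense additive semigroups of the line *)

Section dense_semigroup.
Context {R : realType}.
Variable S : set R.
Hypothesis S_add : forall x y, S x -> S y -> S (x + y).

Let S_addn x y n : S x -> S y -> S (x + y *+ n).
Proof.
by move=> Sx Sy; elim: n => [|n IH]; rewrite ?addr0 // mulrSr addrA; exact: S_add.
Qed.

(** Suppose all nonzero elements have size at least e. Take s > 0 and - t < 0 in S nearly minimal in
    size: s - t is too short to be a nonzero element, so s = t and S is stable under shifts by s in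
    both directions. A non-multiple of s then leaves a remainder y in (0, s), and y - s lies in (-
    e, 0). *)
Lemma semigroup_small : (exists2 x, S x & 0 < x) -> (exists2 x, S x & x < 0) ->
  (forall d, 0 < d -> exists2 x, S x & forall z : int, x != z%:~R * d) ->
  forall e, 0 < e -> exists x, [/\ S x, x != 0 & `|x| < e].
Proof.
move=> [p Sp p0] [m Sm m0] nonlat e e0; apply: contrapT => noS.
have far x : S x -> x != 0 -> e <= `|x|.
  by move=> Sx x0; rewrite leNgt; apply/negP => xe; apply: noS; exists x.
pose P := [set x | S x /\ 0 < x]; pose N := [set x | S (- x) /\ 0 < x].
have lbP : has_lbound P by exists 0 => x [_ /ltW].
have lbN : has_lbound N by exists 0 => x [_ /ltW].
have infP : has_inf P by split => //; exists p.
have infN : has_inf N.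
  by split => //; exists (- m); split; rewrite ?opprK // oppr_gt0.
have [s [Ss s0] sP] := inf_adherent e0 infP.
have [t [St t0] tN] := inf_adherent e0 infN.
have leP x : S x -> 0 < x -> inf P <= x by move=> Sx x0; exact: ge_inf.
have leN x : S (- x) -> 0 < x -> inf N <= x by move=> Sx x0; exact: ge_inf.
have se : e <= s by have := far _ Ss; rewrite gtr0_norm // gt_eqF //; exact.
have te : e <= t.
  by have := far _ St; rewrite normrN gtr0_norm // oppr_eq0 gt_eqF //; exact.
have st : s = t.
  apply/eqP; rewrite -subr_eq0; apply/negP => /negP nz.
  have [lt0|gt0|/eqP] := ltgtP (s - t) 0; last by rewrite (negbTE nz).
    have : S (- (t - s)) by rewrite opprB; exact: S_add.
    move/leN; rewrite subr_gt0 -subr_lt0 => /(_ lt0); lra.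
  by have := leP _ (S_add Ss St) gt0; lra.
rewrite -{t t0 te tN}st in St.
have [x Sx xN] := nonlat s s0.
pose z := Num.floor (x / s).
have zle : z%:~R * s <= x by rewrite -ler_pdivlMr // floor_le.
have zgt : x < z%:~R * s + s.
  by rewrite -[X in _ + X]mul1r -mulrDl -ltr_pdivrMr // -(intrD _ z 1) floorD1_gt.
have Sy : S (x - z%:~R * s).
  case: (z) => n; first by rewrite -pmulrn mulr_natl -mulNrn; exact: S_addn.
  by rewrite NegzE mulrNz mulNr opprK -pmulrn mulr_natl; exact: S_addn.
have y0 : 0 < x - z%:~R * s by rewrite subr_gt0 lt_neqAle zle andbT eq_sym.
have Pe := leP _ Sy y0.
have := far _ (S_add Sy St); rewrite ltr0_norm; last by lra.
rewrite lt_eqF; last by lra.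
by move=> /(_ isT); lra.
Qed.

Lemma dense_semigroup : (exists2 x, S x & 0 < x) -> (exists2 x, S x & x < 0) ->
  (forall d, 0 < d -> exists2 x, S x & forall z : int, x != z%:~R * d) ->
  forall t e, 0 < e -> exists2 x, S x & t < x < t + e.
Proof.
move=> Sp Sm nonlat t e e0.
have [x [Sx x0 xe]] := semigroup_small Sp Sm nonlat e0.
(* If the short element x is negative, go down from some p > 0 by steps x and stop at the last
   positive value, which is at most - x. *)
have [y Sy /andP[y0 ye]] : exists2 y, S y & 0 < y < e.
  have [lt0|gt0|/eqP] := ltgtP x 0; last by rewrite (negbTE x0).
    move: xe; rewrite ltr0_norm // => xe.
    have [p Spp p0] := Sp.
    have xN0 : 0 < - x by rewrite oppr_gt0.
    pose n := `|Num.ceil (p / - x)|%N.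
    have pn : 0 < p / - x by rewrite divr_gt0.
    have nE : n%:R = (Num.ceil (p / - x))%:~R :> R.
      rewrite pmulrn /n gez0_abs // -(ler_int R) (le_trans _ (ceil_ge _)) //.
      exact: ltW.
    have n0 : (0 < n)%N.
      rewrite -(ltr0n R) nE; exact: (lt_le_trans pn (ceil_ge _)).
    exists (p + x *+ n.-1); first exact: S_addn.
    have h1 : p <= n%:R * - x by rewrite -ler_pdivrMr // nE ceil_ge.
    have h2 : (n%:R - 1) * - x < p.
      by rewrite -ltr_pdivlMr // nE -(intrB _ _ 1) ceilB1_lt.
    have -> : p + x *+ n.-1 = p + (n%:R - 1) * x.
      by rewrite -[x *+ _]mulr_natl -subn1 natrB.
    by apply/andP; split; nra.
  by move: xe; rewrite gtr0_norm // => xe; exists x => //; rewrite gt0.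
have [m Smm m0] := Sm.
(* Start to the left of t, then climb by steps y < e. Since 0 need not belong to S, multiples are
   always added to an element, here a first copy of m. *)
pose k := (Num.bound `|t / m|).+1.
have km : m + m *+ k < t.
  have kt : `|t / m| < k%:R.
    by rewrite (lt_trans (archi_boundP _)) ?normr_ge0 ?ltr_nat //.
  have : t / m < k%:R by rewrite (le_lt_trans (ler_norm _)).
  rewrite ltr_ndivrMr // => H.
  by rewrite -[m *+ k]mulr_natl; lra.
pose j := (Num.truncn ((t - (m + m *+ k)) / y)).+1.
have dy : 0 <= (t - (m + m *+ k)) / y by rewrite divr_ge0 // ?subr_ge0 ltW.
exists (m + m *+ k + y *+ j); first by apply: S_addn => //; exact: S_addn.
have /andP[j1 j2] := truncn_itv dy.
have j3 : t - (m + m *+ k) < j%:R * y by rewrite -ltr_pdivrMr.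
have j4 : (j%:R - 1) * y <= t - (m + m *+ k).
  by rewrite -ler_pdivlMr // /j -natr1 addrK.
rewrite -[y *+ j]mulr_natl; apply/andP; split; lra.
Qed.

End dense_semigroup.

(** * Tail and truncated moments of the limit law *)

Section powR_facts.
Context {R : realType}.
Implicit Types (x y z s : R).

Lemma powRDpos x r s : 0 < x -> x `^ (r + s) = x `^ r * x `^ s.
Proof. by move=> x0; rewrite powRD // [x == 0]gt_eqF ?implybT. Qed.

Lemma powRBpos x r s : 0 < x -> x `^ (r - s) = x `^ r / x `^ s.
Proof. by move=> x0; rewrite powRB // [x == 0]gt_eqF ?implybT. Qed.

Lemma ler_powR_pos x y s : 0 <= s -> 0 <= x -> x <= y -> x `^ s <= y `^ s.
Proof. by move=> s0 x0 xy; rewrite ge0_ler_powR ?nnegrE // (le_trans x0). Qed.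

Lemma ler_powR_neg x y s : s <= 0 -> 0 < x -> x <= y -> y `^ s <= x `^ s.
Proof.
move=> s0 x0 xy; rewrite -[s]opprK !(powRN _ (- s)).
rewrite lef_pV2 ?posrE ?powR_gt0 ?(lt_le_trans x0) //.
by apply: ler_powR_pos; rewrite ?oppr_ge0 // ltW.
Qed.

Lemma powRXn x s n : 0 <= x -> (x ^+ n) `^ s = (x `^ s) ^+ n.
Proof.
move=> x0; rewrite -(powR_mulrn n x0) -(powR_mulrn n (powR_ge0 x s)).
by rewrite -!powRrM mulrC.
Qed.

Lemma expR_sub1_le t : expR t - 1 <= t * expR t :> R.
Proof.
have := expR_ge1Dx (- t); rewrite expRN => H.
have e0 := expR_gt0 t.
have := ler_wpM2r (ltW e0) H; rewrite mulVf ?gt_eqF //; lra.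
Qed.

Lemma powR_onePlus_le u s : 0 <= u -> 0 <= s -> (1 + u) `^ s <= expR (s * u).
Proof.
move=> u0 s0; rewrite [s * u]mulrC expRM; apply: ler_powR_pos => //.
  by rewrite addr_ge0.
exact: expR_ge1Dx.
Qed.

(** For large z the increment is of order z^(s - 1), which z^kap dominates as s - 1 <= kap. *)
Lemma powR_addl_le s kap beta : 0 < s -> 0 < kap -> s - kap <= 1 -> 0 <= beta ->
  exists2 C, 0 <= C & forall z B, 0 <= z -> 0 <= B -> B <= beta ->
    (B + z) `^ s - z `^ s <= C * (1 + z `^ kap).
Proof.
(* Positive even when beta = 0; for z >= b, B / z <= 1 keeps the exponential factor below exp(s). *)
move=> s0 k0 sk beta0; pose b := beta + 1.
have b0 : 0 < b by rewrite /b; lra.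
pose D := s * b * expR s * b `^ (s - 1 - kap).
have D0 : 0 <= D by rewrite !mulr_ge0 ?powR_ge0 ?expR_ge0 ?ltW.
have E0 : 0 <= (b + b) `^ s by exact: powR_ge0.
exists ((b + b) `^ s + D); first by rewrite addr_ge0.
move=> z B z0 B0 Bb; have Bb' : B <= b by rewrite /b; lra.
have zk := powR_ge0 z kap.
have [zb|bz] := ltP z b.
  have H : (B + z) `^ s <= (b + b) `^ s.
    by apply: ler_powR_pos; [exact: ltW|exact: addr_ge0|apply: lerD => //; exact: ltW].
  have := powR_ge0 z s; nra.
have zp : 0 < z by exact: lt_le_trans bz.
have -> : B + z = z * (1 + B / z) by field; rewrite gt_eqF.
have u0 : 0 <= B / z by rewrite divr_ge0.
rewrite powRM // ?addr_ge0 //.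
have h1 := powR_onePlus_le u0 (ltW s0).
have h2 := expR_sub1_le (s * (B / z)).
have u1 : B / z <= b / z by rewrite ler_pM2r ?invr_gt0.
have u2 : b / z <= 1 by rewrite ler_pdivrMr // mul1r.
have h3 : s * (B / z) * expR (s * (B / z)) <= s * (b / z) * expR s.
  apply: ler_pM; [exact: mulr_ge0 (ltW s0) u0|exact: expR_ge0|by rewrite ler_pM2l|].
  by rewrite ler_expR -[leRHS]mulr1 ler_pM2l // (le_trans u1).
have h4 : (1 + B / z) `^ s - 1 <= s * (b / z) * expR s by lra.
have h5 := ler_wpM2l (powR_ge0 z s) h4.
have h6 : z `^ s * (s * (b / z) * expR s) = s * b * expR s * z `^ (s - 1 - kap) * z `^ kap.
  rewrite -[RHS]mulrA -powRDpos // subrK.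
  rewrite powRBpos // powRr1 ?ltW //.
  by field; rewrite gt_eqF.
have h7 : s * b * expR s * z `^ (s - 1 - kap) <= D.
  have sb : 0 <= s * b * expR s by rewrite !mulr_ge0 ?expR_ge0 ?ltW.
  rewrite /D; apply: ler_wpM2l => //.
  by apply: ler_powR_neg => //; lra.
have h8 := ler_wpM2r zk h7.
nra.
Qed.

End powR_facts.

(** * The fixed-point equation for tails and truncated moments *)

Section truncated_moments.
Context {R : realType}.
Variables (q : R) (A B : nat -> R) (alpha beta : R).
Hypotheses (q_gt0 : 0 < q) (q_lt1 : q < 1).
Hypotheses (A_gt0 : forall N, 0 < A N) (A_le : forall N, A N <= alpha).
Hypotheses (B_ge0 : forall N, 0 <= B N) (B_le : forall N, B N <= beta).

Local Notation gm := (gmean q).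
Local Notation low := (chain_mean q A B (fun=> 0)).
Local Notation lim := (low_lim q A B).

Definition above (x y : R) : R := (x < y)%R%:R.

Lemma nonneg_nd_above x : nonneg_nd 1 (above x).
Proof.
split=> [y _|y z _ yz]; rewrite /above; first by rewrite ler0n lern1 leq_b1.
have [xy|_] := ltP x y; first by rewrite (lt_le_trans xy yz).
exact: ler0n.
Qed.

Definition tail x := lim (above x).

Lemma tail_bound x : 0 <= tail x <= 1.
Proof. exact: low_lim_bound (nonneg_nd_above x). Qed.

Lemma tail_nonincr x y : x <= y -> tail y <= tail x.
Proof.
move=> xy; apply: (low_lim_le q_gt0 q_lt1 A_gt0 B_ge0 (nonneg_nd_above _) (nonneg_nd_above _)) => // z _.
rewrite /above; have [yz|_] := ltP y z; first by rewrite (le_lt_trans xy yz).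
exact: ler0n.
Qed.

Lemma tail_fix x : tail x = gm (fun N => tail ((x - B N) / A N)).
Proof.
rewrite {1}/tail (low_lim_fix q_gt0 q_lt1 A_gt0 B_ge0 (nonneg_nd_above x)) //.
congr gmean; apply/funext => N; rewrite /tail; congr low_lim; apply/funext => y.
by rewrite /above ltr_pdivrMr // ltrBlDl mulrC.
Qed.

Lemma tail_lt0 x : x < 0 -> tail x = 1.
Proof.
move=> x0; apply: cvg_lim => //.
rewrite (_ : (fun n => _) = fun=> 1); first exact: cvg_cst.
apply/funext => n; rewrite -[RHS](chain_mean_cst q A B (fun=> 0) n 0 1).
by apply: chain_mean_ext => // y y0; rewrite /above (lt_le_trans x0 y0).
Qed.

(** [tail] is the supremum of the means [low n], and each of these is constant on a short interval
    to the right of x. *)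
Lemma tail_right_continuous x e : 0 < e ->
  exists2 y, x < y & tail x - e < tail y.
Proof.
move=> e0; have H := cvg_low q_gt0 q_lt1 A_gt0 B_ge0 (nonneg_nd_above x).
have /cvgrPdist_lt /(_ _ e0) [n _ /(_ n (leqnn n)) /=] := H.
have rc k m : exists2 y, x < y & low m k (above x) = low m k (above y).
  elim: m k {H} x => [|m IH] k x.
    have [x0|x0] := ltP x 0; last first.
      by exists (x + 1); rewrite /= /above ?ltrDl // !ltNge x0 (le_trans x0) // lerDl.
    by exists (x / 2); rewrite /= /above ?x0; [lra|have -> : x / 2 < 0 by lra].
  have [y1 xy1 h1] := IH k.+1 x.
  have [y2 xy2 h2] := IH 0%N ((x - B k) / A k).
  have E u : low m 0 (fun y => above u (B k + A k * y)) = low m 0 (above ((u - B k) / A k)).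
    congr chain_mean; apply/funext => y.
    by rewrite /above ltr_pdivrMr // ltrBlDl mulrC.
  pose y := Num.min y1 (A k * y2 + B k).
  have xy : x < y.
    by rewrite lt_min xy1 -ltrBlDr mulrC -ltr_pdivrMr.
  exists y => //=; rewrite !E.
  have mono j u v : u <= v -> low m j (above v) <= low m j (above u).
    move=> uv; apply: chain_mean_le => // z _; rewrite /above.
    have [vz|_] := ltP v z; first by rewrite (le_lt_trans uv vz).
    exact: ler0n.
  congr (_ * _ + _ * _); apply/le_anti/andP; split.
  - by rewrite h1; apply: mono; rewrite ge_min lexx.
  - by apply: mono; exact: ltW.
  - rewrite h2; apply: mono; rewrite ler_pdivrMr // lerBlDr mulrC.
    by rewrite ge_min lexx orbT.
  - by apply: mono; rewrite ler_pM2r ?invr_gt0 // lerB // ltW.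
have [y xy ->] := rc 0%N n => d.
exists y => //.
have := low_le_lim q_gt0 q_lt1 A_gt0 B_ge0 n (nonneg_nd_above y).
rewrite -/(tail y) => h.
by move: d; rewrite -/(tail x) => /(le_lt_trans (ler_norm _)); lra.
Qed.

Variable s : R.
Hypothesis s_gt0 : 0 < s.

Definition trunc_pow (x y : R) : R := (Num.min y x) `^ s.

Lemma nonneg_nd_trunc x : 0 < x -> nonneg_nd (x `^ s) (trunc_pow x).
Proof.
move=> x0; split=> [y y0|y z y0 yz]; rewrite /trunc_pow.
  rewrite powR_ge0 /=; apply: ler_powR_pos; rewrite ?le_min ?y0 ?(ltW x0) ?(ltW s_gt0) //.
  by rewrite ge_min lexx orbT.
apply: ler_powR_pos; rewrite ?le_min ?y0 ?(ltW x0) ?(ltW s_gt0) //.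
by rewrite ge_min yz ge_min lexx orbT.
Qed.

(** Clamping z to [x, y] makes it visible that the increment in the truncation level is
    nondecreasing in z. *)
Lemma trunc_diff x y z : 0 < x -> x <= y ->
  trunc_pow y z - trunc_pow x z = (Num.min (Num.max z x) y) `^ s - x `^ s.
Proof.
move=> x0 xy; rewrite /trunc_pow.
have [zx|xz] := leP z x.
  by rewrite min_l ?(le_trans zx) // min_l // !subrr.
by [].
Qed.

Definition tmom x := lim (trunc_pow x).

Lemma tmom_bound x : 0 < x -> 0 <= tmom x <= x `^ s.
Proof. by move=> x0; apply: low_lim_bound => //; exact: nonneg_nd_trunc. Qed.

Let cvgT x : 0 < x -> low n 0 (trunc_pow x) @[n --> \oo] --> tmom x.
Proof. by move=> x0; apply: cvg_low; last exact: nonneg_nd_trunc. Qed.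

Let cvgA x : low n 0 (above x) @[n --> \oo] --> tail x.
Proof. by apply: cvg_low; last exact: nonneg_nd_above. Qed.

Lemma tmom_diff_le x y : 0 < x -> x <= y ->
  tmom y - tmom x <= tail x * (y `^ s - x `^ s).
Proof.
move=> x0 xy; have y0 : 0 < y by exact: lt_le_trans xy.
have h : x `^ s <= y `^ s by apply: ler_powR_pos => //; exact: ltW.
have H1 : low n 0 (trunc_pow y) - low n 0 (trunc_pow x) @[n --> \oo] --> tmom y - tmom x.
  by apply: cvgB; exact: cvgT.
have H2 : low n 0 (above x) * (y `^ s - x `^ s) @[n --> \oo] -->
    tail x * (y `^ s - x `^ s) by apply: cvgMr_tmp; exact: cvgA.
apply: (ler_cvg_to H1 H2); apply: nearW => n /=.
rewrite -chain_meanB [leRHS]mulrC -chain_meanZ; apply: chain_mean_le => // z z0.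
rewrite trunc_diff // /above; have [xz|zx] := ltP x z; last first.
  by rewrite min_l // subrr mulr0.
rewrite mulr1 lerD2r; apply: ler_powR_pos; first exact: ltW.
  by rewrite le_min (ltW (lt_trans x0 xz)) ltW.
by rewrite ge_min lexx orbT.
Qed.

Lemma tmom_diff_ge x y : 0 < x -> x <= y ->
  tail y * (y `^ s - x `^ s) <= tmom y - tmom x.
Proof.
move=> x0 xy; have y0 : 0 < y by exact: lt_le_trans xy.
have h : x `^ s <= y `^ s by apply: ler_powR_pos => //; exact: ltW.
have H1 : low n 0 (trunc_pow y) - low n 0 (trunc_pow x) @[n --> \oo] --> tmom y - tmom x.
  by apply: cvgB; exact: cvgT.
have H2 : low n 0 (above y) * (y `^ s - x `^ s) @[n --> \oo] -->
    tail y * (y `^ s - x `^ s) by apply: cvgMr_tmp; exact: cvgA.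
apply: (ler_cvg_to H2 H1); apply: nearW => n /=.
rewrite -chain_meanB [leLHS]mulrC -chain_meanZ; apply: chain_mean_le => // z z0.
rewrite trunc_diff // /above; have [yz|zy] := ltP y z.
  by rewrite mulr1 max_l ?(le_trans xy (ltW yz)) // min_r // ltW.
rewrite mulr0 subr_ge0; apply: ler_powR_pos; rewrite ?(ltW s_gt0) ?(ltW x0) //.
by rewrite le_min xy andbT le_max lexx orbT.
Qed.

Variable kap : R.
Hypotheses (kap_gt0 : 0 < kap) (kap_lts : kap < s).
Hypothesis phi_lt1 : gm (fun N => A N `^ kap) < 1.

(** Markov's inequality at order kap, and min(y, x)^s <= x^(s - kap) y^kap. *)
Lemma tail_tmom_decay : exists2 C, 0 <= C & forall x, 0 < x ->
  tail x <= C * x `^ (- kap) /\ tmom x <= C * x `^ (s - kap).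
Proof.
have [C C0 HC] := low_moment q_gt0 q_lt1 A_gt0 A_le B_ge0 B_le kap_gt0 phi_lt1.
exists C => // x x0; split.
  apply: (cvgr_to_le (@cvgA x)); apply: nearW => n.
  apply: (@le_trans _ _ (low n 0 (fun y => x `^ (- kap) * y `^ kap))).
    apply: chain_mean_le => // y y0; rewrite /above.
    have [xy|_] := ltP x y; last by rewrite mulr_ge0 ?powR_ge0.
    rewrite powRN mulrC ler_pdivlMr ?powR_gt0 // mul1r.
    by apply: ler_powR_pos; rewrite ?(ltW kap_gt0) ?(ltW x0) ?(ltW xy).
  by rewrite chain_meanZ mulrC ler_wpM2r ?powR_ge0.
apply: (cvgr_to_le (cvgT x0)); apply: nearW => n.
apply: (@le_trans _ _ (low n 0 (fun y => x `^ (s - kap) * y `^ kap))).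
  apply: chain_mean_le => // y y0; rewrite /trunc_pow.
  have [y00|yp] := leP y 0.
    have -> : y = 0 by apply/le_anti; rewrite y00.
    by rewrite min_l ?(ltW x0) // powR0 ?gt_eqF // mulr_ge0 ?powR_ge0.
  have mp : 0 < Num.min y x by rewrite lt_min yp.
  rewrite -[s in leLHS](subrK kap) (powRDpos _ _ mp).
  apply: ler_pM; rewrite ?powR_ge0 //; apply: ler_powR_pos; rewrite ?subr_ge0 ?(ltW kap_gt0) ?(ltW kap_lts) ?(ltW mp) //.
    by rewrite ge_min lexx orbT.
  by rewrite ge_min lexx.
by rewrite chain_meanZ mulrC ler_wpM2r ?powR_ge0.
Qed.

Hypothesis skap : s - kap <= 1.

Let lim_scale x N : 0 < x ->
  lim (fun y => trunc_pow x (A N * y)) = A N `^ s * tmom (x / A N).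
Proof.
move=> x0; have An0 := A_gt0 N.
have xA : 0 < x / A N by rewrite divr_gt0.
apply: cvg_lim => //; have H : A N `^ s * low n 0 (trunc_pow (x / A N)) @[n --> \oo] --> A N `^ s * tmom (x / A N).
  by apply: cvgMl_tmp; exact: cvgT.
apply: (cvg_trans _ H); apply: near_eq_cvg; apply: nearW => n.
rewrite -chain_meanZ; apply: chain_mean_ext => // y y0.
rewrite /trunc_pow -powRM ?(ltW An0) ?le_min ?y0 ?(ltW xA) //.
by rewrite minr_pMr ?(ltW An0) // mulrCA divff ?gt_eqF // mulr1.
Qed.

(** Contribution of a first run of length N to Psi, which is the mean of this over N ([defectE]). *)
Definition defect x N :=
  lim (fun y => trunc_pow x (B N + A N * y)) - lim (fun y => trunc_pow x (A N * y)).

Let nndB x N : 0 < x -> nonneg_nd (x `^ s) (fun y => trunc_pow x (B N + A N * y)).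
Proof. by move=> x0; apply: nonneg_nd_aff; rewrite ?(ltW (A_gt0 N)) //; exact: nonneg_nd_trunc. Qed.

Let nnd0 x N : 0 < x -> nonneg_nd (x `^ s) (fun y => trunc_pow x (A N * y)).
Proof.
move=> x0; have := @nonneg_nd_aff _ _ _ 0 (A N) (lexx 0) (ltW (A_gt0 N)) (nonneg_nd_trunc x0).
by under eq_fun do rewrite add0r.
Qed.

Let cvgD' x N (x0 : 0 < x) :
  low n 0 (fun y => trunc_pow x (B N + A N * y) - trunc_pow x (A N * y)) @[n --> \oo]
    --> defect x N.
Proof.
under eq_fun do rewrite chain_meanB.
apply: cvgB; apply: cvg_low => //; [exact: nndB|exact: nnd0].
Qed.

(** Truncation only shrinks the increment of the s-th power from A W to B + A W, and s - kap <= 1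
    bounds that increment by a moment of order kap. *)
Lemma defect_bound : exists2 c, 0 <= c & forall x N, 0 < x -> 0 <= defect x N <= c.
Proof.
have beta0 : 0 <= beta by rewrite (le_trans (B_ge0 0)).
have alpha0 : 0 < alpha by rewrite (lt_le_trans (A_gt0 0)).
have [C C0 HC] := low_moment q_gt0 q_lt1 A_gt0 A_le B_ge0 B_le kap_gt0 phi_lt1.
have [D D0 HD] := powR_addl_le s_gt0 kap_gt0 skap beta0.
exists (D * (1 + alpha `^ kap * C)).
  by rewrite mulr_ge0 // addr_ge0 // mulr_ge0 // powR_ge0.
move=> x N x0; have H := @cvgD' x N x0; apply/andP; split.
  apply: (cvgr_to_ge H); apply: nearW => n.
  rewrite -[leLHS](chain_mean_cst q A B (fun=> 0) n 0 0).
  apply: chain_mean_le => // y y0; rewrite subr_ge0.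
  by apply: (nonneg_nd_trunc x0).2; rewrite ?mulr_ge0 ?(ltW (A_gt0 _)) // lerDr.
apply: (cvgr_to_le H); apply: nearW => n.
apply: (@le_trans _ _ (low n 0 (fun y => (D * alpha `^ kap) * y `^ kap + D))); last first.
  rewrite chain_mean_lin chain_mean_cst mulrDr mulr1 addrC lerD2l mulrA.
  by rewrite ler_wpM2l // mulr_ge0 ?powR_ge0.
apply: chain_mean_le => // y y0.
have Ay0 : 0 <= A N * y by rewrite mulr_ge0 // ltW.
have ByAy : A N * y <= B N + A N * y by rewrite lerDr.
apply: (@le_trans _ _ ((B N + A N * y) `^ s - (A N * y) `^ s)); last first.
  apply: (le_trans (HD _ _ Ay0 (B_ge0 N) (B_le N))).
  rewrite mulrDr mulr1 addrC lerD2r -mulrA ler_wpM2l // powRM ?(ltW (A_gt0 N)) //.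
  by rewrite ler_wpM2r ?powR_ge0 //; apply: ler_powR_pos; rewrite ?(ltW kap_gt0) ?(ltW (A_gt0 N)).
rewrite /trunc_pow; have [h|h] := leP (A N * y) x.
  rewrite lerD2r; apply: ler_powR_pos; rewrite ?(ltW s_gt0) //.
    by rewrite le_min (ltW x0) (le_trans Ay0).
  by rewrite ge_min lexx.
rewrite min_r ?subrr ?subr_ge0; first by apply: ler_powR_pos; rewrite ?(ltW s_gt0).
by rewrite (le_trans (ltW h)).
Qed.

(** Raising the truncation level gains at least as much at B + A W as at A W, by the monotonicity
    behind [trunc_diff]. *)
Lemma defect_nd x y N : 0 < x -> x <= y -> defect x N <= defect y N.
Proof.
move=> x0 xy; have y0 : 0 < y by exact: lt_le_trans xy.
apply: (ler_cvg_to (@cvgD' x N x0) (@cvgD' y N y0)); apply: nearW => n.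
apply: chain_mean_le => // z z0.
have Ay0 : 0 <= A N * z by rewrite mulr_ge0 // ltW.
have ByAy : A N * z <= B N + A N * z by rewrite lerDr.
rewrite -subr_ge0.
have -> : trunc_pow y (B N + A N * z) - trunc_pow y (A N * z) -
    (trunc_pow x (B N + A N * z) - trunc_pow x (A N * z)) =
    (trunc_pow y (B N + A N * z) - trunc_pow x (B N + A N * z)) -
    (trunc_pow y (A N * z) - trunc_pow x (A N * z)) by ring.
rewrite !trunc_diff // subr_ge0 lerD2r; apply: ler_powR_pos.
- exact: ltW.
- by rewrite le_min le_max Ay0 (ltW y0).
- by rewrite le_min !ge_min lexx orbT andbT ge_max !le_max ByAy lexx orbT.
Qed.

Let defectE x : 0 < x ->
  gm (defect x) = tmom x - gm (fun N => A N `^ s * tmom (x / A N)).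
Proof.
move=> x0.
have bB N : `|lim (fun y => trunc_pow x (B N + A N * y))| <= x `^ s.
  have /andP[h1 h2] := low_lim_bound q_gt0 q_lt1 A_gt0 B_ge0 (nndB N x0).
  by rewrite ger0_norm.
have b0 N : `|lim (fun y => trunc_pow x (A N * y))| <= x `^ s.
  have /andP[h1 h2] := low_lim_bound q_gt0 q_lt1 A_gt0 B_ge0 (nnd0 N x0).
  by rewrite ger0_norm.
rewrite /defect (gmeanB q_gt0 q_lt1 bB b0); congr (_ - _).
  by rewrite /tmom (low_lim_fix q_gt0 q_lt1 A_gt0 B_ge0 (nonneg_nd_trunc x0)).
by congr gmean; apply/funext => N; rewrite lim_scale.
Qed.

Lemma tmom_defect : exists2 c, 0 <= c & forall x, 0 < x ->
  0 <= tmom x - gm (fun N => A N `^ s * tmom (x / A N)) <= c.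
Proof.
have [c c0 H] := defect_bound; exists c => // x x0; rewrite -defectE //.
have bd N : `|defect x N| <= c by have /andP[h1 h2] := H x N x0; rewrite ger0_norm.
rewrite (gmean_ge0 q_gt0 q_lt1 bd); last by move=> N; have /andP[] := H x N x0.
exact: (le_trans (ler_norm _) (gmean_norm q_gt0 q_lt1 bd)).
Qed.

Lemma tmom_defect_nd x y : 0 < x -> x <= y ->
  tmom x - gm (fun N => A N `^ s * tmom (x / A N)) <=
  tmom y - gm (fun N => A N `^ s * tmom (y / A N)).
Proof.
move=> x0 xy; have y0 : 0 < y by exact: lt_le_trans xy.
rewrite -(defectE x0) -(defectE y0); have [c c0 H] := defect_bound.
have bd z N : 0 < z -> `|defect z N| <= c.
  by move=> z0; have /andP[h1 h2] := H z N z0; rewrite ger0_norm.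
apply: (gmean_le q_gt0 q_lt1 (bd x ^~ x0) (bd y ^~ y0)) => N.
exact: defect_nd.
Qed.

(** At level b the variable B + A W is always truncated and contributes b^s, while the contribution
    of A W is of order A_N^kap, hence smaller for some N. *)
Lemma tmom_defect_pos b : 0 < b -> (forall N, b <= B N) ->
  (forall d, 0 < d -> exists N, A N < d) ->
  exists2 x, 0 < x & 0 < tmom x - gm (fun N => A N `^ s * tmom (x / A N)).
Proof.
move=> b0 bB Asmall; exists b => //; rewrite -defectE //.
have [C C0 HC] := tail_tmom_decay.
have [c c0 H] := defect_bound.
have bd N : `|defect b N| <= c by have /andP[h1 h2] := H b N b0; rewrite ger0_norm.
(* Solves (C + 1) b^(s - kap) d^kap = b^s; the 1 guards against C = 0. *)
pose d := (b `^ s / ((C + 1) * b `^ (s - kap))) `^ kap^-1.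
have C1 : 0 < (C + 1) * b `^ (s - kap).
  by rewrite mulr_gt0 ?powR_gt0 // ltr_wpDl.
have d0 : 0 < d by rewrite powR_gt0 // divr_gt0 ?powR_gt0.
have [N AN] := Asmall d d0.
have H0 i : 0 <= defect b i by have /andP[] := H b i b0.
apply: (lt_le_trans _ (gmean_term q_gt0 q_lt1 N bd H0)).
rewrite mulr_gt0 ?mulr_gt0 ?exprn_gt0 ?subr_gt0 //.
have An0 := A_gt0 N.
have bA : 0 < b / A N by rewrite divr_gt0.
rewrite (lim_scale N b0).
have -> : lim (fun y => trunc_pow b (B N + A N * y)) = b `^ s.
  apply: cvg_lim => //; rewrite (_ : (fun n => _) = fun=> b `^ s); first exact: cvg_cst.
  apply/funext => n; rewrite -[RHS](chain_mean_cst q A B (fun=> 0) n 0).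
  apply: chain_mean_ext => // y y0; rewrite /trunc_pow min_r //.
  by rewrite (le_trans (bB N)) // lerDl mulr_ge0 // ltW.
apply: (@le_lt_trans _ _ (C * b `^ (s - kap) * A N `^ kap)).
  apply: (@le_trans _ _ (A N `^ s * (C * (b / A N) `^ (s - kap)))).
    by rewrite ler_wpM2l ?powR_ge0 //; case: (HC _ bA).
  rewrite powRM ?(ltW b0) ?invr_ge0 ?(ltW An0) // -[(A N)^-1]powR_inv1 ?(ltW An0) //.
  rewrite -powRrM mulN1r opprB.
  rewrite le_eqVlt; apply/orP; left; apply/eqP.
  have <- : A N `^ s * A N `^ (kap - s) = A N `^ kap by rewrite -powRDpos // addrC subrK.
  ring.
have : A N `^ kap < d `^ kap.
  by apply: gt0_ltr_powR; rewrite ?nnegrE ?ltW.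
rewrite /d -powRrM mulVf ?gt_eqF // powRr1; last by rewrite divr_ge0 ?powR_ge0 // ltW.
rewrite ltr_pdivlMr //.
have := powR_gt0 (s - kap) b0; have := powR_gt0 kap An0; set u := _ `^ _; set v := _ `^ _.
nra.
Qed.

End truncated_moments.

(** * Power tail in the contractive case *)

Section limsup_sequence.
Context {R : realType}.

(** M is the infimum of the eventual upper bounds. Used for the normalised tail and for its
    opposite. *)
Lemma limsup_sequence (F : R -> R) K : (forall x, 0 < x -> `|F x| <= K) ->
  exists M, exists u : nat -> R,
  [/\ u n @[n --> \oo] --> +oo, F (u n) @[n --> \oo] --> M &
   forall e, 0 < e -> exists X, forall x, X <= x -> F x <= M + e].
Proof.
move=> FK; pose E := [set z | exists X, forall x, X <= x -> F x <= z].
have EK : E K by exists 1 => x x1; rewrite (le_trans (ler_norm _)) // FK // (lt_le_trans _ x1).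
have lbE : lbound E (- K).
  move=> z [X HX]; have [m1 m2] : X <= Num.max X 1 /\ 1 <= Num.max X 1.
    by rewrite !le_max !lexx orbT.
  have := FK _ (lt_le_trans ltr01 m2); rewrite ler_norml => /andP[h _].
  exact: le_trans h (HX _ m1).
have infE : has_inf E by split; [exists K|exists (- K)].
pose M := inf E.
have up e : 0 < e -> exists X, forall x, X <= x -> F x <= M + e.
  move=> e0; have [z [X HX] zM] := inf_adherent e0 infE.
  by exists X => x /HX h; rewrite (le_trans h) // ltW.
have lo e X : 0 < e -> exists2 x, X <= x & M - e < F x.
  move=> e0; apply: contrapT => noX.
  have : E (M - e).
    by exists X => x Xx; rewrite leNgt; apply/negP => h; apply: noX; exists x.
  move=> /(ge_inf infE.2); rewrite -/M; lra.
have ex n : exists x, n%:R <= x /\ M - n.+1%:R^-1 < F x.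
  by have [|x h1 h2] := lo n.+1%:R^-1 n%:R; [rewrite invr_gt0|exists x].
have [u Hu] := choice ex.
have uy : u n @[n --> \oo] --> +oo.
  apply/cvgryPge => a; near=> n; apply: le_trans (Hu n).1; near: n.
  exact: nbhs_infty_ger.
exists M, u; split => //.
apply/cvgrPdist_le => e e0; have [X HX] := up e e0.
have uX : \forall n \near \oo, X <= u n by exact: cvgry_ge.
near=> n; rewrite distrC ler_distl; apply/andP; split.
  apply/ltW/(le_lt_trans _ (Hu n).2); rewrite lerD2l lerN2.
  by apply/ltW; near: n; exact: (near_infty_natSinv_lt (PosNum e0)).
by apply: HX; near: n.
Unshelve. all: by end_near. Qed.

End limsup_sequence.

(** * Renewal argument for the normalised tail *)

Section renewal.
Context {R : realType}.
Variables (q : R) (A : nat -> R) (alpha : R).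
Hypotheses (q_gt0 : 0 < q) (q_lt1 : q < 1).
Hypotheses (A_gt0 : forall N, 0 < A N) (A_le : forall N, A N <= alpha).
Hypothesis alpha_ge1 : 1 <= alpha.
Local Notation gm := (gmean q).

Variables s kap : R.
Hypotheses (s_gt0 : 0 < s) (kap_gt0 : 0 < kap) (kap_lts : kap < s).
Hypothesis phi_s : gm (fun N => A N `^ s) = 1.
Hypothesis phi_kap : gm (fun N => A N `^ kap) < 1.
Hypothesis dense : forall t e, 0 < e ->
  exists w : seq nat, t < \sum_(i <- w) ln (A i) < t + e.

Let alpha0 : 0 < alpha. Proof. exact: lt_le_trans alpha_ge1. Qed.

Let powA_bound r N : 0 <= r -> `|A N `^ r| <= alpha `^ r.
Proof. exact: powA_le. Qed.

(** The A_N may approach 0: there, ln y < y at y = A^(-s) gives - A^s ln A <= 1 / s. *)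
Lemma powA_ln_bound N : `|A N `^ s * ln (A N)| <= alpha `^ s * alpha + s^-1.
Proof.
have A0 := A_gt0 N; have As := powR_gt0 s A0.
have h1 := ln_sublinear A0.
have h2 : - (s * ln (A N)) <= (A N `^ s)^-1.
  by rewrite -ln_powR -lnV ?posrE // ltW // ln_sublinear // invr_gt0.
have si : 0 < s^-1 by rewrite invr_gt0.
have as0 := powR_gt0 s alpha0.
have h3 : A N `^ s <= alpha `^ s by apply: ler_powR_pos; rewrite ?(ltW s_gt0) ?(ltW A0).
rewrite ler_norml; apply/andP; split; last first.
  have h4 : A N `^ s * ln (A N) <= A N `^ s * alpha.
    by rewrite ler_wpM2l ?(ltW As) // (le_trans (ltW h1)).
  have := ler_wpM2r (ltW alpha0) h3; lra.
have h5 : s * (- (A N `^ s * ln (A N))) <= 1.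
  have := ler_wpM2l (ltW As) h2; rewrite divff ?gt_eqF //; lra.
have h6 : - (A N `^ s * ln (A N)) <= s^-1.
  by rewrite -[s^-1]div1r ler_pdivlMr // mulrC.
have := mulr_gt0 as0 alpha0; lra.
Qed.

(** The derivative of sig -> E[A^sig] at s, and the mean step ln A_N under the tilted weights. *)
Definition drift := gm (fun N => A N `^ s * ln (A N)).

(** E[A^sig] is convex in sig, below 1 at kap < s and equal to 1 at s, so its slope at s is
    positive; the tangent inequality for exp is applied term by term. *)
Lemma drift_gt0 : 0 < drift.
Proof.
pose d := s - kap; have d0 : 0 < d by rewrite subr_gt0.
have bs N := powA_bound N (ltW s_gt0).
have bk N := powA_bound N (ltW kap_gt0).
have bd N : `|d * (A N `^ s * ln (A N))| <= d * (alpha `^ s * alpha + s^-1).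
  by rewrite normrM (gtr0_norm d0) ler_wpM2l ?(ltW d0) // powA_ln_bound.
have H : 1 - d * drift <= gm (fun N => A N `^ kap).
  rewrite -phi_s /drift -(gmeanZ q_gt0 q_lt1 d powA_ln_bound).
  rewrite -(gmeanB q_gt0 q_lt1 bs bd).
  have bb N : `|A N `^ s - d * (A N `^ s * ln (A N))| <=
      alpha `^ s + d * (alpha `^ s * alpha + s^-1).
    by rewrite (le_trans (ler_normB _ _)) // lerD.
  apply: (gmean_le q_gt0 q_lt1 bb bk) => N.
  have -> : kap = s + - d by rewrite /d; ring.
  have E : A N `^ (- d) = expR (- d * ln (A N)) by rewrite /powR gt_eqF.
  rewrite powRDpos // E.
  have := ler_wpM2l (powR_ge0 (A N) s) (expR_ge1Dx (- d * ln (A N))); lra.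
by have := le_lt_trans H phi_kap; rewrite gtrBl pmulr_rgt0.
Qed.

Variables G Phi : R -> R.
Hypothesis G_ge0 : forall x, 0 <= G x.
Hypothesis G_ni : forall x y, x <= y -> G y <= G x.
Hypothesis Phi_up : forall x y, 0 < x -> x <= y ->
  Phi y - Phi x <= G x * (y `^ s - x `^ s).
Hypothesis Phi_lo : forall x y, 0 < x -> x <= y ->
  G y * (y `^ s - x `^ s) <= Phi y - Phi x.
Hypothesis Phi_ge0 : forall x, 0 < x -> 0 <= Phi x.
Hypothesis Phi_le : forall x, 0 < x -> Phi x <= x `^ s.
Variables C c : R.
Hypotheses (C_ge0 : 0 <= C) (c_ge0 : 0 <= c).
Hypothesis Phi_decay : forall x, 0 < x -> Phi x <= C * x `^ (s - kap).

Definition Phi_defect x := Phi x - gm (fun N => A N `^ s * Phi (x / A N)).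

Hypothesis defect_le : forall x, 0 < x -> Phi_defect x <= c.

Let Phi_nd x y : 0 < x -> x <= y -> Phi x <= Phi y.
Proof.
move=> x0 xy; rewrite -subr_ge0; apply: le_trans (Phi_lo x0 xy).
rewrite mulr_ge0 // subr_ge0; apply: ler_powR_pos => //; exact: ltW.
Qed.

Let bPhi x N : 0 < x -> `|A N `^ s * Phi (x / A N)| <= x `^ s.
Proof.
move=> x0; have xA : 0 < x / A N by rewrite divr_gt0.
rewrite ger0_norm ?mulr_ge0 ?powR_ge0 ?Phi_ge0 //.
apply: (le_trans (ler_wpM2l (powR_ge0 _ _) (Phi_le xA))).
rewrite -powRM ?(ltW (A_gt0 N)) ?(ltW xA) // mulrCA divff ?gt_eqF // mulr1 //.
Qed.

(* Wald's argument: [c / drift * (ln h + ln alpha)] dominates [c] times the mean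
   time the tilted walk with steps [ln (A N)] needs to climb by [ln h], the
   overshoot being at most [ln alpha]; the last term is the contribution of the
   paths that have not climbed that far after [n] steps. *)
Lemma Phi_growth n x h : 0 < x -> 1 <= h ->
  Phi x <= Phi (x / h) + c / drift * (ln h + ln alpha) +
    C * x `^ (s - kap) * (gm (fun N => A N `^ kap)) ^+ n.
Proof.
have m0 := drift_gt0; set phi := gm _.
have phi0 : 0 <= phi.
  by apply: (gmean_ge0 q_gt0 q_lt1 (fun N => powA_bound N (ltW kap_gt0))) => N; exact: powR_ge0.
have cm0 : 0 <= c / drift by rewrite divr_ge0 // ltW.
have la0 : 0 <= ln alpha by exact: ln_ge0.
elim: n x h => [|n IH] x h x0 h1.
  rewrite expr0 mulr1; have h0 : 0 < h by exact: lt_le_trans h1.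
  have := Phi_ge0 (divr_gt0 x0 h0); have := Phi_decay x0.
  have := mulr_ge0 cm0 (addr_ge0 (ln_ge0 h1) la0); lra.
have h0 : 0 < h by exact: lt_le_trans h1.
pose K1 := Phi (x / h) + c / drift * (ln h + ln alpha).
pose K3 := C * x `^ (s - kap) * phi ^+ n.
have K30 : 0 <= K3 by rewrite !mulr_ge0 ?powR_ge0 ?exprn_ge0.
have step N : A N `^ s * Phi (x / A N) <=
    (K1 * A N `^ s + (- (c / drift)) * (A N `^ s * ln (A N))) + K3 * A N `^ kap.
  have A0 := A_gt0 N; have xA : 0 < x / A N by rewrite divr_gt0.
  have -> : K3 * A N `^ kap = A N `^ s * (C * (x / A N) `^ (s - kap) * phi ^+ n).
    rewrite /K3 -[x / A N]/(x * (A N)^-1) powRM ?(ltW x0) ?invr_ge0 ?(ltW A0) //.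
    rewrite -[(A N)^-1]powR_inv1 ?(ltW A0) // -powRrM mulN1r opprB.
    have <- : A N `^ s * A N `^ (kap - s) = A N `^ kap by rewrite -powRDpos // addrC subrK.
    by ring.
  suff H : Phi (x / A N) <= K1 - c / drift * ln (A N) + C * (x / A N) `^ (s - kap) * phi ^+ n.
    by have := ler_wpM2l (powR_ge0 (A N) s) H; lra.
  have lA : ln (A N) <= ln alpha by rewrite ler_ln ?posrE.
  (* Either h / A N >= 1 remains to be climbed towards the same target x / h, or x / A N is already
     below that target. *)
  have [Ah|hA] := leP (A N) h.
    have := IH (x / A N) (h / A N) xA; rewrite ler_pdivlMr // mul1r => /(_ Ah).
    rewrite ln_div ?posrE //.
    have -> : x / A N / (h / A N) = x / h by field; rewrite !gt_eqF.
    by rewrite /K1; lra.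
  have e1 : Phi (x / A N) <= Phi (x / h).
    by apply: Phi_nd => //; rewrite ler_pM2l // lef_pV2 ?posrE // ltW.
  have e2 : 0 <= c / drift * (ln h + ln alpha - ln (A N)).
    by rewrite mulr_ge0 // -addrA addr_ge0 ?ln_ge0 // subr_ge0.
  have e3 : 0 <= C * (x / A N) `^ (s - kap) * phi ^+ n.
    by rewrite !mulr_ge0 ?powR_ge0 ?exprn_ge0.
  by rewrite /K1; lra.
have b1 N : `|K1 * A N `^ s| <= `|K1| * alpha `^ s.
  by rewrite normrM ler_wpM2l // powA_bound // ltW.
have b2 N : `|(- (c / drift)) * (A N `^ s * ln (A N))| <=
    `|c / drift| * (alpha `^ s * alpha + s^-1).
  by rewrite normrM normrN ler_wpM2l // powA_ln_bound.
have b3 N : `|K3 * A N `^ kap| <= K3 * alpha `^ kap.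
  by rewrite normrM (ger0_norm K30) ler_wpM2l // powA_bound // ltW.
have b12 N := le_trans (ler_normD _ _) (lerD (b1 N) (b2 N)).
have b123 N := le_trans (ler_normD _ _) (lerD (b12 N) (b3 N)).
have H := gmean_le q_gt0 q_lt1 (fun N => @bPhi x N x0) b123 step.
move: H; rewrite (gmeanD q_gt0 q_lt1 b12 b3) (gmeanD q_gt0 q_lt1 b1 b2).
rewrite (gmeanZ q_gt0 q_lt1 K1 (fun N => powA_bound N (ltW s_gt0))) phi_s mulr1.
rewrite (gmeanZ q_gt0 q_lt1 K3 (fun N => powA_bound N (ltW kap_gt0))) -/phi.
rewrite (gmeanZ q_gt0 q_lt1 _ powA_ln_bound) -/drift mulNr divfK ?gt_eqF //.
have := defect_le x0; rewrite /Phi_defect /K1 /K3 exprSr; lra.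
Qed.

Definition ptail x := G x * x `^ s.

Lemma ptail_ge0 x : 0 <= ptail x.
Proof. by rewrite mulr_ge0 ?powR_ge0. Qed.

(** Phi x - Phi (x / 2) dominates ptail x (1 - 2^(-s)), and [Phi_growth] with h = 2 and n tending to
    infinity bounds it by D, uniformly in x. *)
Lemma ptail_bounded : exists2 K, 0 <= K & forall x, 0 < x -> ptail x <= K.
Proof.
have m0 := drift_gt0.
have phi0 : 0 <= gm (fun N => A N `^ kap).
  by apply: (gmean_ge0 q_gt0 q_lt1 (fun N => powA_bound N (ltW kap_gt0))) => N; exact: powR_ge0.
pose D := c / drift * (ln 2 + ln alpha).
have D0 : 0 <= D.
  by rewrite mulr_ge0 ?divr_ge0 ?addr_ge0 ?ln_ge0 ?(ltW m0) // ler1n.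
have t2 : 0 < 1 - 2^-1 `^ s :> R.
  rewrite subr_gt0 /powR gt_eqF ?invr_gt0 // -[X in _ < X]expR0 ltr_expR.
  by rewrite pmulr_rlt0 // lnV ?posrE // oppr_lt0 ln_gt0 // ltr1n.
exists (D / (1 - 2^-1 `^ s)); first by rewrite divr_ge0 // ltW.
move=> x x0; rewrite ler_pdivlMr //.
have x2 : 0 < x / 2 by rewrite divr_gt0.
have xx : x / 2 <= x by rewrite ler_pdivrMr // ler_peMr ?(ltW x0) // ler1n.
have <- : G x * (x `^ s - (x / 2) `^ s) = ptail x * (1 - 2^-1 `^ s).
  by rewrite /ptail (powRM _ (ltW x0)) ?invr_ge0 //; ring.
apply: (le_trans (Phi_lo x2 xx)).
have cv : Phi (x / 2) + D + C * x `^ (s - kap) * (gm (fun N => A N `^ kap)) ^+ n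
    @[n --> \oo] --> Phi (x / 2) + D + C * x `^ (s - kap) * 0.
  apply: cvgD; first exact: cvg_cst.
  by apply: cvgMl_tmp; apply: cvg_expr; rewrite ger0_norm.
have : Phi x <= Phi (x / 2) + D + C * x `^ (s - kap) * 0.
  apply: (cvgr_to_ge cv); apply: nearW => n.
  exact: (Phi_growth n x0 (ler1n _ 2)).
rewrite mulr0 addr0; lra.
Qed.

(** One-sided control, from monotonicity of G; it replaces any continuity of the tail. *)
Lemma ptail_scale x y : 0 < x -> x <= y -> ptail y <= (y / x) `^ s * ptail x.
Proof.
move=> x0 xy; have y0 : 0 < y by exact: lt_le_trans xy.
rewrite /ptail mulrCA -powRM ?divr_ge0 ?(ltW x0) ?(ltW y0) // divfK ?gt_eqF //.
by rewrite ler_wpM2r ?powR_ge0 // G_ni.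
Qed.

(* Since the weights [(1 - q) * q ^+ N * A N `^ s] sum to one, this is a maximum
   principle at infinity. *)
Lemma max_principle_step (F : R -> R) (b K M : R) (u : nat -> R) N :
  0 <= b -> (forall x, 0 < x -> `|F x| <= K) ->
  (forall e, 0 < e -> exists X, forall x, X <= x ->
     F x <= gm (fun N => A N `^ s * F ((x - b) / A N)) + e) ->
  (forall e, 0 < e -> exists X, forall x, X <= x -> F x <= M + e) ->
  u n @[n --> \oo] --> +oo -> F (u n) @[n --> \oo] --> M ->
  (u n - b) / A N @[n --> \oo] --> +oo /\ F ((u n - b) / A N) @[n --> \oo] --> M.
Proof.
move=> b0 FK Fsub FM uy uM.
have vy : (u n - b) / A N @[n --> \oo] --> +oo.
  apply/cvgryPge => a; near=> n; rewrite ler_pdivlMr // lerBrDr.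
  by near: n; exact: cvgry_ge.
split => //.
have [p p0 pE] : exists2 p, 0 < p & p = (1 - q) * q ^+ N * A N `^ s.
  exists ((1 - q) * q ^+ N * A N `^ s) => //.
  by rewrite !mulr_gt0 ?exprn_gt0 ?powR_gt0 ?subr_gt0.
apply/cvgrPdist_le => e e0.
(* The errors add up to 3 d, and the term N carries the weight p. *)
pose d := p * e / 3.
have d0 : 0 < d by rewrite !mulr_gt0 // invr_gt0.
have [X1 H1] := Fsub d d0.
have [X2 H2] := FM d d0.
have [X3 H3] := FM e e0.
have e1 : \forall n \near \oo, X1 <= u n by exact: cvgry_ge.
have e2 : \forall n \near \oo, (b + Num.max X2 1 * alpha) < u n by exact: cvgry_gt.
have e3 : \forall n \near \oo, X3 <= (u n - b) / A N by exact: cvgry_ge.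
have /cvgrPdist_le /(_ _ d0) e4 := uM.
near=> n.
have f1 : X1 <= u n by near: n.
have f2 : b + Num.max X2 1 * alpha < u n by near: n.
have f3 : X3 <= (u n - b) / A N by near: n.
have f4 : `|M - F (u n)| <= d by near: n.
have arg i : Num.max X2 1 <= (u n - b) / A i.
  rewrite ler_pdivlMr // lerBrDl; apply: le_trans (ltW f2).
  by rewrite lerD2l ler_wpM2l // le_max ler01 orbT.
have pos i : 0 < (u n - b) / A i.
  by apply: lt_le_trans (arg i); rewrite lt_max ltr01 orbT.
have bd i : `|A i `^ s * F ((u n - b) / A i)| <= alpha `^ s * K.
  rewrite normrM; apply: ler_pM => //; last exact: FK.
  exact: powA_bound (ltW s_gt0).
have bM i : `|(M + d) * A i `^ s| <= `|M + d| * alpha `^ s.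
  by rewrite normrM ler_wpM2l // powA_bound // ltW.
have bb i := le_trans (ler_normB _ _) (lerD (bM i) (bd i)).
have nn i : 0 <= (M + d) * A i `^ s - A i `^ s * F ((u n - b) / A i).
  rewrite mulrC -mulrBr mulr_ge0 ?powR_ge0 // subr_ge0; apply: H2.
  by apply: le_trans (arg i); rewrite le_max lexx.
have := gmean_term q_gt0 q_lt1 N bb nn.
rewrite (gmeanB q_gt0 q_lt1 bM bd).
rewrite (gmeanZ q_gt0 q_lt1 _ (fun N => powA_bound N (ltW s_gt0))) phi_s mulr1.
have -> : (1 - q) * q ^+ N * ((M + d) * A N `^ s - A N `^ s * F ((u n - b) / A N)) =
   p * (M + d - F ((u n - b) / A N)) by rewrite pE; ring.
have := H1 _ f1; move: f4; rewrite ler_distl => /andP[g4 g5] h1 h2.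
rewrite distrC ler_distl H3 // andbT.
have h3 : p * (M + d - F ((u n - b) / A N)) <= p * e by rewrite /d in h1 h2 g5 *; lra.
by move: h3; rewrite ler_pM2l //; lra.
Unshelve. all: by end_near. Qed.

(** Iterating the step along a word w scales the sequence asymptotically by exp(- sum of ln A_i),
    since the shift b is negligible against u n. Density supplies a word whose scale lies in (h1,
    h2). *)
Lemma max_principle (F : R -> R) (b K M : R) (u : nat -> R) :
  0 <= b -> (forall x, 0 < x -> `|F x| <= K) ->
  (forall e, 0 < e -> exists X, forall x, X <= x ->
     F x <= gm (fun N => A N `^ s * F ((x - b) / A N)) + e) ->
  (forall e, 0 < e -> exists X, forall x, X <= x -> F x <= M + e) ->
  u n @[n --> \oo] --> +oo -> F (u n) @[n --> \oo] --> M ->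
  forall h1 h2, 0 < h1 -> h1 < h2 -> exists v : nat -> R,
  [/\ v n @[n --> \oo] --> +oo, F (v n) @[n --> \oo] --> M &
    \forall n \near \oo, h1 * u n < v n < h2 * u n].
Proof.
move=> b0 FK Fsub FM uy uM h1 h2 h10 h12.
have word (w : seq nat) : exists v : nat -> R,
  [/\ v n @[n --> \oo] --> +oo, F (v n) @[n --> \oo] --> M &
    v n / u n @[n --> \oo] --> expR (- \sum_(i <- w) ln (A i))].
  elim: w => [|N w [v [vy vM vu]]].
    exists u; split => //; rewrite big_nil oppr0 expR0.
    have : (fun n => 1 : R) @ \oo --> (1 : R) by exact: cvg_cst.
    apply: cvg_trans; apply: near_eq_cvg; near=> n.
    by rewrite divff // gt_eqF //; near: n; exact: cvgry_gt.
  have [vy' vM'] := max_principle_step N b0 FK Fsub FM vy vM.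
  exists (fun n => (v n - b) / A N); split => //.
  have iu : (u n)^-1 @[n --> \oo] --> (0 : R).
    apply/cvgrPdist_le => e e0; near=> n.
    have un : e^-1 < u n by near: n; exact: cvgry_gt.
    have ie : 0 < e^-1 by rewrite invr_gt0.
    rewrite sub0r normrN gtr0_norm ?invr_gt0 ?(lt_trans ie un) //.
    by rewrite -[e]invrK lef_pV2 ?posrE ?(lt_trans ie un) // ltW.
  have -> : expR (- \sum_(i <- N :: w) ln (A i)) =
      (expR (- \sum_(i <- w) ln (A i)) - b * 0) / A N.
    by rewrite big_cons opprD expRD mulr0 subr0 [expR (- ln _)]expRN lnK ?posrE // mulrC.
  rewrite (_ : (fun n => _) = (fun n => (v n / u n - b * (u n)^-1) / A N)).
    apply: cvgMr_tmp; apply: cvgB => //; exact: cvgMl_tmp.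
  by apply/funext => n; ring.
have e0 : 0 < ln h2 - ln h1 by rewrite subr_gt0 ltr_ln ?posrE // (lt_trans h10).
have h20 : 0 < h2 by exact: lt_trans h12.
have [w /andP[w1 w2]] := dense (- ln h2) e0.
have [v [vy vM vu]] := word w; exists v; split => //.
have r1 : h1 < expR (- \sum_(i <- w) ln (A i)).
  by rewrite -[h1]lnK ?posrE // ltr_expR; lra.
have r2 : expR (- \sum_(i <- w) ln (A i)) < h2.
  by rewrite -[h2]lnK ?posrE // ltr_expR; lra.
have n1 : \forall n \near \oo, h1 < v n / u n by apply: (cvgr_gt _ vu).
have n2 : \forall n \near \oo, v n / u n < h2 by apply: (cvgr_lt _ vu).
have n3 : \forall n \near \oo, 0 < u n by exact: cvgry_gt.
near=> n.
have un0 : 0 < u n by near: n.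
apply/andP; split; first by rewrite -ltr_pdivlMr //; near: n.
by rewrite -ltr_pdivrMr //; near: n.
Unshelve. all: by end_near. Qed.

Variable beta : R.
Hypothesis beta_ge0 : 0 <= beta.
Hypothesis G_le1 : forall x, G x <= 1.
Hypothesis G_sup : forall x, 0 < x -> gm (fun N => G (x / A N)) <= G x.
Hypothesis G_sub : forall x, G x <= gm (fun N => G ((x - beta) / A N)).

Lemma ptail_super x : 0 < x -> gm (fun N => A N `^ s * ptail (x / A N)) <= ptail x.
Proof.
move=> x0.
have E N : A N `^ s * ptail (x / A N) = x `^ s * G (x / A N).
  have A0 := A_gt0 N; rewrite /ptail mulrCA -powRM ?(ltW A0) ?divr_ge0 ?(ltW x0) ?(ltW A0) //.
  by rewrite [A N * _]mulrC divfK ?gt_eqF // mulrC.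
under [X in gm X]funext => N do rewrite E.
have bG N : `|G (x / A N)| <= 1 by rewrite ger0_norm.
by rewrite (gmeanZ q_gt0 q_lt1 _ bG) /ptail mulrC ler_wpM2r ?powR_ge0 // G_sup.
Qed.

(** The shift by beta costs the factor (x / (x - beta))^s, which tends to 1, on a bounded mean. *)
Lemma ptail_sub e : 0 < e -> exists X, forall x, X <= x ->
  ptail x <= gm (fun N => A N `^ s * ptail ((x - beta) / A N)) + e.
Proof.
move=> e0; have [K K0 HK] := ptail_bounded.
pose r := (1 + e / (K * alpha `^ s + 1)) `^ s^-1.
have Ka0 : 0 < K * alpha `^ s + 1.
  by rewrite ltr_wpDl // mulr_ge0 // powR_ge0.
have ek : 0 < e / (K * alpha `^ s + 1) by rewrite divr_gt0.
have r1 : 1 < r.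
  rewrite /r /powR gt_eqF; last by rewrite addr_gt0.
  by rewrite -[X in X < _]expR0 ltr_expR mulr_gt0 ?invr_gt0 // ln_gt0 // ltrDl.
have rE : r `^ s = 1 + e / (K * alpha `^ s + 1).
  by rewrite /r -powRrM mulVf ?gt_eqF // powRr1 // addr_ge0 // ltW.
(* x >= beta r / (r - 1) means x / (x - beta) <= r; beta + 1 keeps x - beta positive. *)
exists (Num.max (beta + 1) (beta * r / (r - 1))) => x; rewrite ge_max => /andP[x1 x2].
have r10 : 0 < r - 1 by rewrite subr_gt0.
have xb : 0 < x - beta by lra.
have x0 : 0 < x by rewrite (lt_le_trans xb) // gerBl.
have xr : x / (x - beta) <= r.
  by move: x2; rewrite !ler_pdivrMr //; lra.
have bd N : `|A N `^ s * ptail ((x - beta) / A N)| <= alpha `^ s * K.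
  rewrite normrM; apply: ler_pM => //; first exact: powA_bound (ltW s_gt0).
  by rewrite ger0_norm ?ptail_ge0 // HK // divr_gt0.
have E N : A N `^ s * ptail ((x - beta) / A N) = (x - beta) `^ s * G ((x - beta) / A N).
  have A0 := A_gt0 N; rewrite /ptail mulrCA -powRM ?(ltW A0) ?divr_ge0 ?(ltW xb) ?(ltW A0) //.
  by rewrite [A N * _]mulrC divfK ?gt_eqF // mulrC.
have bG N : `|G ((x - beta) / A N)| <= 1 by rewrite ger0_norm.
set S := gm _.
have SE : S = (x - beta) `^ s * gm (fun N => G ((x - beta) / A N)).
  rewrite /S; under [X in gm X]funext => N do rewrite E.
  by rewrite (gmeanZ q_gt0 q_lt1 _ bG).
have SK : S <= alpha `^ s * K := le_trans (ler_norm _) (gmean_norm q_gt0 q_lt1 bd).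
have S0 : 0 <= S.
  apply: (gmean_ge0 q_gt0 q_lt1 bd) => N; by rewrite mulr_ge0 ?powR_ge0 ?ptail_ge0.
have h1 : ptail x <= (x / (x - beta)) `^ s * S.
  rewrite SE mulrA -powRM ?divr_ge0 ?(ltW x0) ?(ltW xb) // divfK ?gt_eqF //.
  by rewrite /ptail mulrC ler_wpM2l ?powR_ge0 // G_sub.
have h2 : (x / (x - beta)) `^ s <= 1 + e / (K * alpha `^ s + 1).
  rewrite -rE; apply: ler_powR_pos => //; first exact: ltW.
  by rewrite divr_ge0 // ltW.
have h3 : e / (K * alpha `^ s + 1) * S <= e.
  by rewrite mulrAC ler_pdivrMr // ler_pM2l //; lra.
by have := ler_wpM2r S0 h2; lra.
Qed.

Definition uniform_limit (M : R) (u : nat -> R) := u n @[n --> \oo] --> +oo /\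
  forall h, 0 < h -> ptail (h * u n) @[n --> \oo] --> M.

Let powR_root (x : R) : 1 < x -> exists2 r, 1 < r & r `^ s = x.
Proof.
move=> x1; have x0 : 0 < x by exact: lt_trans x1.
exists (x `^ s^-1); last by rewrite -powRrM mulVf ?gt_eqF // powRr1 // ltW.
rewrite /powR gt_eqF // -[X in X < _]expR0 ltr_expR mulr_gt0 ?invr_gt0 //.
exact: ln_gt0.
Qed.

(** [max_principle] reaches only ratios near h. A point v slightly to the right of h u satisfies
    ptail v <= (1 + d) ptail (h u), which forces the latter up to M. *)
Lemma limsup_uniform : exists M u, uniform_limit M u /\
  forall e, 0 < e -> exists X, forall x, X <= x -> ptail x <= M + e.
Proof.
have [K K0 HK] := ptail_bounded.
have FK x : 0 < x -> `|ptail x| <= K by move=> /HK; rewrite ger0_norm // ptail_ge0.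
have [M [u [uy uM HM]]] := limsup_sequence FK.
exists M, u; split => //; split => // h h0.
apply/cvgrPdist_le => e e0.
pose d := e / 2 / (K + 1).
have K1 : 0 < K + 1 by rewrite ltr_wpDl.
have d0 : 0 < d by rewrite !divr_gt0.
have d1 : 1 < 1 + d by rewrite ltrDl.
have [r r1 rE] := powR_root d1.
have hr : h < h * r by rewrite ltr_pMr.
have [v [vy vM vu]] := max_principle beta_ge0 FK ptail_sub HM uy uM h0 hr.
have [X HX] := HM e e0.
have n1 : \forall n \near \oo, X / h <= u n by exact: cvgry_ge.
 have n2 : \forall n \near \oo, 0 < u n by exact: cvgry_gt.
have e2 : 0 < e / 2 by rewrite divr_gt0.
have /cvgrPdist_le /(_ _ e2) n3 := vM.
near=> n.
have un0 : 0 < u n by near: n.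
have hu0 : 0 < h * u n by rewrite mulr_gt0.
have /andP[v1 v2] : h * u n < v n < h * r * u n by near: n.
have : `|M - ptail (v n)| <= e / 2 by near: n.
rewrite ler_distl => /andP[m3 m4].
have n5 : X <= h * u n by rewrite mulrC -ler_pdivrMr //; near: n.
rewrite distrC ler_distl HX // andbT.
have h1 := ptail_scale hu0 (ltW v1).
have h2 : (v n / (h * u n)) `^ s <= 1 + d.
  rewrite -rE; apply: ler_powR_pos; first exact: ltW.
    by rewrite divr_ge0 // ltW // (lt_trans hu0).
  by rewrite ler_pdivrMr // ltW // mulrCA mulrA.
have h3 := ler_wpM2r (ptail_ge0 (h * u n)) h2.
have h4 : d * ptail (h * u n) <= e / 2.
  by rewrite /d mulrAC ler_pdivrMr // ler_pM2l //; have := HK _ hu0; lra.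
lra.
Unshelve. all: by end_near. Qed.

(** The same for - ptail, a subsolution with no shift and no error by [ptail_super]; now v is taken
    slightly to the left of h u. *)
Lemma liminf_uniform : exists M u, uniform_limit M u /\
  forall e, 0 < e -> exists X, forall x, X <= x -> M - e <= ptail x.
Proof.
have [K K0 HK] := ptail_bounded.
pose F x := - ptail x.
have FK x : 0 < x -> `|F x| <= K.
  by move=> /HK; rewrite /F normrN ger0_norm // ptail_ge0.
have [M' [u [uy uM HM']]] := limsup_sequence FK.
pose M := - M'.
have HM e : 0 < e -> exists X, forall x, X <= x -> M - e <= ptail x.
  by move=> /HM'[X HX]; exists X => x /HX; rewrite /F /M; lra.
exists M, u; split => //; split => // h h0.
have Fsub e : 0 < e -> exists X, forall x, X <= x ->
    F x <= gm (fun N => A N `^ s * F ((x - 0) / A N)) + e.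
  move=> e0; exists 1 => x x1; have x0 : 0 < x by exact: lt_le_trans x1.
  have bd N : `|A N `^ s * ptail (x / A N)| <= alpha `^ s * K.
    rewrite normrM; apply: ler_pM => //; first exact: powA_bound (ltW s_gt0).
    by rewrite ger0_norm ?ptail_ge0 // HK // divr_gt0.
  rewrite (_ : (fun N => _) = (fun N => -1 * (A N `^ s * ptail (x / A N)))); last first.
    by apply/funext => N; rewrite subr0 /F; ring.
  rewrite (gmeanZ q_gt0 q_lt1 _ bd) /F mulN1r.
  by have := ptail_super x0; lra.
apply/cvgrPdist_le => e e0.
pose d := e / 2 / (K + 1).
have K1 : 0 < K + 1 by rewrite ltr_wpDl.
have d0 : 0 < d by rewrite !divr_gt0.
have d1 : 1 < 1 + d by rewrite ltrDl.
have [r r1 rE] := powR_root d1.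
have r0 : 0 < r by exact: lt_trans r1.
have hr : h / r < h by rewrite ltr_pdivrMr // ltr_pMr.
have hr0 : 0 < h / r by rewrite divr_gt0.
have [v [vy vM vu]] := max_principle (lexx 0) FK Fsub HM' uy uM hr0 hr.
have [X HX] := HM e e0.
have n1 : \forall n \near \oo, X / h <= u n by exact: cvgry_ge.
 have n2 : \forall n \near \oo, 0 < u n by exact: cvgry_gt.
have e2 : 0 < e / 2 by rewrite divr_gt0.
have /cvgrPdist_le /(_ _ e2) n3 := vM.
near=> n.
have un0 : 0 < u n by near: n.
have hu0 : 0 < h * u n by rewrite mulr_gt0.
have /andP[v1 v2] : h / r * u n < v n < h * u n by near: n.
have v0 : 0 < v n by apply: lt_trans v1; rewrite mulr_gt0.
have : `|M' - F (v n)| <= e / 2 by near: n.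
rewrite ler_distl /F => /andP[m3 m4].
have n5 : X <= h * u n by rewrite mulrC -ler_pdivrMr //; near: n.
rewrite distrC ler_distl HX //=.
have h1 := ptail_scale v0 (ltW v2).
have h2 : (h * u n / v n) `^ s <= 1 + d.
  rewrite -rE; apply: ler_powR_pos; first exact: ltW.
    by rewrite divr_ge0 // ltW.
  rewrite ler_pdivrMr // ltW //.
  by move: v1; rewrite mulrAC ltr_pdivrMr // [v n * r]mulrC.
have h3 := ler_wpM2r (ptail_ge0 (v n)) h2.
have h4 : d * ptail (v n) <= e / 2.
  by rewrite /d mulrAC ler_pdivrMr // ler_pM2l //; have := HK _ v0; lra.
rewrite /M; lra.
Unshelve. all: by end_near. Qed.

(** Phi behaves like a primitive of s ptail(x) / x. A geometric mesh of ratio h^(1/(m+1)) gives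
    upper and lower Riemann sums; the mesh is finite, so convergence at each dilation suffices. *)
Lemma Phi_increment M u h : uniform_limit M u -> 1 <= h ->
  Phi (h * u n) - Phi (u n) @[n --> \oo] --> M * (s * ln h).
Proof.
move=> [uy uM] h1; have h0 : 0 < h by exact: lt_le_trans h1.
have M0 : 0 <= M.
  by apply: (cvgr_to_ge (uM 1 ltr01)); apply: nearW => n; exact: ptail_ge0.
pose t := s * ln h.
have t0 : 0 <= t by rewrite mulr_ge0 ?(ltW s_gt0) // ln_ge0.
have upos : \forall n \near \oo, 0 < u n by exact: cvgry_gt.
pose r m := expR (ln h / m.+1%:R).
have r0 m i : 0 < r m ^+ i by rewrite exprn_gt0 // expR_gt0.
have r1 m : 1 <= r m.
  by rewrite -[leLHS]expR0 ler_expR divr_ge0 // ln_ge0.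
have rh m : r m ^+ m.+1 = h.
  by rewrite -expRM_natr divfK ?pnatr_eq0 // lnK ?posrE.
have rs m : r m `^ s = expR (t / m.+1%:R).
  by rewrite /r -expRM /t; congr expR; ring.
have telesc m n : Phi (h * u n) - Phi (u n) =
    \sum_(i < m.+1) (Phi (r m ^+ i.+1 * u n) - Phi (r m ^+ i * u n)).
  rewrite -(big_mkord xpredT (fun i => Phi (r m ^+ i.+1 * u n) - Phi (r m ^+ i * u n))).
  by rewrite telescope_sumr // rh expr0 mul1r.
have rS m i n : r m ^+ i.+1 * u n = r m * (r m ^+ i * u n) by rewrite exprS mulrA.
have powS m x : 0 < x -> (r m * x) `^ s = r m `^ s * x `^ s.
  by move=> x0; rewrite powRM // ltW // expR_gt0.
have up m : \forall n \near \oo, Phi (h * u n) - Phi (u n) <=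
    \sum_(i < m.+1) ptail (r m ^+ i * u n) * (r m `^ s - 1).
  near=> n; have un0 : 0 < u n by near: n.
  rewrite (telesc m); apply: ler_sum => i _.
  have x0 : 0 < r m ^+ i * u n by rewrite mulr_gt0.
  rewrite rS; apply: (le_trans (Phi_up x0 _)); first by rewrite ler_peMl // ltW.
  by rewrite powS // /ptail le_eqVlt; apply/orP; left; apply/eqP; ring.
have lo m : \forall n \near \oo,
    \sum_(i < m.+1) ptail (r m ^+ i.+1 * u n) * (1 - (r m `^ s)^-1) <=
    Phi (h * u n) - Phi (u n).
  near=> n; have un0 : 0 < u n by near: n.
  rewrite (telesc m); apply: ler_sum => i _.
  have x0 : 0 < r m ^+ i * u n by rewrite mulr_gt0.
  rewrite rS; apply: (le_trans _ (Phi_lo x0 _)); last by rewrite ler_peMl // ltW.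
  rewrite /ptail powS // le_eqVlt; apply/orP; left; apply/eqP; field.
  by rewrite gt_eqF // rs expR_gt0.
have cup m : \sum_(i < m.+1) ptail (r m ^+ i * u n) * (r m `^ s - 1) @[n --> \oo] -->
    \sum_(i < m.+1) M * (r m `^ s - 1).
  by apply: cvg_big => [|i _]; [exact: add_continuous|apply: cvgMr_tmp; exact: uM].
have clo m : \sum_(i < m.+1) ptail (r m ^+ i.+1 * u n) * (1 - (r m `^ s)^-1) @[n --> \oo] -->
    \sum_(i < m.+1) M * (1 - (r m `^ s)^-1).
  by apply: cvg_big => [|i _]; [exact: add_continuous|apply: cvgMr_tmp; exact: uM].
have t_to0 : t / m.+1%:R @[m --> \oo] --> (0 : R).
  by rewrite -[X in _ --> X](mulr0 t); apply: cvgMl_tmp; exact: cvg_harmonic.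
have e_to1 : expR (t / m.+1%:R) @[m --> \oo] --> (1 : R).
  rewrite -[X in _ --> X]expR0; apply: (continuous_cvg _ _ t_to0); exact: continuous_expR.
(* For the mesh m, the upper sum is at most M t exp(t/(m+1)) and the lower one at least M t
   exp(-t/(m+1)). *)
have c1 : M * (t * expR (t / m.+1%:R)) @[m --> \oo] --> M * t.
  rewrite -[X in _ --> X]mulr1 -mulrA.
  by apply: cvgMl_tmp; apply: cvgMl_tmp.
have c2 : M * (t * (expR (t / m.+1%:R))^-1) @[m --> \oo] --> M * t.
  have c3 : (expR (t / m.+1%:R))^-1 @[m --> \oo] --> (1 : R).
    by rewrite -[X in _ --> X]invr1; apply: cvgV => //; exact: oner_neq0.
  rewrite -[X in _ --> X]mulr1 -mulrA.
  by apply: cvgMl_tmp; apply: cvgMl_tmp.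
apply/cvgrPdist_le => e e0; have e2 : 0 < e / 2 by rewrite divr_gt0.
have [m0 _ Hm] : \forall m \near \oo, `|M * t - M * (t * expR (t / m.+1%:R))| <= e / 2 /\
    `|M * t - M * (t * (expR (t / m.+1%:R))^-1)| <= e / 2.
  near=> m; split; near: m.
    by have /cvgrPdist_le := c1; apply.
  by have /cvgrPdist_le := c2; apply.
have [Hm1 Hm2] := Hm m0 (leqnn m0).
have u1 : \sum_(i < m0.+1) M * (r m0 `^ s - 1) <= M * (t * expR (t / m0.+1%:R)).
  rewrite sumr_const card_ord -[leLHS]mulr_natl [leLHS]mulrCA ler_wpM2l // rs.
  have := ler_wpM2l (ler0n R m0.+1) (expR_sub1_le (t / m0.+1%:R)).
  by rewrite mulrA [_ * (t / _)]mulrC divfK ?pnatr_eq0.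
have l1 : M * (t * (expR (t / m0.+1%:R))^-1) <= \sum_(i < m0.+1) M * (1 - (r m0 `^ s)^-1).
  rewrite sumr_const card_ord -[leRHS]mulr_natl [leRHS]mulrCA ler_wpM2l // rs -expRN.
  have H := expR_ge1Dx (t / m0.+1%:R).
  have H2 : t / m0.+1%:R * expR (- (t / m0.+1%:R)) <= 1 - expR (- (t / m0.+1%:R)).
    have E0 := expR_gt0 (- (t / m0.+1%:R)).
    by have := ler_wpM2r (ltW E0) H; rewrite expRxMexpNx_1 mulrDl mul1r lerBrDl.
  have := ler_wpM2l (ler0n R m0.+1) H2.
  by rewrite mulrA [_ * (t / _)]mulrC divfK ?pnatr_eq0.
have cu : \forall n \near \oo, `|\sum_(i < m0.+1) M * (r m0 `^ s - 1) -
    \sum_(i < m0.+1) ptail (r m0 ^+ i * u n) * (r m0 `^ s - 1)| <= e / 2.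
  by have /cvgrPdist_le := cup m0; apply.
have cl : \forall n \near \oo, `|\sum_(i < m0.+1) M * (1 - (r m0 `^ s)^-1) -
    \sum_(i < m0.+1) ptail (r m0 ^+ i.+1 * u n) * (1 - (r m0 `^ s)^-1)| <= e / 2.
  by have /cvgrPdist_le := clo m0; apply.
have up0 := up m0; have lo0 := lo m0.
near=> n; rewrite distrC ler_distl -/t.
have k1 : Phi (h * u n) - Phi (u n) <=
    \sum_(i < m0.+1) ptail (r m0 ^+ i * u n) * (r m0 `^ s - 1) by near: n.
have k2 : \sum_(i < m0.+1) ptail (r m0 ^+ i.+1 * u n) * (1 - (r m0 `^ s)^-1) <=
    Phi (h * u n) - Phi (u n) by near: n.
have k3 : `|\sum_(i < m0.+1) M * (r m0 `^ s - 1) -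
    \sum_(i < m0.+1) ptail (r m0 ^+ i * u n) * (r m0 `^ s - 1)| <= e / 2 by near: n.
have k4 : `|\sum_(i < m0.+1) M * (1 - (r m0 `^ s)^-1) -
    \sum_(i < m0.+1) ptail (r m0 ^+ i.+1 * u n) * (1 - (r m0 `^ s)^-1)| <= e / 2 by near: n.
move: Hm1 Hm2 k3 k4; rewrite !ler_distl => /andP[a1 _] /andP[_ a2] /andP[a3 _] /andP[_ a4].
apply/andP; split; lra.
Unshelve. all: by end_near. Qed.

(** As the tilted weights sum to one, Psi(x) is the mean of A^s (Phi x - Phi (x / A)); the bound on
    [ptail] dominates these increments and [Phi_increment] gives their limits. *)
Lemma Phi_defect_cvg M u : uniform_limit M u ->
  Phi_defect (u n) @[n --> \oo] --> M * s * drift.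
Proof.
move=> uM; have [uy uM'] := uM.
have [K K0 HK] := ptail_bounded.
have upos : \forall n \near \oo, 0 < u n by exact: cvgry_gt.
have bA N x : 0 < x -> `|A N `^ s * (Phi x - Phi (x / A N))| <= K * (alpha `^ s * alpha `^ s + 1).
  move=> x0; have A0 := A_gt0 N; have xA : 0 < x / A N by rewrite divr_gt0.
  have As0 := powR_gt0 s A0.
  have As : A N `^ s <= alpha `^ s by apply: ler_powR_pos; rewrite ?(ltW s_gt0) ?(ltW A0).
  have xE : (x / A N) `^ s * A N `^ s = x `^ s.
    by rewrite -powRM ?(ltW xA) ?(ltW A0) // divfK ?gt_eqF.
  rewrite normrM (ger0_norm (ltW As0)).
  have [A1|A1] := leP 1 (A N).
    have xx : x / A N <= x by rewrite ler_pdivrMr // ler_peMr // ltW.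
    rewrite ger0_norm ?subr_ge0 ?Phi_nd //.
    have h1 := Phi_up xA xx.
    have h2 : G (x / A N) * (x `^ s - (x / A N) `^ s) <= K * A N `^ s.
      have := HK _ xA; rewrite /ptail => h.
      have h3 : G (x / A N) * x `^ s <= K * A N `^ s.
        by rewrite -xE mulrA ler_wpM2r // ltW.
      have := mulr_ge0 (G_ge0 (x / A N)) (powR_ge0 (x / A N) s); lra.
    have h3 : A N `^ s * (Phi x - Phi (x / A N)) <= A N `^ s * (K * A N `^ s).
      by rewrite ler_wpM2l ?(ltW As0) // (le_trans h1).
    apply: (le_trans h3); rewrite mulrCA ler_wpM2l //.
    apply: (@le_trans _ _ (alpha `^ s * alpha `^ s)); last by rewrite lerDl.
    by apply: ler_pM => //; exact: ltW.
  have xx : x <= x / A N by rewrite ler_pdivlMr // ler_piMr // ltW.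
  rewrite distrC ger0_norm ?subr_ge0 ?Phi_nd //.
  have h1 := Phi_up x0 xx.
  have h2 : A N `^ s * (G x * ((x / A N) `^ s - x `^ s)) <= K.
    have -> : A N `^ s * (G x * ((x / A N) `^ s - x `^ s)) =
        G x * x `^ s - A N `^ s * (G x * x `^ s) by rewrite -xE; ring.
    have := HK _ x0; rewrite /ptail.
    have := mulr_ge0 (ltW As0) (mulr_ge0 (G_ge0 x) (powR_ge0 x s)); lra.
  apply: (@le_trans _ _ K); last first.
    by rewrite ler_peMr // lerDr mulr_ge0 ?powR_ge0.
  apply: le_trans h2; by rewrite ler_wpM2l // ltW.
have DE x : 0 < x -> Phi_defect x = gm (fun N => A N `^ s * (Phi x - Phi (x / A N))).
  move=> x0; rewrite /Phi_defect.
  have b1 N : `|Phi x * A N `^ s| <= `|Phi x| * alpha `^ s.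
    by rewrite normrM ler_wpM2l // powA_bound // ltW.
  rewrite -[X in X - _]mulr1 -phi_s.
  rewrite -(gmeanZ q_gt0 q_lt1 _ (fun N => powA_bound N (ltW s_gt0))).
  rewrite -(gmeanB q_gt0 q_lt1 b1 (fun N => @bPhi x N x0)).
  by congr gmean; apply/funext => N; ring.
(* [gmean_tannery] wants the bound for every n, while finitely many u n may fail to be positive. *)
pose w n := if 0 < u n then u n else 1.
have w0 n : 0 < w n by rewrite /w; case: ifP.
have wE : \forall n \near \oo, w n = u n.
  by near=> n; rewrite /w ifT //; near: n.
have H : gm (fun N => A N `^ s * (Phi (w n) - Phi (w n / A N))) @[n --> \oo] -->
    gm (fun N => M * s * (A N `^ s * ln (A N))).
  apply: (gmean_tannery q_gt0 q_lt1 (fun n N => bA N (w n) (w0 n))) => N.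
  rewrite mulrCA -mulrA; apply: cvgMl_tmp.
  have A0 := A_gt0 N.
  have : Phi (u n) - Phi (u n / A N) @[n --> \oo] --> M * (s * ln (A N)).
    (* [Phi_increment] needs a ratio at least 1: climb from u / A N to u if A N >= 1, from u to u /
       A N otherwise. *)
    have [A1|A1] := leP 1 (A N).
      have U : uniform_limit M (fun n => u n / A N).
        split.
          apply/cvgryPge => x; near=> n; rewrite ler_pdivlMr //.
          by near: n; exact: cvgry_ge.
        move=> h h0; have := uM' (h / A N) (divr_gt0 h0 A0).
        by under eq_fun do rewrite mulrAC -mulrA.
      have := Phi_increment U A1.
      by under eq_fun do rewrite mulrC divfK ?gt_eqF //.
    have A1' : 1 <= (A N)^-1 by rewrite invf_ge1 // ltW.
    have : - (Phi ((A N)^-1 * u n) - Phi (u n)) @[n --> \oo] --> - (M * (s * ln (A N)^-1)).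
      by apply: cvgN; exact: Phi_increment.
    rewrite lnV ?posrE // !mulrN opprK.
    by under eq_fun do rewrite opprB mulrC.
  apply: cvg_trans; apply: near_eq_cvg; near=> n.
  by have -> : w n = u n by near: n.
rewrite -(gmeanZ q_gt0 q_lt1 _ powA_ln_bound).
apply: cvg_trans H; apply: near_eq_cvg; near=> n.
by have <- : w n = u n by [near: n]; rewrite DE.
Unshelve. all: by end_near. Qed.

Hypothesis defect_nd : forall x y, 0 < x -> x <= y -> Phi_defect x <= Phi_defect y.
Hypothesis defect_gt0 : exists2 x, 0 < x & 0 < Phi_defect x.

Lemma ptail_cvg : exists2 K : R, 0 < K & ptail x @[x --> +oo] --> K.
Proof.
have m0 := drift_gt0.
pose E := [set Phi_defect x | x in [set x : R | 0 < x]].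
have [x0 x00 Px0] := defect_gt0.
have supE : has_sup E.
  split; first by exists (Phi_defect x0), x0.
  by exists c => _ [x /= x1 <-]; exact: defect_le.
pose P := sup E.
have P0 : 0 < P.
  by apply: (lt_le_trans Px0); apply: (ub_le_sup supE.2); exists x0.
have PM M u : uniform_limit M u -> M = P / (s * drift).
  move=> uM; have sd : s * drift != 0 by rewrite mulf_neq0 // gt_eqF.
  apply: (canRL (mulfK sd)); rewrite mulrA.
  have [uy _] := uM.
  apply: (cvg_unique _ (Phi_defect_cvg uM)) => //.
  apply/cvgrPdist_le => e e0; have [_ [x /= x1 <-] xP] := sup_adherent e0 supE.
  have u1 : \forall n \near \oo, x <= u n by exact: cvgry_ge.
  near=> n; have ux : x <= u n by near: n.
  have un0 : 0 < u n by exact: lt_le_trans ux.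
  rewrite ger0_norm ?subr_ge0; last by apply: (ub_le_sup supE.2); exists (u n).
  by have := defect_nd x1 ux; rewrite -/P in xP; lra.
have [M1 [u1 [U1 H1]]] := limsup_uniform.
have [M2 [u2 [U2 H2]]] := liminf_uniform.
exists (P / (s * drift)); first by rewrite divr_gt0 // mulr_gt0.
apply/cvgrPdist_le => e e0.
have [X1 HX1] := H1 e e0; have [X2 HX2] := H2 e e0.
near=> x; rewrite distrC ler_distl; apply/andP; split.
  rewrite -(PM _ _ U2); apply: HX2; by near: x; apply: nbhs_pinfty_ge; rewrite num_real.
rewrite -(PM _ _ U1); apply: HX1; by near: x; apply: nbhs_pinfty_ge; rewrite num_real.
Unshelve. all: by end_near. Qed.

End renewal.

(** * Escape to infinity in the non-contractive case *)

Section escape.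
Context {R : realType}.
Variables (q : R) (A B : nat -> R) (alpha b : R).
Hypotheses (q_gt0 : 0 < q) (q_lt1 : q < 1).
Hypotheses (A_gt0 : forall N, 0 < A N) (A_le : forall N, A N <= alpha).
Hypotheses (b_gt0 : 0 < b) (B_ge : forall N, b <= B N).
Hypothesis A0_gt1 : 1 < A 0%N.
Hypothesis phi_ge1 : forall sig, 0 < sig -> 1 <= gmean q (fun N => A N `^ sig).
Local Notation gm := (gmean q).

Let B_ge0 N : 0 <= B N. Proof. exact: le_trans (ltW b_gt0) (B_ge N). Qed.
Let alpha0 : 0 < alpha. Proof. exact: lt_le_trans (A_gt0 0) (A_le 0). Qed.

Local Notation tail := (tail q A B).
Let F x : R := 1 - tail x.

Let F_bound x : 0 <= F x <= 1.
Proof.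
have /andP[h1 h2] := tail_bound q_gt0 q_lt1 A_gt0 B_ge0 x.
by rewrite /F subr_ge0 h2 gerBl.
Qed.

Let F_nd x y : x <= y -> F x <= F y.
Proof. by move=> xy; rewrite /F lerD2l lerN2 tail_nonincr. Qed.

Let F_small x : x < b -> F x = 0.
Proof.
move=> xb; rewrite /F (tail_fix q_gt0 q_lt1 A_gt0 B_ge0).
rewrite (_ : (fun N => _) = fun=> 1) ?gmean_cst ?subrr //.
apply/funext => N; apply: tail_lt0 => //.
by rewrite pmulr_llt0 ?invr_gt0 // subr_lt0 (lt_le_trans xb).
Qed.

Let F_sub x : F x <= gm (fun N => F (x / A N)).
Proof.
have b1 y : `|tail y| <= 1.
  by have /andP[h1 h2] := tail_bound q_gt0 q_lt1 A_gt0 B_ge0 y; rewrite ger0_norm.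
have bc (N : nat) : `|1 : R| <= 1 by rewrite normr1.
rewrite /F (gmeanB q_gt0 q_lt1 bc (fun N => b1 (x / A N))) gmean_cst // lerD2l lerN2.
rewrite [leRHS](tail_fix q_gt0 q_lt1 A_gt0 B_ge0).
apply: (gmean_le q_gt0 q_lt1 (fun N => b1 _) (fun N => b1 _)) => N.
by apply: tail_nonincr => //; rewrite ler_pM2r ?invr_gt0 // gerBl.
Qed.

(** From y >= b one step leads to y / A N >= x0, and F vanishes below b: the barrier is needed only
    from x0 on. *)
Let x0 := b / alpha.
Let x0_gt0 : 0 < x0. Proof. by rewrite divr_gt0. Qed.

(* [2 * (1 - (x / x0) `^ (- sig))] is a supersolution of the inequality [F_sub]
   satisfied by the distribution function [F] because [phi sig >= 1]. *)
Let F_barrier sig x : 0 < sig -> x0 <= x -> F x <= 2 * (1 - (x / x0) `^ (- sig)).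
Proof.
move=> sig0 xx0.
pose l y : R := 2 * (1 - (y / x0) `^ (- sig)); pose D y : R := F y - l y.
suff H : D x <= 0 by move: H; rewrite /D subr_le0.
have l_ge0 y : x0 <= y -> 0 <= l y.
  move=> yx; rewrite mulr_ge0 // subr_ge0 powRN invf_le1.
    rewrite -[leLHS](powRr0 (y / x0)) ler_powR ?(ltW sig0) //.
    by rewrite ler_pdivlMr // mul1r.
  by rewrite powR_gt0 // divr_gt0 // (lt_le_trans x0_gt0).
have D_small y : x0 <= y -> y < b -> D y <= 0.
  by move=> y1 y2; rewrite /D F_small // sub0r oppr_le0 l_ge0.
have D_le1 y : x0 <= y -> D y <= 1.
  move=> y1; have /andP[_ h] := F_bound y; have := l_ge0 y y1; rewrite /D; lra.
(* Beyond X1 the barrier is at least 1 >= F; this is the purpose of its factor 2. *)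
pose X1 := x0 * 2 `^ sig^-1.
have X10 : 0 < X1 by rewrite mulr_gt0 ?powR_gt0.
have D_large y : X1 <= y -> D y <= 0.
  move=> yX; have y0 : 0 < y by exact: lt_le_trans yX.
  have : (y / x0) `^ (- sig) <= 2^-1.
    rewrite powRN lef_pV2 ?posrE ?powR_gt0 ?divr_gt0 //.
    have -> : 2 = (2 `^ sig^-1) `^ sig :> R.
      by rewrite -powRrM mulVf ?gt_eqF // powRr1.
    apply: ler_powR_pos; rewrite ?(ltW sig0) ?powR_ge0 //.
    by rewrite ler_pdivlMr // mulrC.
  by have /andP[_ h] := F_bound y; rewrite /D /l; lra.
have argx y N : b <= y -> x0 <= y / A N.
  move=> yb; rewrite /x0; apply: ler_pM; rewrite ?(ltW b_gt0) ?invr_ge0 ?(ltW alpha0) //.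
  by rewrite lef_pV2 ?posrE.
have bF N y : `|F (y / A N)| <= 1.
  by have /andP[h1 h2] := F_bound (y / A N); rewrite ger0_norm.
have lA y N : 0 < y -> l (y / A N) = 2 - 2 * (y / x0) `^ (- sig) * A N `^ sig.
  move=> y0; have h1 : 0 <= y / x0 by rewrite divr_ge0 // ltW.
  have h2 : 0 <= (A N)^-1 by rewrite invr_ge0 ltW.
  rewrite /l mulrAC (powRM _ h1 h2) -[(A N)^-1]powR_inv1 ?(ltW (A_gt0 N)) // -powRrM mulN1r opprK; ring.
have bA N : `|A N `^ sig| <= alpha `^ sig.
  by rewrite ger0_norm ?powR_ge0 //; apply: ler_powR_pos; rewrite ?(ltW sig0) ?(ltW (A_gt0 N)).
have bl y N : 0 < y -> `|l (y / A N)| <= 2 + 2 * (y / x0) `^ (- sig) * alpha `^ sig.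
  move=> y0; rewrite lA //; apply: (le_trans (ler_normB _ _)).
  rewrite normr_nat lerD2l normrM ger0_norm ?mulr_ge0 ?powR_ge0 //.
  by rewrite ler_wpM2l // mulr_ge0 ?powR_ge0.
have D_sub y : b <= y -> D y <= gm (fun N => D (y / A N)).
  move=> yb; have y0 : 0 < y by exact: lt_le_trans yb.
  rewrite /D (gmeanB q_gt0 q_lt1 (fun N => bF N y) (fun N => bl y N y0)).
  apply: lerB (F_sub y) _.
  rewrite (_ : (fun N => l (y / A N)) =
     (fun N => 2 - 2 * (y / x0) `^ (- sig) * A N `^ sig)); last first.
    by apply/funext => N; rewrite lA.
  have b2 (N : nat) : `|2 : R| <= 2 by rewrite normr_nat.
  have b3 N : `|2 * (y / x0) `^ (- sig) * A N `^ sig| <=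
      2 * (y / x0) `^ (- sig) * alpha `^ sig.
    by rewrite normrM ger0_norm ?mulr_ge0 ?powR_ge0 // ler_wpM2l // mulr_ge0 ?powR_ge0.
  rewrite (gmeanB q_gt0 q_lt1 b2 b3) (gmeanZ q_gt0 q_lt1 _ bA) gmean_cst //.
  rewrite /l mulrBr mulr1 lerD2l lerN2 ler_peMr ?mulr_ge0 ?powR_ge0 //.
  exact: phi_ge1.
have bD y N : 0 < y -> `|D (y / A N)| <= 1 + (2 + 2 * (y / x0) `^ (- sig) * alpha `^ sig).
  by move=> y0; apply: (le_trans (ler_normB _ _)); apply: lerD => //; exact: bl.
pose p : R := 1 - q.
have p0 : 0 < p by rewrite subr_gt0.
have p1 : p <= 1 by rewrite gerBl ltW.
have pj j : 0 <= 1 - p ^+ j by rewrite subr_ge0 exprn_ile1 // ltW.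
(* With probability p the run is empty and y is divided by A 0 > 1. After j such steps y is below b,
   where D <= 0, so a bound S improves by the factor 1 - p^j; J steps cover all y < X1, and
   iterating drives D to 0. *)
have claim (S : R) j : 0 <= S -> (forall y, x0 <= y -> D y <= S) ->
    forall y, x0 <= y -> y < b * A 0%N ^+ j -> D y <= S * (1 - p ^+ j).
  move=> S0 DS; elim: j => [|j IH] y y1 y2.
    by rewrite expr0 subrr mulr0 D_small // -[b]mulr1.
  have [yb|yb] := ltP y b.
    by apply: (le_trans (D_small _ y1 yb)); rewrite mulr_ge0.
  have y0 : 0 < y by exact: lt_le_trans yb.
  have bS (N : nat) : `|S| <= S by rewrite ger0_norm.
  have bb N := le_trans (ler_normB _ _) (lerD (bS N) (bD y N y0)).
  have nn N : 0 <= S - D (y / A N) by rewrite subr_ge0 DS // argx.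
  have := gmean_term q_gt0 q_lt1 0 bb nn.
  rewrite (gmeanB q_gt0 q_lt1 bS (fun N => bD y N y0)) gmean_cst // expr0 mulr1 -/p.
  have := D_sub y yb.
  have : D (y / A 0%N) <= S * (1 - p ^+ j).
    by apply: IH; [exact: argx|rewrite ltr_pdivrMr // -mulrA -exprSr].
  move=> h1 h2 h3; have h4 := ler_wpM2l (ltW p0) h1.
  by rewrite exprS; clear bS; lra.
have [J HJ] : exists J, X1 < b * A 0%N ^+ J.
  have a1 : `|(A 0%N)^-1| < 1 by rewrite ger0_norm ?invr_ge0 ?(ltW (A_gt0 0)) // invf_lt1.
  have c : (A 0%N)^-1 ^+ n @[n --> \oo] --> (0 : R) by exact: cvg_expr.
  have bX : 0 < b / X1 by rewrite divr_gt0.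
  have /cvgrPdist_lt /(_ _ bX) [J _ /(_ J (leqnn J)) /=] := c.
  rewrite sub0r normrN ger0_norm ?exprn_ge0 ?invr_ge0 ?(ltW (A_gt0 0)) // => h.
  exists J; move: h; rewrite exprVn invf_plt ?posrE ?exprn_gt0 ?divr_gt0 // invf_div.
  by rewrite ltr_pdivrMr // mulrC.
have iter i : forall y, x0 <= y -> D y <= (1 - p ^+ J) ^+ i.
  elim: i => [|i IH] y y1; first by rewrite expr0 D_le1.
  rewrite exprSr; have [yX|yX] := leP X1 y.
    by apply: (le_trans (D_large y yX)); rewrite mulr_ge0 ?exprn_ge0.
  apply: (claim _ J _ IH) => //; first by rewrite exprn_ge0.
  exact: lt_trans HJ.
have pJ1 : 1 - p ^+ J < 1 by rewrite gtrBl exprn_gt0.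
have c : (1 - p ^+ J) ^+ n @[n --> \oo] --> (0 : R).
  by apply: cvg_expr; rewrite ger0_norm.
by apply: (cvgr_to_ge c); apply: nearW => n; exact: iter.
Qed.

Lemma tail_eq1 x : tail x = 1.
Proof.
suff H : F x <= 0.
  apply/le_anti/andP; split; first by have /andP[] := tail_bound q_gt0 q_lt1 A_gt0 B_ge0 x.
  by move: H; rewrite /F subr_le0.
pose y := Num.max x x0.
have xy : x <= y by rewrite le_max lexx.
have yx0 : x0 <= y by rewrite le_max lexx orbT.
apply: (le_trans (F_nd xy)).
have y0 : 0 < y / x0 by rewrite divr_gt0 // (lt_le_trans x0_gt0).
(* The barrier with sig = 1 / (n + 1) is at most 2 sig ln(y / x0), which tends to 0. *)
have h n : F y <= (2 * ln (y / x0)) * n.+1%:R^-1.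
  have n0 : 0 < n.+1%:R^-1 :> R by rewrite invr_gt0.
  apply: (le_trans (F_barrier n0 yx0)).
  rewrite /powR gt_eqF // -mulrA ler_pM2l // lerBlDr.
  have := expR_ge1Dx (- n.+1%:R^-1 * ln (y / x0)).
  by move: (n.+1%:R^-1) => r; lra.
have c : (2 * ln (y / x0)) * n.+1%:R^-1 @[n --> \oo] --> (2 * ln (y / x0)) * 0.
  by apply: cvgMl_tmp; exact: cvg_harmonic.
by rewrite -[leRHS](mulr0 (2 * ln (y / x0))); apply: (cvgr_to_ge c); apply: nearW => n.
Qed.

End escape.

(** * The tail exponent as a function of the parameter *)

Section exponent.
Context {R : realType}.
Variables (A : nat -> R) (alpha rho theta : R).
Hypotheses (A_gt0 : forall N, 0 < A N) (A_le : forall N, A N <= alpha * rho ^+ N).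
Hypotheses (alpha_gt0 : 0 < alpha) (rho_gt0 : 0 < rho) (rho_lt1 : rho < 1).
Hypothesis A_ge : forall N, rho ^+ N.+1 <= A N.
Hypothesis A0_gt1 : 1 < A 0%N.
Hypotheses (theta_gt0 : 0 < theta) (theta_lt1 : theta < 1).
Hypothesis A_submul : forall k l, A (k + l).+1 <= theta * A k * A l.

Definition phi (sig q : R) : R := gmean q (fun N => A N `^ sig).

Let A_le' N : A N <= alpha.
Proof.
apply: (le_trans (A_le N)); rewrite ler_piMr ?(ltW alpha_gt0) //.
by rewrite exprn_ile1 ?(ltW rho_gt0) ?(ltW rho_lt1).
Qed.

Let bA0 sig N : 0 <= sig -> `|A N `^ sig| <= alpha `^ sig.
Proof. exact: powA_le. Qed.

Let bA sig N : 0 < sig -> `|A N `^ sig| <= alpha `^ sig.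
Proof. by move=> /ltW; exact: bA0. Qed.

Lemma phi0 q : 0 < q -> q < 1 -> phi 0 q = 1.
Proof.
move=> q0 q1; rewrite /phi; under [X in gmean q X]funext => N do rewrite powRr0.
exact: gmean_cst.
Qed.

Lemma phi_gt0 sig q : 0 < sig -> 0 < q -> q < 1 -> 0 < phi sig q.
Proof.
move=> s0 q0 q1.
apply: (lt_le_trans _ (gmean_term q0 q1 0 (fun N => bA N s0) (fun N => powR_ge0 _ _))).
by rewrite expr0 mulr1 mulr_gt0 ?powR_gt0 // subr_gt0.
Qed.

(* The tail sums [r i] satisfy [r i = (1 - q') y_i + q' r (i + 1)]; averaging this
   under the weights of [q] gives a discrete derivative of [phi] in [q]. *)
Lemma phi_difference sig q q' : 0 < sig -> 0 < q -> q < 1 -> 0 < q' -> q' < 1 ->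
  (1 - q) * phi sig q' = (1 - q') * phi sig q +
    (q' - q) * gmean q (fun i => gmean q' (fun j => A (i.+1 + j)%N `^ sig)).
Proof.
move=> s0 q0 q1 q'0 q'1.
pose y N := A N `^ sig; pose r i := gmean q' (fun j => y (i + j)%N).
have by' N : `|y N| <= alpha `^ sig by exact: bA.
have br i : `|r i| <= alpha `^ sig.
  exact: (gmean_norm q'0 q'1 (fun j => by' (i + j)%N)).
have rE i : r i = (1 - q') * y i + q' * r i.+1.
  rewrite {1}/r (gmean_recl q'0 q'1 (fun j => by' (i + j)%N)) addn0.
  by congr (_ + _ * gmean _ _); apply/funext => j; rewrite addnS addSn.
have H : gmean q r = (1 - q') * gmean q y + q' * gmean q (fun i => r i.+1).
  have b1 N : `|(1 - q') * y N| <= `|1 - q'| * alpha `^ sig.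
    by rewrite normrM ler_wpM2l.
  have b2 N : `|q' * r N.+1| <= `|q'| * alpha `^ sig by rewrite normrM ler_wpM2l.
  rewrite -(gmeanZ q0 q1 _ by') -(gmeanZ q0 q1 _ (fun i => br i.+1)) -(gmeanD q0 q1 b1 b2).
  by congr gmean; apply/funext => i; rewrite rE.
move: H; rewrite (gmean_recl q0 q1 br).
have -> : r 0%N = phi sig q' by [].
rewrite -[gmean q y]/(phi sig q); lra.
Qed.

Let gap_bound sig q' i : 0 < sig -> 0 < q' -> q' < 1 ->
  0 <= gmean q' (fun j => A (i.+1 + j)%N `^ sig) <=
    theta `^ sig * phi sig q' * A i `^ sig.
Proof.
move=> s0 q'0 q'1; apply/andP; split.
  by apply: (gmean_ge0 q'0 q'1 (fun j => bA (i.+1 + j)%N s0)) => j; exact: powR_ge0.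
have E : theta `^ sig * phi sig q' * A i `^ sig =
    gmean q' (fun j => theta `^ sig * A i `^ sig * A j `^ sig).
  by rewrite (gmeanZ q'0 q'1 _ (fun j => bA j s0)) /phi; ring.
rewrite E; have b2 j : `|theta `^ sig * A i `^ sig * A j `^ sig| <=
    `|theta `^ sig * A i `^ sig| * alpha `^ sig by rewrite normrM ler_wpM2l // bA.
apply: (gmean_le q'0 q'1 (fun j => bA (i.+1 + j)%N s0) b2) => j.
have Ai := ltW (A_gt0 i); have Aj := ltW (A_gt0 j); have t0 := ltW theta_gt0.
rewrite -(powRM _ t0 Ai) -powRM ?mulr_ge0 //.
by apply: ler_powR_pos; rewrite ?(ltW s0) ?(ltW (A_gt0 _)) // addSn.
Qed.

(** phi / (1 - q) is the sum of q^N A_N^sig, nondecreasing in q. It serves as the one-sided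
    continuity of phi in q. *)
Lemma phi_ratio sig q q' : 0 < sig -> 0 < q -> q <= q' -> q' < 1 ->
  (1 - q') * phi sig q <= (1 - q) * phi sig q'.
Proof.
move=> s0 q0 qq q'1; have q'0 : 0 < q' by exact: lt_le_trans qq.
have q1 : q < 1 by exact: le_lt_trans q'1.
rewrite (phi_difference s0 q0 q1 q'0 q'1) lerDl mulr_ge0 ?subr_ge0 //.
have bg i : `|gmean q' (fun j => A (i.+1 + j)%N `^ sig)| <= alpha `^ sig.
  exact: (gmean_norm q'0 q'1 (fun j => bA (i.+1 + j)%N s0)).
by apply: (gmean_ge0 q0 q1 bg) => i; have /andP[] := gap_bound i s0 q'0 q'1.
Qed.

(** In [phi_difference] the double mean is at most theta^sig phi(q') phi(q) < phi(q'); since (1 - q)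
    - (q' - q) = 1 - q', what remains is (1 - q') phi(q') < 1 - q'. *)
Lemma phi_lt1_incr sig q q' : 0 < sig -> 0 < q -> q < q' -> q' < 1 ->
  phi sig q <= 1 -> phi sig q' < 1.
Proof.
move=> s0 q0 qq q'1 p1; have q'0 : 0 < q' by exact: lt_trans qq.
have q1 : q < 1 by exact: lt_trans q'1.
have bg i : `|gmean q' (fun j => A (i.+1 + j)%N `^ sig)| <= alpha `^ sig.
  exact: (gmean_norm q'0 q'1 (fun j => bA (i.+1 + j)%N s0)).
have f0 := phi_gt0 s0 q0 q1; have f'0 := phi_gt0 s0 q'0 q'1.
have t1 : theta `^ sig < 1.
  rewrite /powR gt_eqF // -[X in _ < X]expR0 ltr_expR pmulr_rlt0 //.
  by rewrite ln_lt0 // theta_gt0.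
have H : gmean q (fun i => gmean q' (fun j => A (i.+1 + j)%N `^ sig)) <=
    theta `^ sig * phi sig q' * phi sig q.
  rewrite [in leRHS]/(phi sig q) -(gmeanZ q0 q1 _ (fun N => bA N s0)).
  have b2 N : `|theta `^ sig * phi sig q' * A N `^ sig| <=
      `|theta `^ sig * phi sig q'| * alpha `^ sig by rewrite normrM ler_wpM2l // bA.
  by apply: (gmean_le q0 q1 bg b2) => i; have /andP[] := gap_bound i s0 q'0 q'1.
have H2 := phi_difference s0 q0 q1 q'0 q'1.
have qq0 : 0 < q' - q by rewrite subr_gt0.
have h1 := ler_wpM2l (ltW qq0) H.
have h2 : theta `^ sig * phi sig q' * phi sig q < phi sig q'.
  apply: (@le_lt_trans _ _ (theta `^ sig * phi sig q')).
    by rewrite ler_piMr // mulr_ge0 ?powR_ge0 // ltW.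
  by rewrite gtr_pMl.
have h3 : (q' - q) * (theta `^ sig * phi sig q' * phi sig q) < (q' - q) * phi sig q'.
  by rewrite ltr_pM2l.
have q'10 : 0 < 1 - q' by rewrite subr_gt0.
have h4 := ler_wpM2l (ltW q'10) p1.
rewrite -(ltr_pM2l q'10); lra.
Qed.

Lemma phi_convex s1 s2 t q : 0 <= s1 -> 0 <= s2 -> 0 <= t -> t <= 1 -> 0 < q -> q < 1 ->
  phi ((1 - t) * s1 + t * s2) q <= (1 - t) * phi s1 q + t * phi s2 q.
Proof.
move=> s10 s20 t0 t1 q0 q1.
have t'0 : 0 <= 1 - t by rewrite subr_ge0.
pose m := (1 - t) * s1 + t * s2.
have m0 : 0 <= m by rewrite addr_ge0 // mulr_ge0.
have b1 N : `|(1 - t) * A N `^ s1| <= `|1 - t| * alpha `^ s1.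
  by rewrite normrM ler_wpM2l // bA0.
have b2 N : `|t * A N `^ s2| <= `|t| * alpha `^ s2 by rewrite normrM ler_wpM2l // bA0.
have b12 N := le_trans (ler_normD _ _) (lerD (b1 N) (b2 N)).
rewrite /phi -(gmeanZ q0 q1 _ (fun N => bA0 N s10)) -(gmeanZ q0 q1 _ (fun N => bA0 N s20)).
rewrite -(gmeanD q0 q1 b1 b2).
apply: (gmean_le q0 q1 (fun N => bA0 N m0) b12) => N.
rewrite /powR gt_eqF //; set l := ln (A N).
have e0 := expR_gt0 (m * l).
have h1 : expR (m * l) * (1 + (s1 - m) * l) <= expR (s1 * l).
  have -> : s1 * l = m * l + (s1 - m) * l by ring.
  by rewrite expRD ler_pM2l // expR_ge1Dx.
have h2 : expR (m * l) * (1 + (s2 - m) * l) <= expR (s2 * l).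
  have -> : s2 * l = m * l + (s2 - m) * l by ring.
  by rewrite expRD ler_pM2l // expR_ge1Dx.
have h3 := lerD (ler_wpM2l t'0 h1) (ler_wpM2l t0 h2).
apply: le_trans h3; rewrite -/m le_eqVlt; apply/orP; left; apply/eqP; rewrite /m; ring.
Qed.

(** 1 + phi(sig) - 2 phi(sig / 2) is the mean of (1 - A^(sig / 2))^2, positive because A 0 > 1. *)
Lemma phi_half sig q : 0 < sig -> 0 < q -> q < 1 -> phi sig q <= 1 -> phi (sig / 2) q < 1.
Proof.
move=> s0 q0 q1 f1; have s20 : 0 < sig / 2 by rewrite divr_gt0.
pose y N := A N `^ (sig / 2).
have yE N : A N `^ sig = y N * y N by rewrite /y -powRDpos // -splitr.
have b2 N : `|2 * y N| <= 2 * alpha `^ (sig / 2).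
  by rewrite normrM normr_nat ler_wpM2l // bA.
have b1 (N : nat) : `|1 : R| <= 1 by rewrite normr1.
have b3 N := le_trans (ler_normD _ _) (lerD (b1 N) (bA N s0)).
have b4 N := le_trans (ler_normB _ _) (lerD (b3 N) (b2 N)).
have nn N : 0 <= 1 + A N `^ sig - 2 * y N.
  by rewrite yE (_ : _ - _ = (1 - y N) ^+ 2) ?sqr_ge0 //; ring.
have := gmean_term q0 q1 0 b4 nn.
rewrite (gmeanB q0 q1 b3 b2) (gmeanD q0 q1 b1 (fun N => bA N s0)) gmean_cst //.
rewrite (gmeanZ q0 q1 _ (fun N => bA N s20)) -/(phi sig q) -/(phi (sig / 2) q).
rewrite expr0 mulr1 yE (_ : 1 + _ - _ = (1 - y 0%N) ^+ 2); last by ring.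
have y1 : 1 < y 0%N.
  by rewrite /y /powR gt_eqF // -[X in X < _]expR0 ltr_expR mulr_gt0 // ln_gt0.
have : 0 < (1 - q) * (1 - y 0%N) ^+ 2.
  by rewrite mulr_gt0 ?subr_gt0 // exprn_even_gt0 //= subr_eq0 lt_eqF.
by move: (_ * _ ^+ 2) => z; clear b1; lra.
Qed.

Lemma gmean_geometric (r q : R) : 0 <= r -> r <= 1 -> 0 < q -> q < 1 ->
  gmean q (fun N => r ^+ N) = (1 - q) / (1 - q * r).
Proof.
move=> r0 r1 q0 q1.
have bd N : `|r ^+ N| <= 1 by rewrite ger0_norm ?exprn_ge0 // exprn_ile1.
have bd' N : `|r ^+ N.+1| <= 1 by rewrite ger0_norm ?exprn_ge0 // exprn_ile1.
have H := gmean_recl q0 q1 bd.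
have E : gmean q (fun N => r ^+ N.+1) = r * gmean q (fun N => r ^+ N).
  by rewrite -(gmeanZ q0 q1 _ bd); congr gmean; apply/funext => N; rewrite exprS.
move: H; rewrite E expr0 mulr1; move: (gmean _ _) => g H.
have qr : 0 < 1 - q * r by rewrite subr_gt0 (le_lt_trans _ q1) // ler_piMr // ltW.
by apply: (canRL (mulfK (lt0r_neq0 qr))); lra.
Qed.

Lemma phi_near1 sig : 0 < sig -> exists2 q0, 0 < q0 < 1 &
  forall q, q0 < q -> q < 1 -> phi sig q < 1.
Proof.
move=> s0; pose g := rho `^ sig.
have g0 : 0 < g by exact: powR_gt0.
have g1 : g < 1.
  rewrite /g /powR gt_eqF // -[X in _ < X]expR0 ltr_expR pmulr_rlt0 //.
  by rewrite ln_lt0 // rho_gt0.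
pose C := alpha `^ sig; have C0 : 0 < C by exact: powR_gt0.
(* Ensures C (1 - q) < 1 - g <= 1 - q g as soon as q > 1 - d. *)
pose d := (1 - g) / (C + 1).
have d0 : 0 < d by rewrite divr_gt0 ?subr_gt0 // addr_gt0.
have d1 : d < 1 by rewrite ltr_pdivrMr ?addr_gt0 //; lra.
exists (1 - d); first by apply/andP; split; lra.
move=> q qd q1; have q0 : 0 < q by lra.
have bg N : `|g ^+ N| <= 1 by rewrite ger0_norm ?exprn_ge0 ?exprn_ile1 // ltW.
have bC N : `|C * g ^+ N| <= C.
  by rewrite normrM (ger0_norm (ltW C0)) ler_piMr // ltW.
have H : phi sig q <= C * ((1 - q) / (1 - q * g)).
  rewrite -gmean_geometric ?(ltW g0) ?(ltW g1) // -(gmeanZ q0 q1 _ bg).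
  apply: (gmean_le q0 q1 (fun N => bA N s0) bC) => N.
  have -> : C * g ^+ N = (alpha * rho ^+ N) `^ sig.
    rewrite powRM ?(ltW alpha_gt0) ?exprn_ge0 ?(ltW rho_gt0) //.
    by rewrite powRXn // ltW.
  by apply: ler_powR_pos; rewrite ?(ltW s0) ?(ltW (A_gt0 _)).
apply: (le_lt_trans H).
have qg : q * g <= g by rewrite ler_piMl // ltW.
have h1 : 0 < 1 - q * g by lra.
rewrite mulrA ltr_pdivrMr // mul1r.
have h2 : d * (C + 1) = 1 - g by rewrite /d divfK // gt_eqF // addr_gt0.
have h3 : (1 - q) * (C + 1) < d * (C + 1) by rewrite ltr_pM2r ?addr_gt0 //; lra.
have : C * (1 - q) <= (1 - q) * (C + 1) by lra.
lra.
Qed.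

(** q must not depend on sig, so everything is measured by 1 - g with g = rho^sig: the term N = 0
    has A_0^sig >= 1 + t (1 - g), the others average at least g^3 >= 1 - 3 (1 - g), and q <=
    min(1/2, t/6) gives (1 - q) t >= 3 q. *)
Lemma phi_near0 : exists2 q, 0 < q < 1 & forall sig, 0 < sig -> 1 <= phi sig q.
Proof.
have L0 : 0 < - ln rho by rewrite oppr_gt0 ln_lt0 // rho_gt0.
have l0 : 0 < ln (A 0%N) by exact: ln_gt0.
pose t := ln (A 0%N) / - ln rho.
have t0 : 0 < t by rewrite divr_gt0.
pose q := Num.min (1 / 2) (t / 6).
have q0 : 0 < q by rewrite lt_min !divr_gt0.
have q2 : q <= 1 / 2 by rewrite ge_min lexx.
have q3 : q <= t / 6 by rewrite ge_min lexx orbT.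
have q1 : q < 1 by lra.
exists q; first by rewrite q0.
move=> sig s0; pose g := rho `^ sig.
have g0 : 0 < g by exact: powR_gt0.
have gE : g = expR (sig * ln rho) by rewrite /g /powR gt_eqF.
have g1 : g < 1 by rewrite gE -[X in _ < X]expR0 ltr_expR pmulr_rlt0 // -oppr_gt0.
have h1 : 1 + t * (1 - g) <= A 0%N `^ sig.
  rewrite /powR gt_eqF //; apply: (le_trans _ (expR_ge1Dx _)); rewrite lerD2l.
  rewrite /t mulrAC ler_pdivrMr // [sig * _]mulrC -mulrA ler_pM2l //.
  by have := expR_ge1Dx (sig * ln rho); rewrite -gE; lra.
have bg N : `|g ^+ N| <= 1 by rewrite ger0_norm ?exprn_ge0 ?exprn_ile1 // ltW.
have bG N : `|g ^+ 2 * g ^+ N| <= 1.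
  by rewrite -exprD ger0_norm ?exprn_ge0 ?exprn_ile1 // ltW.
have h2 : g ^+ 2 * ((1 - q) / (1 - q * g)) <= gmean q (fun N => A N.+1 `^ sig).
  rewrite -gmean_geometric ?(ltW g0) ?(ltW g1) // -(gmeanZ q0 q1 _ bg).
  apply: (gmean_le q0 q1 bG (fun N => bA N.+1 s0)) => N.
  have -> : g ^+ 2 * g ^+ N = (rho ^+ N.+2) `^ sig.
    by rewrite -exprD powRXn // ltW.
  by apply: ler_powR_pos; rewrite ?(ltW s0) ?exprn_ge0 ?(ltW rho_gt0).
have qg : q * g <= 1 / 2 by nra.
have qg0 : 0 < 1 - q * g by lra.
have h3 : g <= (1 - q) / (1 - q * g).
  have k1 : q * (1 + g) <= 1 by nra.
  have k2 : 0 <= (1 - g) * (1 - q * (1 + g)) by rewrite mulr_ge0 // subr_ge0 // ltW.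
  by rewrite ler_pdivlMr //; lra.
have h4 : g ^+ 2 * g <= gmean q (fun N => A N.+1 `^ sig).
  by apply: le_trans h2; rewrite ler_wpM2l // sqr_ge0.
have h5 : 1 - 3 * (1 - g) <= g ^+ 2 * g.
  have k : 0 <= (1 - g) ^+ 2 * (g + 2) by rewrite mulr_ge0 ?sqr_ge0 // addr_ge0 // ltW.
  lra.
rewrite /phi (gmean_recl q0 q1 (fun N => bA N s0)).
have q10 : 0 <= 1 - q by lra.
have h6 := ler_wpM2l q10 h1.
have h7 := ler_wpM2l (ltW q0) (le_trans h5 h4).
have h8 : 0 <= (1 - g) * ((1 - q) * t - 3 * q).
  have k : 0 <= (1 / 2 - q) * t by rewrite mulr_ge0 ?(ltW t0) // subr_ge0.
  by apply: mulr_ge0; lra.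
move: (A 0%N `^ sig) (gmean _ _) h6 h7 => u v h6 h7; lra.
Qed.

(** * The exponent and the threshold *)

Definition good (q : R) := exists2 sig, 0 < sig & phi sig q < 1.

(** By convexity and phi(0) = 1 this is the second root of phi = 1. If q is not good the set is
    empty and the value has no meaning. *)
Definition tail_exponent q : R := sup [set sig | 0 < sig /\ phi sig q < 1].
Local Notation s := tail_exponent.

Section fixed_q.
Variable q : R.
Hypotheses (q_gt0 : 0 < q) (q_lt1 : q < 1) (q_good : good q).

Let E := [set sig | 0 < sig /\ phi sig q < 1].

(** The term N = 0 alone, (1 - q) A_0^z, exceeds 1 for large z. *)
Let supE : has_sup E.
Proof.
have [sig s0 f1] := q_good; split; first by exists sig.
have l0 : 0 < ln (A 0%N) by exact: ln_gt0.
exists ((1 - q)^-1 / ln (A 0%N)) => z [z0 fz].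
rewrite leNgt; apply/negP; rewrite ltr_pdivrMr // => h.
have : (1 - q) * A 0%N `^ z < 1.
  apply: le_lt_trans fz.
  have := gmean_term q_gt0 q_lt1 0 (fun N => bA N z0) (fun N => powR_ge0 _ _).
  by rewrite expr0 mulr1.
have q1 : 0 < 1 - q by rewrite subr_gt0.
rewrite -ltr_pdivlMl // mulr1 => h2.
have := expR_ge1Dx (z * ln (A 0%N)).
have : expR (z * ln (A 0%N)) = A 0%N `^ z by rewrite /powR gt_eqF.
move: (A 0%N `^ z) (expR _) h2 h => u v; lra.
Qed.

Lemma lt_tail_exponent sig : 0 < sig -> sig < s q -> phi sig q < 1.
Proof.
move=> s0 ss; have [x [x0 fx] sx] := sup_gt supE.1 ss.
pose t := sig / x.
have t0 : 0 < t by rewrite divr_gt0.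
have t1 : t <= 1 by rewrite ler_pdivrMr // mul1r ltW.
have sE : sig = (1 - t) * 0 + t * x by rewrite mulr0 add0r divfK // gt_eqF.
rewrite sE; apply: (le_lt_trans (phi_convex (lexx 0) (ltW x0) (ltW t0) t1 q_gt0 q_lt1)).
have h2 : t * phi x q < t * 1 by rewrite ltr_pM2l.
rewrite phi0 //; lra.
Qed.

Lemma tail_exponent_gt0 : 0 < s q.
Proof.
have [sig s0 f1] := q_good; apply: (lt_le_trans s0).
by apply: (ub_le_sup supE.2).
Qed.

Lemma tail_exponent_ge sig : 0 < sig -> phi sig q < 1 -> sig <= s q.
Proof. by move=> s0 f1; apply: (ub_le_sup supE.2). Qed.

(** Convexity with the auxiliary point s + 1 replaces continuity in sig: phi(s) > 1 fails by
    interpolating s between s - d and s + 1, and phi(s) < 1 would persist at some s + t. *)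
Lemma phi_tail_exponent : phi (s q) q = 1.
Proof.
have s0 := tail_exponent_gt0.
apply/le_anti/andP; split.
  pose f := phi (s q + 1) q.
  have s10 : 0 <= s q + 1 by rewrite addr_ge0 // ltW.
  have f0 : 0 < f by apply: phi_gt0 => //; rewrite addr_gt0.
  rewrite leNgt; apply/negP => fs.
  pose d := Num.min (s q / 2) ((phi (s q) q - 1) / (2 * f)).
  have d0 : 0 < d by rewrite lt_min !divr_gt0 ?subr_gt0 // mulr_gt0.
  have d1 : d <= s q / 2 by rewrite ge_min lexx.
  have d2 : d <= (phi (s q) q - 1) / (2 * f) by rewrite ge_min lexx orbT.
  pose t := d / (1 + d).
  have d10 : 0 < 1 + d by rewrite addr_gt0.
  have t0 : 0 <= t by rewrite divr_ge0 // ltW.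
  have t1 : t <= 1 by rewrite ler_pdivrMr // mul1r lerDr.
  have sd0 : 0 < s q - d by lra.
  have sE : s q = (1 - t) * (s q - d) + t * (s q + 1) by rewrite /t; field; rewrite gt_eqF.
  have := phi_convex (ltW sd0) s10 t0 t1 q_gt0 q_lt1; rewrite -sE -/f.
  have h1 : phi (s q - d) q < 1 by apply: lt_tail_exponent => //; lra.
  have h2 : (1 - t) * phi (s q - d) q <= 1 - t.
    by rewrite -[leRHS]mulr1 ler_wpM2l ?subr_ge0 // ltW.
  have h3 : t * f <= (phi (s q) q - 1) / 2.
    apply: (@le_trans _ _ (d * f)).
      by rewrite ler_pM2r // ler_pdivrMr // ler_peMr ?(ltW d0) // lerDl ltW.
    by move: d2; rewrite invfM mulrA ler_pdivlMr.
  lra.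
rewrite leNgt; apply/negP => fs.
pose f := phi (s q + 1) q.
have s10 : 0 <= s q + 1 by rewrite addr_ge0 // ltW.
have f0 : 0 < f by apply: phi_gt0 => //; rewrite addr_gt0.
pose t := Num.min 1 ((1 - phi (s q) q) / (2 * f)).
have t0 : 0 < t by rewrite lt_min ltr01 divr_gt0 ?subr_gt0 // mulr_gt0.
have t1 : t <= 1 by rewrite ge_min lexx.
have t2 : t <= (1 - phi (s q) q) / (2 * f) by rewrite ge_min lexx orbT.
have sE : s q + t = (1 - t) * s q + t * (s q + 1) by ring.
have := phi_convex (ltW s0) s10 (ltW t0) t1 q_gt0 q_lt1; rewrite -sE -/f => h.
have h1 : t * f <= (1 - phi (s q) q) / 2 by move: t2; rewrite invfM mulrA ler_pdivlMr.
have h2 : 0 <= t * phi (s q) q by rewrite mulr_ge0 ?(ltW t0) // ltW // phi_gt0.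
have : s q + t <= s q by apply: tail_exponent_ge; [rewrite addr_gt0|lra].
lra.
Qed.

Lemma gt_tail_exponent sig : s q < sig -> 1 < phi sig q.
Proof.
move=> ss; have s0 := tail_exponent_gt0.
have s20 : 0 < s q / 2 by rewrite divr_gt0.
have h1 : phi (s q / 2) q < 1 by apply: lt_tail_exponent => //; lra.
have sig0 : 0 < sig by exact: lt_trans ss.
pose t := (s q / 2) / (sig - s q / 2).
have d0 : 0 < sig - s q / 2 by lra.
have t0 : 0 < t by rewrite divr_gt0.
have t1 : t < 1 by rewrite ltr_pdivrMr //; lra.
have sE : s q = (1 - t) * (s q / 2) + t * sig by rewrite /t; field; apply: lt0r_neq0; lra.
have := phi_convex (ltW s20) (ltW sig0) (ltW t0) (ltW t1) q_gt0 q_lt1.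
rewrite -sE phi_tail_exponent => h.
have h2 : (1 - t) * phi (s q / 2) q < (1 - t) * 1 by rewrite ltr_pM2l // subr_gt0.
rewrite -(ltr_pM2l t0); lra.
Qed.

End fixed_q.

Lemma tail_exponent_incr q q' : 0 < q -> q < q' -> q' < 1 -> good q -> good q' ->
  s q < s q'.
Proof.
move=> q0 qq q'1 gq gq'; have q1 : q < 1 by exact: lt_trans q'1.
have q'0 : 0 < q' by exact: lt_trans qq.
have s0 := tail_exponent_gt0 q0 q1 gq.
have f1 : phi (s q) q' < 1.
  by apply: (phi_lt1_incr s0 q0 qq q'1); rewrite (phi_tail_exponent q0 q1 gq).
rewrite lt_neqAle tail_exponent_ge // andbT; apply/eqP => E.
by move: f1; rewrite E (phi_tail_exponent q'0 q'1 gq') ltxx.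
Qed.

(** Above q this is [phi_lt1_incr]; below, [phi_ratio] gives phi(p) <= phi(q) (1 - p) / (1 - q),
    whence the constant in q'. *)
Lemma phi_lt1_open sig q : 0 < sig -> 0 < q -> q < 1 -> phi sig q < 1 ->
  exists2 q', 0 < q' < q & forall p, q' < p -> p < 1 -> phi sig p < 1.
Proof.
move=> s0 q0 q1 f1; have f0 := phi_gt0 s0 q0 q1.
have q10 : 0 < 1 - q by rewrite subr_gt0.
pose q' := Num.max (q / 2) (1 - (1 - q) / phi sig q).
have h : 1 - (1 - q) / phi sig q < q.
  rewrite ltrBlDr -ltrBlDl ltr_pdivlMr //.
  by rewrite gtr_pMr.
exists q'; first by rewrite lt_max gt_max h divr_gt0 //=; lra.
move=> p pq p1; have [pp|pp] := ltP q p.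
  by apply: (phi_lt1_incr s0 q0 pp p1); exact: ltW.
move: pq; rewrite gt_max => /andP[p2 p3].
have p0 : 0 < p by apply: lt_trans p2; rewrite divr_gt0.
have := phi_ratio s0 p0 pp q1.
rewrite -(ltr_pM2l q10) mulr1 => /le_lt_trans; apply.
by rewrite -ltr_pdivlMr //; lra.
Qed.

Lemma phi_gt1_open sig q : 0 < sig -> 0 < q -> q < 1 -> 1 < phi sig q ->
  exists2 q', q < q' < 1 & forall p, 0 < p -> p < q' -> 1 < phi sig p.
Proof.
move=> s0 q0 q1 f1; have f0 := phi_gt0 s0 q0 q1.
have q10 : 0 < 1 - q by rewrite subr_gt0.
pose q' := 1 - (1 - q) / phi sig q.
have h : q < q'.
  by rewrite ltrBrDr -ltrBrDl ltr_pdivrMr // ltr_pMr.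
have h1 : q' < 1 by rewrite gtrBl divr_gt0.
exists q'; first by rewrite h.
move=> p p0 pq; have [pp|pp] := ltP p q.
  rewrite ltNge; apply/negP => fp.
  by have := phi_lt1_incr s0 p0 pp q1 fp; rewrite ltNge (ltW f1).
have p1 : p < 1 by exact: lt_trans h1.
have := phi_ratio s0 q0 pp p1.
rewrite -(ltr_pM2l q10) mulr1; apply: lt_le_trans.
by rewrite -ltr_pdivrMr //; rewrite /q' in pq; lra.
Qed.

(** In the variable q = 1 - epsilon, hence 1 minus the critical epsilon. *)
Definition threshold : R := inf [set q | 0 < q < 1 /\ good q].

Let infE : has_inf [set q | 0 < q < 1 /\ good q].
Proof.
split; last by exists 0 => q [/andP[/ltW]].
have [q0 /andP[q00 q01] H] := phi_near1 (@ltr01 R).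
have q1 : q0 < (q0 + 1) / 2 by lra.
have q2 : (q0 + 1) / 2 < 1 by lra.
by exists ((q0 + 1) / 2); split; [apply/andP; split; lra|exists 1 => //; exact: H].
Qed.

Lemma threshold_good q : threshold < q -> q < 1 -> good q.
Proof.
move=> tq q1; have d0 : 0 < q - threshold by rewrite subr_gt0.
have [p [/andP[p0 p1] [sig s0 fp]] pq] := inf_adherent d0 infE.
exists sig => //; apply: (phi_lt1_incr s0 p0 _ q1 (ltW fp)).
by rewrite -/threshold in pq; lra.
Qed.

(** The threshold itself is included: by [phi_lt1_open] a good q has good points to its left. *)
Lemma threshold_bad q : 0 < q -> q <= threshold -> q < 1 ->
  forall sig, 0 < sig -> 1 <= phi sig q.
Proof.
move=> q0 qt q1 sig s0; rewrite leNgt; apply/negP => f1.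
have [q' /andP[q'0 q'q] H] := phi_lt1_open s0 q0 q1 f1.
have p1 : q' < (q' + q) / 2 by lra.
have p2 : (q' + q) / 2 < q by lra.
have p3 : (q' + q) / 2 < 1 by lra.
have : threshold <= (q' + q) / 2.
  apply: (ge_inf infE.2); split; first by apply/andP; split; lra.
  by exists sig => //; exact: H.
lra.
Qed.

Lemma threshold_itv : 0 < threshold < 1.
Proof.
apply/andP; split.
  have [q /andP[q0 q1] H] := phi_near0.
  apply: (lt_le_trans q0); apply: (lb_le_inf infE.1) => p [/andP[p0 p1] [sig s0 fp]].
  rewrite leNgt; apply/negP => pq.
  by have := phi_lt1_incr s0 p0 pq q1 (ltW fp); rewrite ltNge H.
have [p [/andP[p0 p1] gp]] := infE.1.
by apply: (le_lt_trans _ p1); apply: (ge_inf infE.2); split => //; rewrite p0.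
Qed.

Lemma tail_exponent_continuous q e : threshold < q -> q < 1 -> 0 < e ->
  exists2 d, 0 < d & forall p, `|p - q| < d -> `|s p - s q| < e.
Proof.
move=> tq q1 e0; have /andP[t0 t1] := threshold_itv.
have q0 : 0 < q by exact: lt_trans tq.
have gq := threshold_good tq q1.
have s0 := tail_exponent_gt0 q0 q1 gq.
pose s1 := Num.max (s q / 2) (s q - e / 2).
have s11 : s q / 2 <= s1 by rewrite le_max lexx.
have s12 : s q - e / 2 <= s1 by rewrite le_max lexx orbT.
have s13 : s1 < s q by rewrite gt_max; apply/andP; split; lra.
have s10 : 0 < s1 by lra.
have s2 : s q < s q + e / 2 by lra.
have s20 : 0 < s q + e / 2 by lra.
have [qa /andP[qa0 qaq] Ha] := phi_lt1_open s10 q0 q1 (lt_tail_exponent q0 q1 gq s10 s13).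
have [qb /andP[qbq qb1] Hb] := phi_gt1_open s20 q0 q1 (gt_tail_exponent q0 q1 gq s2).
pose d := Num.min (q - threshold) (Num.min (q - qa) (qb - q)).
exists d; first by rewrite !lt_min !subr_gt0 tq qaq qbq.
move=> p; rewrite ltr_distl /d => /andP[p1 p2].
have d1 : d <= q - threshold by rewrite /d ge_min lexx.
have d2 : d <= q - qa by rewrite /d !ge_min lexx orbT.
have d3 : d <= qb - q by rewrite /d !ge_min lexx !orbT.
rewrite -/d in p1 p2.
have pt : threshold < p by lra.
have p0 : 0 < p by lra.
have pp1 : p < 1 by lra.
have gp := threshold_good pt pp1.
have k1 : s1 <= s p by apply: tail_exponent_ge => //; apply: Ha => //; lra.
have k2 : s p <= s q + e / 2.
  rewrite leNgt; apply/negP => h.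
  have := lt_tail_exponent p0 pp1 gp s20 h.
  by rewrite ltNge ltW // Hb //; lra.
rewrite ltr_distl; apply/andP; split; lra.
Qed.

Lemma tail_exponent_near1 M : exists2 q0, 0 < q0 < 1 &
  forall q, q0 < q -> q < 1 -> M <= s q.
Proof.
pose M' := Num.max M 1.
have M'0 : 0 < M' by rewrite lt_max ltr01 orbT.
have [q0 q01 H] := phi_near1 M'0.
exists q0 => // q qq q1; have q00 : 0 < q by have /andP[h _] := q01; exact: lt_trans qq.
have f1 := H q qq q1.
have gq : good q by exists M'.
by apply: le_trans (tail_exponent_ge q00 q1 gq M'0 f1); rewrite le_max lexx.
Qed.

Lemma tail_exponent_near_threshold e : 0 < e -> exists2 q0, threshold < q0 < 1 &
  forall q, threshold < q -> q < q0 -> s q <= e.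
Proof.
move=> e0; have /andP[t0 t1] := threshold_itv.
(* [phi_half] makes this strict: phi = 1 at e would give phi < 1 at e / 2. *)
have f1 : 1 < phi e threshold.
  rewrite ltNge; apply/negP => /(phi_half e0 t0 t1).
  by rewrite ltNge threshold_bad ?divr_gt0.
have [q0 /andP[q01 q02] H] := phi_gt1_open e0 t0 t1 f1.
exists q0; first by rewrite q01.
move=> q tq qq; have q1 : q < 1 by exact: lt_trans q02.
have q00 : 0 < q by exact: lt_trans tq.
rewrite leNgt; apply/negP => h.
have := lt_tail_exponent q00 q1 (threshold_good tq q1) e0 h.
by rewrite ltNge ltW // H.
Qed.

End exponent.

(** * The sequence driven by ones *)

Section run.
Context {R : realType}.
Variables (a b : R).
Hypotheses (a_gt0 : 0 < a) (a_lt1 : a < 1) (b_gt : 1 - a < b).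

Let b_gt0 : 0 < b. Proof. by rewrite (lt_trans _ b_gt) // subr_gt0. Qed.

(* [X_n] along a run of ones *)
Definition xrun n : R := Xrec a b (fun=> 1) n.

Lemma xrunSS n : xrun n.+2 = a * xrun n.+1 + b * xrun n.
Proof. by rewrite /xrun /= mulr1. Qed.

Lemma xrun_gt0 n : 0 < xrun n.
Proof.
suff : 0 < xrun n /\ 0 < xrun n.+1 by case.
elim: n => [|n [IH1 IH2]]; first by rewrite /xrun /= ltr01.
by split => //; rewrite xrunSS addr_gt0 // mulr_gt0.
Qed.

(** The positive root of the characteristic equation exceeds 1 because a + b > 1. *)
Lemma growth_rate : exists2 lam, 1 < lam & lam ^+ 2 = a * lam + b.
Proof.
have D0 : 0 <= a ^+ 2 + 4 * b by rewrite addr_ge0 ?sqr_ge0 // mulr_ge0 // ltW.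
have sE := sqr_sqrtr D0; set s := Num.sqrt _ in sE.
have s0 : 0 <= s by exact: sqrtr_ge0.
have s1 : 2 - a < s.
  rewrite ltNge; apply/negP => h.
  have : s ^+ 2 <= (2 - a) ^+ 2 by rewrite ler_pXn2r ?nnegrE // (le_trans s0).
  by rewrite sE; have := b_gt; lra.
exists ((a + s) / 2); first by lra.
by rewrite expr_div_n sqrrD sE; field.
Qed.

Variable lam : R.
Hypotheses (lam_gt1 : 1 < lam) (lamE : lam ^+ 2 = a * lam + b).

Let lam_gt0 : 0 < lam. Proof. exact: lt_trans lam_gt1. Qed.

Lemma xrun_le n : xrun n <= lam ^+ n.
Proof.
suff : xrun n <= lam ^+ n /\ xrun n.+1 <= lam ^+ n.+1 by case.
elim: n => [|n [IH1 IH2]].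
  by rewrite /xrun /= expr0 expr1 lexx (le_trans (ltW a_lt1)) // ltW.
split => //; rewrite xrunSS -[n.+2]add2n exprD lamE mulrDl -mulrA -exprS.
by apply: lerD; rewrite ler_pM2l.
Qed.

Lemma xrun_ge n : a / lam * lam ^+ n <= xrun n.
Proof.
suff : a / lam * lam ^+ n <= xrun n /\ a / lam * lam ^+ n.+1 <= xrun n.+1 by case.
elim: n => [|n [IH1 IH2]].
  rewrite /xrun /= expr0 expr1 mulr1 divfK ?gt_eqF // lexx; split => //.
  by rewrite ler_pdivrMr // mul1r (le_trans (ltW a_lt1)) // ltW.
split => //; rewrite xrunSS -[n.+2]add2n exprD lamE mulrCA mulrDl -mulrA.
have -> : a * (lam * (a / lam * lam ^+ n)) = a * (a / lam * lam ^+ n.+1).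
  by rewrite exprS; ring.
by apply: lerD; rewrite ler_pM2l.
Qed.

(** With a zero as the middle bit X would restart and leave the product only; a one adds the second
    term. The induction carries two consecutive indices, as the recursion has order two. *)
Lemma xrun_split k l :
  xrun (k + l).+2 = xrun k.+1 * xrun l.+1 + b * (xrun k * xrun l).
Proof.
suff : xrun (k + l).+2 = xrun k.+1 * xrun l.+1 + b * (xrun k * xrun l) /\
       xrun (k + l).+3 = xrun k.+1 * xrun l.+2 + b * (xrun k * xrun l.+1) by case.
elim: l => [|l [IH1 IH2]].
  rewrite addn0 xrunSS (xrunSS k.+1) (xrunSS 0) xrunSS /xrun /=; split; ring.
rewrite addnS; split => //.
by rewrite (xrunSS (k + l).+2) IH1 IH2 (xrunSS l.+1) (xrunSS l); ring.
Qed.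

Lemma xrun_det n :
  xrun n.+2 * xrun n - xrun n.+1 ^+ 2 = b * (- b) ^+ n.
Proof.
elim: n => [|n IH]; first by rewrite /xrun /= expr0; ring.
rewrite [(- b) ^+ n.+1]exprS (_ : b * (- b * _) = - b * (b * (- b) ^+ n)); last by ring.
by rewrite -IH (xrunSS n.+1) (xrunSS n); ring.
Qed.

Definition runA N : R := (xrun N.+1)^-1.
Definition runB N : R := runA N * \sum_(0 <= k < N.+1) xrun k.
(** Bounds x_{n+1} / x_n, since x_{n+1} >= a x_n. Hence b x_k x_l is at least b / [run_ratio]^2
    times x_{k+1} x_{l+1}, which is where [run_theta] comes from. *)
Definition run_ratio : R := a + b / a.
Definition run_theta : R := (1 + b / run_ratio ^+ 2)^-1.

Lemma runA_gt0 N : 0 < runA N. Proof. by rewrite invr_gt0 xrun_gt0. Qed.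

Lemma runA0_gt1 : 1 < runA 0.
Proof. by rewrite /runA /xrun /= invf_gt1. Qed.

Lemma runA_le N : runA N <= a^-1 * lam^-1 ^+ N.
Proof.
have h : 0 < a / lam * lam ^+ N.+1 by rewrite mulr_gt0 ?divr_gt0 ?exprn_gt0.
have -> : a^-1 * lam^-1 ^+ N = (a / lam * lam ^+ N.+1)^-1.
  rewrite exprS exprVn; field; by rewrite !gt_eqF // exprn_gt0.
by rewrite lef_pV2 ?posrE ?xrun_gt0 // xrun_ge.
Qed.

Lemma runA_ge N : lam^-1 ^+ N.+1 <= runA N.
Proof. by rewrite exprVn lef_pV2 ?posrE ?xrun_gt0 ?exprn_gt0 // xrun_le. Qed.

Let r_gt0 : 0 < run_ratio. Proof. by rewrite addr_gt0 // divr_gt0. Qed.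

Lemma xrun_ratio n : xrun n.+1 <= run_ratio * xrun n.
Proof.
case: n => [|n].
  by rewrite /xrun /= mulr1 /run_ratio lerDl divr_ge0 // ltW.
have h : a * xrun n <= xrun n.+1.
  case: n => [|n]; first by rewrite /xrun /= mulr1.
  by rewrite xrunSS lerDl mulr_ge0 // ltW // xrun_gt0.
rewrite xrunSS /run_ratio mulrDl lerD2l -mulrA ler_pM2l //.
by rewrite mulrC ler_pdivlMr // mulrC.
Qed.

Lemma run_theta_itv : 0 < run_theta < 1.
Proof.
have h : 0 < b / run_ratio ^+ 2 by rewrite divr_gt0 // exprn_gt0.
by rewrite invr_gt0 addr_gt0 //= invf_lt1 ?addr_gt0 // ltrDl.
Qed.

Lemma runA_submul k l : runA (k + l).+1 <= run_theta * runA k * runA l.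
Proof.
have h : 0 < b / run_ratio ^+ 2 by rewrite divr_gt0 // exprn_gt0.
rewrite /runA /run_theta -!invfM.
rewrite lef_pV2 ?posrE ?mulr_gt0 ?xrun_gt0 ?addr_gt0 //.
rewrite xrun_split -mulrA mulrDl mul1r lerD2l -mulrA ler_pM2l //.
rewrite mulrC ler_pdivrMr ?exprn_gt0 //.
have -> : xrun k * xrun l * run_ratio ^+ 2 =
  (run_ratio * xrun k) * (run_ratio * xrun l) by ring.
by apply: ler_pM; rewrite ?(ltW (xrun_gt0 _)) // xrun_ratio.
Qed.

Lemma runB_ge N : run_ratio^-1 <= runB N.
Proof.
rewrite /runB /runA mulrC ler_pdivlMr ?xrun_gt0 // mulrC ler_pdivrMr //.
rewrite mulrC (le_trans (xrun_ratio N)) // ler_pM2l // big_nat_recr //= lerDr.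
by apply: sumr_ge0 => i _; exact/ltW/xrun_gt0.
Qed.

Lemma runB_le N : runB N <= (a / lam * (lam - 1))^-1.
Proof.
have l1 : 0 < lam - 1 by rewrite subr_gt0.
have c0 : 0 < a / lam by rewrite divr_gt0.
have h : (lam - 1) * \sum_(0 <= k < N.+1) xrun k <= lam ^+ N.+1.
  apply: (@le_trans _ _ ((lam - 1) * \sum_(0 <= k < N.+1) lam ^+ k)).
    by rewrite ler_pM2l //; apply: ler_sum => i _; exact: xrun_le.
  by rewrite big_mkord -subrX1 gerBl.
rewrite /runB /runA mulrC ler_pdivrMr ?xrun_gt0 // mulrC ler_pdivlMr ?mulr_gt0 ?invr_gt0 //.
apply: le_trans (xrun_ge N.+1); move: (\sum_(0 <= k < N.+1) xrun k) h => S h.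
have -> : S * (a / lam * (lam - 1)) = a / lam * ((lam - 1) * S) by ring.
by rewrite ler_pM2l.
Qed.

Lemma runA_small d : 0 < d -> exists N, runA N < d.
Proof.
move=> d0.
have c : a^-1 * lam^-1 ^+ n @[n --> \oo] --> a^-1 * 0.
  apply: cvgMl_tmp; apply: cvg_expr.
  by rewrite ger0_norm ?invr_ge0 ?(ltW lam_gt0) // invf_lt1.
have d0' : a^-1 * 0 < d by rewrite mulr0.
have [n _ /(_ n (leqnn n)) /= h] : \forall n \near \oo, a^-1 * lam^-1 ^+ n < d.
  exact: (cvgr_lt _ c).
by exists n; apply: le_lt_trans h; exact: runA_le.
Qed.

(** If all ln A_N lay in d Z, so would the logarithm of x_{n+2} x_n / x_{n+1}^2. By [xrun_det] it is
    never 0, yet it tends to 0 because b < lam^2. *)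
Lemma runA_nonlattice d : 0 < d ->
  exists N, forall z : int, ln (runA N) != z%:~R * d.
Proof.
move=> d0; apply: contrapT => H.
have lat N : exists z : int, ln (runA N) = z%:~R * d.
  apply: contrapT => Hz; apply: H; exists N => z; apply/eqP => E; apply: Hz.
  by exists z.
pose e n := b * (- b) ^+ n / xrun n.+1 ^+ 2.
have eE n : 1 + e n = xrun n.+2 * xrun n / xrun n.+1 ^+ 2.
  have D := xrun_det n; have x0 := lt0r_neq0 (xrun_gt0 n.+1).
  rewrite /e -D; move: (xrun n.+2) (xrun n.+1) (xrun n) x0 => u v w v0.
  by field.
have e0 : e n @[n --> \oo] --> (0 : R).
  pose K := b / (a / lam * lam) ^+ 2; pose g := b / lam ^+ 2.
  have g0 : 0 <= g by rewrite divr_ge0 ?sqr_ge0 // ltW.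
  have g1 : g < 1.
    by rewrite ltr_pdivrMr ?exprn_gt0 // mul1r lamE ltrDr mulr_gt0.
  have c : K * g ^+ n @[n --> \oo] --> (0 : R).
    by rewrite -[X in _ --> X](mulr0 K); apply: cvgMl_tmp; apply: cvg_expr; rewrite ger0_norm.
  apply: norm_cvg0; apply: (squeeze_cvgr _ (cvg_cst 0) c); apply: nearW => n.
  rewrite normr_ge0 /= /e !normrM normrX normrN (gtr0_norm b_gt0) normfV.
  rewrite (ger0_norm (sqr_ge0 _)).
  have xs := xrun_ge n.+1.
  have c0 : 0 < a / lam * lam ^+ n.+1 by rewrite mulr_gt0 ?divr_gt0 ?exprn_gt0.
  have -> : K * g ^+ n = b * b ^+ n / (a / lam * lam ^+ n.+1) ^+ 2.
    have -> : g ^+ n = b ^+ n / (lam ^+ n) ^+ 2 by rewrite /g expr_div_n -!exprM mulnC.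
    have ln0 := lt0r_neq0 (exprn_gt0 n lam_gt0).
    rewrite /K [lam ^+ n.+1]exprS; move: (lam ^+ n) (b ^+ n) ln0 => u v u0.
    by field; rewrite u0 !gt_eqF.
  rewrite ler_pM2l ?mulr_gt0 ?exprn_gt0 // lef_pV2 ?posrE ?exprn_gt0 ?xrun_gt0 //.
  by rewrite ler_pXn2r ?nnegrE ?(ltW c0) // ltW // xrun_gt0.
(* Shifted index: the A_N start at x_1, so e 0, which involves x_0, is avoided. *)
have l0 : ln (1 + e n.+1) @[n --> \oo] --> (0 : R).
  rewrite -[X in _ --> X]ln1.
  have c1 : 1 + e n.+1 @[n --> \oo] --> (1 : R).
    rewrite -[X in _ --> X]addr0; apply: cvgD; first exact: cvg_cst.
    by have := e0; rewrite -(cvg_shiftS e).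
  apply: (continuous_cvg _ _ c1); exact: continuous_ln.
have [n _ /(_ n (leqnn n)) /=] : \forall n \near \oo, `|0 - ln (1 + e n.+1)| < d.
  by have /cvgrPdist_lt := l0; apply.
rewrite sub0r normrN.
have [z1 E1] := lat n; have [z2 E2] := lat n.+1; have [z3 E3] := lat n.+2.
have lnE N : ln (runA N) = - ln (xrun N.+1) by rewrite /runA lnV ?posrE ?xrun_gt0.
have E : ln (1 + e n.+1) = (- z3 - z1 + z2 + z2)%:~R * d.
  rewrite eE ln_div ?lnM ?posrE ?mulr_gt0 ?exprn_gt0 ?xrun_gt0 //.
  move: E1 E2 E3; rewrite !lnE !intrD !intrN => E1 E2 E3; lra.
have nz : ln (1 + e n.+1) != 0.
  rewrite ln_eq0; last first.
    by rewrite eE divr_gt0 ?mulr_gt0 ?exprn_gt0 ?xrun_gt0.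
  rewrite -subr_eq0 addrAC subrr add0r /e !mulf_neq0 ?invr_eq0 ?expf_neq0 ?oppr_eq0 //;
    by rewrite gt_eqF // xrun_gt0.
move: nz; rewrite E mulf_eq0 negb_or => /andP[zn _].
rewrite normrM (gtr0_norm d0) gtr_pMl // => h.
move: zn; rewrite intr_eq0 => zn.
by move: h; rewrite -intr_norm ltrz1 ltNge -gtz0_ge1 normr_gt0 zn.
Qed.

Lemma runA_dense t e : 0 < e ->
  exists w : seq nat, t < \sum_(i <- w) ln (runA i) < t + e.
Proof.
move=> e0; pose S := [set x | exists w : seq nat, x = \sum_(i <- w) ln (runA i)].
have Sadd x y : S x -> S y -> S (x + y).
  by move=> [u ->] [v ->]; exists (u ++ v); rewrite big_cat.
have S1 N : S (ln (runA N)) by exists [:: N]; rewrite big_seq1.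
have Sp : exists2 x, S x & 0 < x.
  by exists (ln (runA 0)) => //; rewrite ln_gt0 // runA0_gt1.
have Sm : exists2 x, S x & x < 0.
  have [N HN] := runA_small ltr01; exists (ln (runA N)) => //.
  by rewrite ln_lt0 // runA_gt0.
have Sn d : 0 < d -> exists2 x, S x & forall z : int, x != z%:~R * d.
  by move=> /runA_nonlattice[N HN]; exists (ln (runA N)).
by have [x [w ->] h] := dense_semigroup Sadd Sp Sm Sn t e0; exists w.
Qed.

End run.

(** * Law of the process *)

Lemma exists_RV_cdf (R : realType) (F : R -> R) :
  {homo F : x y / x <= y} -> right_continuous F ->
  F @ -oo --> (0 : R) -> F @ +oo --> (1 : R) ->
  exists (d : measure_display) (T : measurableType d) (Q : probability T R)
    (W : {RV Q >-> R}), forall x, cdf W x = (F x)%:E.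
Proof.
move=> Fnd Frc FN F1.
pose f : cumulativeBounded (0 : R) (1 : R) :=
  HB.pack F (isCumulative.Build R _ R F Fnd Frc)
    (isCumulativeBounded.Build R 0 1 F FN F1).
exists _, _, (lebesgue_stieltjes_measure f).
pose id_f : measurableTypeR R -> R := idfun.
pose W : {RV lebesgue_stieltjes_measure f >-> R} :=
  HB.pack id_f (@isMeasurableFun.Build _ _ _ _ id_f (@measurable_id _ _ setT)).
by exists W => x; rewrite -(cdf_lebesgue_stieltjes_id f).
Qed.

Section bit_lists.
Context {R : realType}.
Variables (a b : R).
Hypotheses (a_gt0 : 0 < a) (a_lt1 : a < 1) (b_gt : 1 - a < b).

Let b_gt0 : 0 < b. Proof. by rewrite (lt_trans _ b_gt) // subr_gt0. Qed.

(* State (X_{n+1}, X_n, X_0 + ... + X_n) after [n = size v] bits; the head of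
   [v] is the most recent one. *)
Fixpoint bit_state (v : seq bool) : R * R * R :=
  match v with
  | [::] => (a, 1, 1)
  | c :: v' => let s := bit_state v' in
      (a * s.1.1 + b * c%:R * s.1.2, s.1.1, s.2 + s.1.1)
  end.

Definition bitW v := (bit_state v).1.1^-1 * (bit_state v).2.

Lemma bit_state_gt0 v : 0 < (bit_state v).1.1 /\ 0 < (bit_state v).1.2.
Proof.
elim: v => [|c v [IH1 IH2]] /=; first by rewrite a_gt0 ltr01.
split => //; rewrite ltr_wpDr ?mulr_gt0 // !mulr_ge0 ?ler0n // ltW //.
Qed.

Lemma bit_state_run k : bit_state (nseq k true) =
  (xrun a b k.+1, xrun a b k, \sum_(0 <= i < k.+1) xrun a b i).
Proof.
elim: k => [|k IH]; first by rewrite big_nat1.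
by rewrite [nseq _ _]/= [LHS]/= IH /= mulr1 xrunSS [in RHS]big_nat_recr.
Qed.

(** The zero leaves (X_{n+1}, X_n) proportional to the initial pair (a, 1); k further ones reproduce
    [xrun] at that scale. *)
Lemma bit_state_block k v : bit_state (nseq k true ++ false :: v) =
  let x := (bit_state v).1.1 in
  (x * xrun a b k.+1, x * xrun a b k,
   (bit_state v).2 + x * \sum_(0 <= i < k.+1) xrun a b i).
Proof.
elim: k => [|k IH].
  rewrite /= big_nat1 /xrun /= !mulr1 mulr0 mul0r addr0 [a * _]mulrC //.
rewrite [nseq _ _ ++ _]/= [LHS]/= IH /= mulr1 xrunSS [in RHS]big_nat_recr //=.
by congr (_, _, _); ring.
Qed.

(** With no zero back to time 0 the value is B k: the exact law gives the open run the value [B]. *)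
Lemma bitW_run k : bitW (nseq k true) = runB a b k.
Proof. by rewrite /bitW bit_state_run. Qed.

Lemma bitW_block k v :
  bitW (nseq k true ++ false :: v) = runB a b k + runA a b k * bitW v.
Proof.
rewrite /bitW bit_state_block /= /runB /runA.
have [x0 _] := bit_state_gt0 v.
have y0 : 0 < xrun a b k.+1 by exact: xrun_gt0.
move: (\sum_(_ <= i < _) _) (xrun a b k.+1) y0 (bit_state v).2 (bit_state v).1.1 x0.
by move=> S y y0 T x x0; field; rewrite !gt_eqF.
Qed.

Variable q : R.

Fixpoint bit_mean m (F : seq bool -> R) : R :=
  match m with
  | 0 => F [::]
  | n.+1 => q * bit_mean n (fun v => F (true :: v)) +
            (1 - q) * bit_mean n (fun v => F (false :: v))
  end.

Lemma bit_mean_chain m k f :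
  bit_mean m (fun v => f (bitW (nseq k true ++ v))) =
  chain_mean q (runA a b) (runB a b) (runB a b) m k f.
Proof.
elim: m k f => [|m IH] k f /=; first by rewrite cats0 bitW_run.
rewrite -IH -(IH 0%N); congr (_ * bit_mean _ _ + _ * bit_mean _ _);
  apply/funext => v; last by rewrite bitW_block.
by congr (f (bitW _)); elim: k {IH} => [//|k IHk] /=; rewrite IHk.
Qed.

End bit_lists.

(** * From independent variables to the chain *)

Section law.
Context {R : realType}.
Variables (a b : R).
Context {d : measure_display} {T : measurableType d} {P : probability T R}.
Variables (eta : nat -> {RV P >-> R}) (e : R).
Hypothesis eta_indep : mutually_independent eta.
Hypothesis eta1 : forall n, P (eta n @^-1` [set 1]) = (1 - e)%:E.
Hypothesis eta0 : forall n, P (eta n @^-1` [set 0]) = e%:E.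
Local Notation q := (1 - e).

Fixpoint bit_event (v : seq bool) : set T :=
  match v with
  | [::] => setT
  | c :: v' => eta (size v') @^-1` [set c%:R] `&` bit_event v'
  end.

Let measurable_pre n (c : R) : measurable (eta n @^-1` [set c]).
Proof. by rewrite -[X in measurable X]setTI; exact: measurable_funP. Qed.

Lemma measurable_bit_event v : measurable (bit_event v).
Proof.
elim: v => [|c v IH] /=; first exact: measurableT.
exact: measurableI.
Qed.

Lemma bit_state_event v w : bit_event v w -> bit_state a b v =
  (Xn a b eta (size v).+1 w, Xn a b eta (size v) w,
   \sum_(0 <= k < (size v).+1) Xn a b eta k w).
Proof.
elim: v => [|c v IH] /=; first by rewrite big_nat1.
move=> [Hc /IH ->] /=; rewrite -Hc [in RHS]big_nat_recr //=.
Qed.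

Fixpoint bit_weight (v : seq bool) : R :=
  match v with
  | [::] => 1
  | c :: v' => (if c then q else e) * bit_weight v'
  end.

Fixpoint first_indices m : {fset nat} :=
  match m with 0 => fset0 | n.+1 => (n |` first_indices n)%fset end.

Lemma in_first_indices m i : (i \in first_indices m) = (i < m)%N.
Proof.
elim: m => [|m IH]; first by rewrite in_fset0.
by rewrite /= in_fset1U IH ltnS [(i <= m)%N]leq_eqVlt.
Qed.

Lemma probability_bit_event v : P (bit_event v) = (bit_weight v)%:E.
Proof.
suff [c [-> <-]] : exists c : nat -> bool,
    bit_event v = \bigcap_(i in [set` first_indices (size v)]) (eta i @^-1` [set (c i)%:R]) /\
    (\prod_(i <- first_indices (size v)) P (eta i @^-1` [set (c i)%:R]) = (bit_weight v)%:E)%E.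
  by rewrite eta_indep.
elim: v => [|c0 v [c [E1 E2]]].
  exists xpredT; split; first by rewrite /= set_fset0 bigcap_set0.
  by rewrite /= big_seq_fset0.
exists (fun i => if i == size v then c0 else c i); split.
  rewrite /= E1; apply/seteqP; split => [w [h1 h2] i /=|w h].
    rewrite in_fset1U => /orP[/eqP ->|ii]; first by rewrite eqxx.
    rewrite ifF; first exact: h2.
    by apply/negP => /eqP E; move: ii; rewrite E in_first_indices ltnn.
  split; first by have := h (size v); rewrite /= in_fset1U eqxx /=; exact.
  move=> i /= ii; have := h i; rewrite /= in_fset1U ii orbT ifF; first exact.
  by apply/negP => /eqP E; move: ii; rewrite E in_first_indices ltnn.
rewrite /= big_fsetU1 ?in_first_indices ?ltnn //= eqxx EFinM -E2; congr (_ * _)%E.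
  by case: c0.
apply: eq_big_seq => i ii; rewrite ifF //.
by apply/negP => /eqP E; move: ii; rewrite E in_first_indices ltnn.
Qed.

Fixpoint bit_sum m (F : seq bool -> \bar R) : \bar R :=
  match m with
  | 0 => F [::]
  | n.+1 => (bit_sum n (fun v => F (true :: v)) + bit_sum n (fun v => F (false :: v)))%E
  end.

Lemma bit_sumD m F G : bit_sum m (fun v => F v + G v)%E = (bit_sum m F + bit_sum m G)%E.
Proof. by elim: m F G => [//|m IH] F G /=; rewrite !IH addeACA. Qed.

Lemma bit_sum_ext m F G : (forall v, size v = m -> F v = G v) ->
  bit_sum m F = bit_sum m G.
Proof.
elim: m F G => [|m IH] F G FG /=; first exact: FG.
by congr (_ + _)%E; apply: IH => v vm; apply: FG; rewrite /= vm.
Qed.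

(** The variables take the values 0 and 1 only almost surely; the complement of U is a null set. *)
Lemma probability_split n D : measurable D ->
  P D = (P (D `&` eta n @^-1` [set 1%R]) + P (D `&` eta n @^-1` [set 0%R]))%E.
Proof.
move=> mD; pose U := eta n @^-1` [set 1] `|` eta n @^-1` [set 0].
have disj : eta n @^-1` [set 1] `&` eta n @^-1` [set 0] = set0.
  apply/seteqP; split => // w [/= -> /eqP]; by rewrite oner_eq0.
have mU : measurable U by exact: measurableU.
have PUn X Y : measurable X -> measurable Y -> X `&` Y = set0 ->
    P (X `|` Y) = (P X + P Y)%E by move=> *; exact: measureU.
have PU : P U = 1%E.
  by rewrite PUn // eta1 eta0 -EFinD subrK.
have PUc : P (~` U) = 0%E by rewrite probability_setC // PU subee.
rewrite -PUn; last 3 first.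
- exact: measurableI.
- exact: measurableI.
- by rewrite setIACA disj setI0.
rewrite -setIUr -/U -[in LHS](setIT D) -(setUv U) setIUr PUn; last 3 first.
- exact: measurableI.
- by apply: measurableI => //; exact: measurableC.
- by rewrite setIACA setICr setI0.
rewrite [X in (_ + X)%E](_ : _ = 0%E) ?adde0 //.
apply/eqP; rewrite eq_le measure_ge0 andbT -PUc.
by apply: le_measure; rewrite ?inE; [apply: measurableI => //| |exact: subIsetr];
  exact: measurableC.
Qed.

Lemma probability_bits m D : measurable D ->
  P D = bit_sum m (fun v => P (D `&` bit_event v)).
Proof.
move=> mD; elim: m => [|m IH] /=; first by rewrite setIT.
rewrite IH -bit_sumD; congr bit_sum; apply/funext => v.
rewrite (probability_split (size v)) ?[in RHS]setIA; last first.
  by apply: measurableI => //; exact: measurable_bit_event.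
by rewrite -!setIA ![bit_event v `&` _]setIC.
Qed.

Lemma bit_sum_mean m (F : seq bool -> R) :
  bit_sum m (fun v => (F v * bit_weight v)%:E) = (bit_mean q m F)%:E.
Proof.
elim: m F => [|m IH] F /=; first by rewrite mulr1.
have -> : (fun v => (F (true :: v) * (q * bit_weight v))%:E) =
    (fun v => ((q * F (true :: v)) * bit_weight v)%:E).
  by apply/funext => v; congr EFin; ring.
have -> : (fun v => (F (false :: v) * (e * bit_weight v))%:E) =
    (fun v => ((e * F (false :: v)) * bit_weight v)%:E).
  by apply/funext => v; congr EFin; ring.
rewrite !IH -EFinD; congr EFin.
have Z c G : bit_mean q m (fun v => c * G v) = c * bit_mean q m G.
  by elim: m G {IH} => [//|m' IH'] G /=; rewrite !IH'; ring.
by rewrite !Z subKr.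
Qed.

Hypotheses (a_gt0 : 0 < a) (a_lt1 : a < 1) (b_gt : 1 - a < b).

(** The first n bits determine X_0, ..., X_{n+1}, hence W at time n + 1. *)
Lemma probability_Wn_gt n x :
  P [set w | x < W_RV a b eta n.+1 w] =
  (chain_mean q (runA a b) (runB a b) (runB a b) n 0 (above x))%:E.
Proof.
set D := [set w | _].
have mD : measurable D.
  rewrite (_ : D = W_RV a b eta n.+1 @^-1` `]x, +oo[).
    by rewrite -[X in measurable X]setTI; exact: measurable_funP.
  by apply/seteqP; split => w /=; rewrite in_itv /= andbT.
rewrite (probability_bits n mD) -(bit_mean_chain a_gt0 a_lt1 b_gt) -bit_sum_mean.
apply: bit_sum_ext => u un.
rewrite /above; have [xu|ux] := ltP x (bitW a b u).
    rewrite mul1r -probability_bit_event; congr (P _).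
    apply/seteqP; split => [w []//|w uw]; split => //.
    move: xu; rewrite /bitW (bit_state_event uw) /= un //.
  rewrite mul0r (_ : _ `&` _ = set0) ?measure0 //.
  apply/seteqP; split => // w [/= Dw uw].
  move: ux; rewrite leNgt => /negP; apply.
  by rewrite /bitW (bit_state_event uw) /= un.
Qed.

End law.

(** * Convergence in distribution *)

Section limit_law.
Context {R : realType}.
Variables (q : R) (A B : nat -> R) (alpha beta : R).
Hypotheses (q_gt0 : 0 < q) (q_lt1 : q < 1).
Hypotheses (A_gt0 : forall N, 0 < A N) (A_le : forall N, A N <= alpha).
Hypotheses (B_ge0 : forall N, 0 <= B N) (B_le : forall N, B N <= beta).
Local Notation tail := (tail q A B).

Lemma chain_above_le1 n x : chain_mean q A B B n 0 (above x) <= 1.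
Proof.
rewrite -(chain_mean_cst q A B B n 0 1).
by apply: chain_mean_le => // y _; rewrite /above lern1 leq_b1.
Qed.

Lemma low_above_le n x :
  chain_mean q A B (fun=> 0) n 0 (above x) <= chain_mean q A B B n 0 (above x).
Proof. by apply: low_le_chain => //; case: (nonneg_nd_above x). Qed.

Lemma cvg_low_above x :
  chain_mean q A B (fun=> 0) n 0 (above x) @[n --> \oo] --> tail x.
Proof. by apply: cvg_low; last exact: nonneg_nd_above. Qed.

(** A Lipschitz function between the indicators [above x] and [above x'], since [chain_le_low] does
    not apply to an indicator. *)
Definition ramp (x' x y : R) := Num.max 0 (Num.min 1 ((y - x') / (x - x'))).

(** The increment is at most min(1, u) with u = (z - y) / (x - x'), and min(1, u) <= u^kap for kap
    <= 1. *)
Lemma ramp_hoelder x' x kap y z : x' < x -> 0 < kap -> kap <= 1 -> y <= z ->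
  ramp x' x z - ramp x' x y <= (x - x') `^ (- kap) * (z - y) `^ kap.
Proof.
move=> xx k0 k1 yz; pose D := x - x'; have D0 : 0 < D by rewrite subr_gt0.
have zy0 : 0 <= z - y by rewrite subr_ge0.
pose u := (z - y) / D; have u0 : 0 <= u by rewrite divr_ge0 // ltW.
have -> : (x - x') `^ (- kap) * (z - y) `^ kap = u `^ kap.
  rewrite /u powRM ?invr_ge0 ?(ltW D0) // -[D^-1]powR_inv1 ?(ltW D0) // -powRrM mulN1r.
  by rewrite mulrC.
rewrite /ramp -/D; have E : (z - x') / D = (y - x') / D + u by rewrite /u; ring.
rewrite E; move: ((y - x') / D) => v.
have c0 w : 0 <= Num.max 0 (Num.min 1 w) :> R by rewrite le_max lexx.
have c1 w : Num.max 0 (Num.min 1 w) <= 1 :> R by rewrite ge_max ler01 ge_min lexx.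
have h2 : Num.max 0 (Num.min 1 (v + u)) - Num.max 0 (Num.min 1 v) <= 1.
  by have := c0 v; have := c1 (v + u); lra.
have h1 : Num.max 0 (Num.min 1 (v + u)) - Num.max 0 (Num.min 1 v) <= u.
  rewrite lerBlDl ge_max addr_ge0 //=.
  have [v1|v1] := leP 1 v.
    by rewrite max_r ?ler01 // (le_trans _ (_ : 1 <= 1 + u)) ?lerDl // ge_min lexx.
  apply: (@le_trans _ _ (v + u)); first by rewrite ge_min lexx orbT.
  by rewrite lerD2r le_max lexx orbT.
have [u1|u1] := leP 1 u.
  apply: (le_trans h2); rewrite -[leLHS](powRr0 u) ler_powR // ltW //.
apply: (le_trans h1); have [u00|un] := eqVneq u 0.
  by rewrite [leLHS]u00 powR_ge0.
apply: ger1_powR => //.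
by rewrite (ltW u1) andbT lt_neqAle eq_sym un.
Qed.

(** The exact mean lies between [low n] and tail x' plus a multiple of [run_gap], which vanishes;
    left continuity of the tail at x closes the gap. *)
Lemma chain_above_cvg kap x : 0 < kap -> kap <= 1 ->
  gmean q (fun N => A N `^ kap) < 1 ->
  (forall e, 0 < e -> exists2 x', x' < x & tail x' <= tail x + e) ->
  chain_mean q A B B n 0 (above x) @[n --> \oo] --> tail x.
Proof.
move=> k0 k1 phi1 lc; apply/cvgrPdist_le => e e0.
have e2 : 0 < e / 2 by rewrite divr_gt0.
have [x' xx tx] := lc _ e2.
pose L := (x - x') `^ (- kap).
have L0 : 0 <= L by exact: powR_ge0.
have D0 : 0 < x - x' by rewrite subr_gt0.
have up n : chain_mean q A B B n 0 (above x) <= tail x' + L * run_gap q A B kap n 0.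
  apply: (@le_trans _ _ (chain_mean q A B B n 0 (ramp x' x))).
    apply: chain_mean_le => // y y0; rewrite /above /ramp.
    have [xy|yx] := ltP x y; last by rewrite le_max lexx.
    rewrite min_l ?le_max ?lexx ?orbT //.
    by rewrite ler_pdivlMr // mul1r lerB // ltW.
  apply: (@le_trans _ _ (chain_mean q A B (fun=> 0) n 0 (ramp x' x) + L * run_gap q A B kap n 0)).
    by apply: chain_le_low => // y z y0 yz; exact: ramp_hoelder.
  rewrite lerD2r.
  apply: (@le_trans _ _ (chain_mean q A B (fun=> 0) n 0 (above x'))).
    apply: chain_mean_le => // y y0; rewrite /above /ramp.
    have [xy|yx] := ltP x' y; first by rewrite ge_max ler01 ge_min lexx.
    rewrite ge_max lexx /= ge_min; apply/orP; right.
    by rewrite pmulr_lle0 ?invr_gt0 // subr_le0.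
  by apply: low_le_lim => //; exact: nonneg_nd_above.
have g : L * run_gap q A B kap n 0 @[n --> \oo] --> (0 : R).
  by rewrite -[X in _ --> X](mulr0 L); apply: cvgMl_tmp; exact: cvg_run_gap phi1.
have n1 : \forall n \near \oo, `|0 - L * run_gap q A B kap n 0| <= e / 2.
  by have /cvgrPdist_le := g; apply.
have n2 : \forall n \near \oo, `|tail x - chain_mean q A B (fun=> 0) n 0 (above x)| <= e.
  by have /cvgrPdist_le := @cvg_low_above x; apply.
near=> n; rewrite distrC ler_distl.
have m1 : `|0 - L * run_gap q A B kap n 0| <= e / 2 by near: n.
have m2 : `|tail x - chain_mean q A B (fun=> 0) n 0 (above x)| <= e by near: n.
move: m1 m2; rewrite sub0r normrN => /(le_trans (ler_norm _)) m1.
rewrite ler_distl => /andP[_ m2].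
have := up n; have := low_above_le n x => u1 u2.
by apply/andP; split; lra.
Unshelve. all: by end_near. Qed.

Lemma tail_vanish kap : 0 < kap -> gmean q (fun N => A N `^ kap) < 1 ->
  tail x @[x --> +oo] --> (0 : R).
Proof.
(* kap + 1 is just some exponent above kap; only the tail bound of [tail_tmom_decay] is used. *)
move=> k0 phi1; have k1 : kap < kap + 1 by rewrite ltrDl.
have s0 : 0 < kap + 1 by exact: lt_trans k1.
have [C C0 HC] := tail_tmom_decay q_gt0 q_lt1 A_gt0 A_le B_ge0 B_le s0 k0 k1 phi1.
apply/cvgrPdist_le => e e0; pose X := ((C + 1) / e) `^ kap^-1.
have C1 : 0 < (C + 1) / e by rewrite divr_gt0 // ltr_wpDl.
have X0 : 0 < X by exact: powR_gt0.
near=> x.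
have xX : X <= x by near: x; apply: nbhs_pinfty_ge; rewrite num_real.
have x0 : 0 < x by exact: lt_le_trans xX.
have /andP[t0 _] := tail_bound q_gt0 q_lt1 A_gt0 B_ge0 x.
rewrite sub0r normrN ger0_norm //; have [+ _] := HC x x0; move=> /le_trans; apply.
rewrite powRN ler_pdivrMr ?powR_gt0 //.
have h : (C + 1) / e <= x `^ kap.
  have -> : (C + 1) / e = X `^ kap by rewrite /X -powRrM mulVf ?gt_eqF // powRr1 // ltW.
  by apply: ler_powR_pos; rewrite ?(ltW k0) ?(ltW X0).
rewrite ler_pdivrMr // in h; rewrite [e * _]mulrC; lra.
Unshelve. all: by end_near. Qed.

Lemma exists_limit_RV kap : 0 < kap -> gmean q (fun N => A N `^ kap) < 1 ->
  exists (d : measure_display) (T : measurableType d) (Q : probability T R)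
    (W : {RV Q >-> R}), forall x, cdf W x = (1 - tail x)%:E.
Proof.
move=> k0 phi1; apply: exists_RV_cdf.
- by move=> x y xy; rewrite lerD2l lerN2; exact: tail_nonincr.
- move=> x; apply/cvgrPdist_lt => e e0.
  have [y xy ty] := tail_right_continuous q_gt0 q_lt1 A_gt0 B_ge0 x e0.
  near=> z; have zy : z < y by near: z; exact: nbhs_right_lt.
  have xz : x < z by near: z; exact: nbhs_right_gt.
  have h1 := tail_nonincr q_gt0 q_lt1 A_gt0 B_ge0 (ltW zy).
  have h2 := tail_nonincr q_gt0 q_lt1 A_gt0 B_ge0 (ltW xz).
  by rewrite ltr_distl; apply/andP; split; lra.
- have : (fun _ : R => 0 : R) @ -oo%R --> (0 : R) by exact: cvg_cst.
  apply: cvg_trans; apply: near_eq_cvg; near=> x.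
  rewrite tail_lt0 ?subrr //; near: x; apply: nbhs_ninfty_lt; rewrite num_real.
- rewrite -[X in _ --> X]subr0; apply: cvgB; first exact: cvg_cst.
  exact: tail_vanish phi1.
Unshelve. all: by end_near. Qed.

End limit_law.

Theorem theorem1 (R : realType) (a b : R)
    (a_gt0 : 0 < a) (a_lt1 : a < 1) (b_gt : 1 - a < b) :
  exists (estar : R) (s : R -> R),
  [/\ 0 < estar < 1,
    (forall e : R, 0 < e < estar -> 0 < s e),
    (forall (e : R) (d : measure_display) (T : measurableType d)
        (P : probability T R) (eta : nat -> {RV P >-> R}),
      0 < e < 1 ->
      mutually_independent eta ->
      (forall n, P (eta n @^-1` [set 1]) = (1 - e)%:E) ->
      (forall n, P (eta n @^-1` [set 0]) = e%:E) ->
      (e < estar ->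
        exists (d' : measure_display) (T' : measurableType d')
          (Q : probability T' R) (W : {RV Q >-> R}),
        [/\ cvg_in_distribution (W_RV a b eta) W,
          non_degenerate W &
          exists2 K : R, 0 < K &
            (ccdf W x * (x `^ s e)%:E)%E @[x --> +oo] --> K%:E]) /\
      (estar <= e -> forall x : R, 0 < x ->
        P [set w | x < W_RV a b eta n w] @[n --> \oo] --> 1%E)) &
    [/\ {within `]0, estar[, continuous s},
      (forall e1 e2 : R, 0 < e1 -> e1 < e2 -> e2 < estar -> s e2 < s e1),
      s e @[e --> 0^'+] --> +oo &
      s e @[e --> estar^'-] --> (0 : R)]].
Proof.
have [lam lam_gt1 lamE] := growth_rate a_lt1 b_gt.
pose A := runA a b; pose B := runB a b.
have lam_gt0 : 0 < lam by exact: lt_trans lam_gt1.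
have A_gt0 N : 0 < A N by exact: runA_gt0.
have A_le0 N : A N <= a^-1 * lam^-1 ^+ N by exact: runA_le.
have ai0 : 0 < a^-1 by rewrite invr_gt0.
have li0 : 0 < lam^-1 by rewrite invr_gt0.
have li1 : lam^-1 < 1 by rewrite invf_lt1.
have A_le N : A N <= a^-1.
  apply: (le_trans (A_le0 N)); rewrite ler_piMr ?(ltW ai0) //.
  by rewrite exprn_ile1 ?(ltW li0) ?(ltW li1).
have A_ge N : lam^-1 ^+ N.+1 <= A N by exact: runA_ge.
have A0 : 1 < A 0%N by exact: runA0_gt1.
have ai1 : 1 <= a^-1 by rewrite invf_ge1 // ltW.
have /andP[th0 th1] := run_theta_itv a_gt0 a_lt1 b_gt.
have Asub k l : A (k + l).+1 <= run_theta a b * A k * A l by exact: runA_submul.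
have b_gt0 : 0 < b by rewrite (lt_trans _ b_gt) // subr_gt0.
have r0 : 0 < run_ratio a b by rewrite addr_gt0 // divr_gt0.
have ri0 : 0 < (run_ratio a b)^-1 by rewrite invr_gt0.
have B_ge N : (run_ratio a b)^-1 <= B N by exact: runB_ge.
have B_ge0 N : 0 <= B N by apply: le_trans (B_ge N); exact: ltW.
have B_le N : B N <= (a / lam * (lam - 1))^-1 by exact: runB_le.
have beta0 : 0 <= (a / lam * (lam - 1))^-1 by exact: le_trans (B_le 0%N).
pose q0 := threshold A.
have /andP[q00 q01] : 0 < q0 < 1.
  exact: (threshold_itv A_gt0 A_le0 ai0 li0 li1 A_ge A0 th0 th1 Asub).
have q_good q : q0 < q -> q < 1 -> good A q.
  exact: (threshold_good A_gt0 A_le0 ai0 li0 li1 th0 th1 Asub).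
have s_gt0 q : q0 < q -> q < 1 -> 0 < tail_exponent A q.
  move=> qq q1; have qp : 0 < q by exact: lt_trans qq.
  exact: (tail_exponent_gt0 A_gt0 A_le0 ai0 li0 li1 A0 qp q1 (q_good q qq q1)).
have s_phi q sig : q0 < q -> q < 1 -> 0 < sig -> sig < tail_exponent A q ->
    gmean q (fun N => A N `^ sig) < 1.
  move=> qq q1 sg0 ss; have qp : 0 < q by exact: lt_trans qq.
  exact: (lt_tail_exponent A_gt0 A_le0 ai0 li0 li1 A0 qp q1 (q_good q qq q1) sg0 ss).
(* With q = 1 - e the order is reversed: an exponent increasing in q decreases in e. *)
exists (1 - q0), (fun e => tail_exponent A (1 - e)); split.
- by apply/andP; split; lra.
- by move=> e /andP[e0 e1]; apply: s_gt0; lra.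
- move=> e d T P eta /andP[e0 e1] indep eta1 eta0.
  have q_gt0 : 0 < 1 - e by lra.
  have q_lt1 : 1 - e < 1 by lra.
  have law n x := probability_Wn_gt indep eta1 eta0 a_gt0 a_lt1 b_gt n x.
  split=> [ee|ee x x0]; last first.
    have phi1 sig : 0 < sig -> 1 <= gmean (1 - e) (fun N => A N `^ sig).
      apply: (threshold_bad A_gt0 A_le0 ai0 li0 li1 th0 th1 Asub q_gt0 _ q_lt1).
      by rewrite -/q0; lra.
    have t1 := tail_eq1 q_gt0 q_lt1 A_gt0 A_le ri0 B_ge A0 phi1 x.
    (* The law is known for W_{n+1}; the dummy W_0 is dropped. The exact mean is then squeezed
       between [low n], which tends to 1, and 1. *)
    rewrite -cvg_shiftS /=; under eq_fun do rewrite law.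
    apply: cvg_EFin; first exact: nearW.
    have lo := @cvg_low_above _ (1 - e) A B q_gt0 q_lt1 A_gt0 B_ge0 x.
    rewrite t1 in lo.
    have hi : (fun _ : nat => 1 : R) @ \oo --> (1 : R) by exact: cvg_cst.
    apply: (squeeze_cvgr _ lo hi).
    apply: nearW => n; rewrite low_above_le //=; exact: chain_above_le1.
  have qq : q0 < 1 - e by lra.
  have s0 := s_gt0 _ qq q_lt1.
  pose s := tail_exponent A (1 - e); rewrite -/s in s0.
  have s2 : 0 < s / 2 by rewrite divr_gt0.
  have phi_s : gmean (1 - e) (fun N => A N `^ s) = 1.
    exact: (phi_tail_exponent A_gt0 A_le0 ai0 li0 li1 A0 q_gt0 q_lt1 (q_good _ qq q_lt1)).
  (* An exponent in (0, s) that is at most 1, as the ramp requires. *)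
  pose k1 := Num.min (s / 2) 1.
  have k10 : 0 < k1 by rewrite lt_min s2 ltr01.
  have k11 : k1 <= 1 by rewrite ge_min lexx orbT.
  have k12 : k1 <= s / 2 by rewrite ge_min lexx.
  have phi_k1 : gmean (1 - e) (fun N => A N `^ k1) < 1.
    by apply: s_phi => //; rewrite -/s; lra.
  (* An exponent in (0, s) that is at least s - 1, as [defect_bound] requires. *)
  pose k2 := Num.max (s / 2) (s - 1).
  have k20 : s / 2 <= k2 by rewrite le_max lexx.
  have k2p : 0 < k2 by lra.
  have k21 : s - 1 <= k2 by rewrite le_max lexx orbT.
  have k22 : k2 < s by rewrite gt_max; apply/andP; split; lra.
  have sk2 : s - k2 <= 1 by lra.
  have phi_k2 : gmean (1 - e) (fun N => A N `^ k2) < 1 by exact: s_phi.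
  have [d' [T' [Q [W cdfW]]]] :=
    exists_limit_RV q_gt0 q_lt1 A_gt0 A_le B_ge0 B_le k10 phi_k1.
  pose G := tail (1 - e) A B.
  have ccdfW x : ccdf W x = (G x)%:E.
    by rewrite ccdf_1_cdf cdfW -EFinB; congr EFin; rewrite /G; lra.
  have tailK : exists2 K : R, 0 < K & (G x * x `^ s) @[x --> +oo] --> K.
    have [C C0 HC] := tail_tmom_decay q_gt0 q_lt1 A_gt0 A_le B_ge0 B_le s0 k2p k22 phi_k2.
    have [c c0 Hc] := tmom_defect q_gt0 q_lt1 A_gt0 A_le B_ge0 B_le s0 k2p phi_k2 sk2.
    have dense := runA_dense a_gt0 a_lt1 b_gt lam_gt1 lamE.
    have Gb x : 0 <= G x <= 1 by exact: tail_bound.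
    have Gni x y : x <= y -> G y <= G x by exact: tail_nonincr.
    have bG y (N : nat) : `|G (y N)| <= 1 by have /andP[h1 h2] := Gb (y N); rewrite ger0_norm.
    have Gfix x : G x = gmean (1 - e) (fun N => G ((x - B N) / A N)) by exact: tail_fix.
    apply: (@ptail_cvg _ (1 - e) A a^-1 q_gt0 q_lt1 A_gt0 A_le ai1 s k2 s0 k2p k22
      phi_s phi_k2 dense G (tmom (1 - e) A B s) _ Gni _ _ _ _ C c C0 c0 _ _
      _ beta0 _ _ _).
    + by move=> x; have /andP[] := Gb x.
    + by move=> x y; exact: tmom_diff_le.
    + by move=> x y; exact: tmom_diff_ge.
    + by move=> x x0; have /andP[] := tmom_bound q_gt0 q_lt1 A_gt0 B_ge0 s0 x0.
    + by move=> x x0; have /andP[] := tmom_bound q_gt0 q_lt1 A_gt0 B_ge0 s0 x0.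
    + by move=> x x0; case: (HC x x0).
    + by move=> x x0; have /andP[] := Hc x x0.
    + by move=> x; have /andP[] := Gb x.
    + move=> x x0; rewrite [leRHS]Gfix.
      apply: (gmean_le q_gt0 q_lt1 (bG _) (bG _)) => N.
      by apply/Gni/ler_wpM2r; [rewrite invr_ge0 ltW|rewrite gerBl].
    + move=> x; rewrite [leLHS]Gfix.
      apply: (gmean_le q_gt0 q_lt1 (bG _) (bG _)) => N.
      by apply/Gni/ler_wpM2r; [rewrite invr_ge0 ltW|rewrite lerB].
    + move=> x y; exact: (tmom_defect_nd q_gt0 q_lt1 A_gt0 A_le B_ge0 B_le s0 k2p phi_k2 sk2).
    + have small := runA_small a_gt0 a_lt1 b_gt lam_gt1 lamE.
      exact: (tmom_defect_pos q_gt0 q_lt1 A_gt0 A_le B_ge0 B_le s0 k2p k22 phi_k2 sk2 ri0 B_ge small).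
  have [K K0 GK] := tailK.
  exists d', T', Q, W; split.
  + move=> x cx; rewrite cdfW -cvg_shiftS /=.
    have E n : cdf (W_RV a b eta n.+1) x =
        (1 - chain_mean (1 - e) A B B n 0 (above x))%:E.
      rewrite cdf_1_ccdf EFinB -(law n x); congr (_ - _)%E.
      rewrite /ccdf /distribution /pushforward /=; congr (P _).
      by apply/seteqP; split => w /=; rewrite in_itv /= andbT.
    under eq_fun do rewrite E.
    apply: cvg_EFin; first exact: nearW.
    apply: cvgB; first exact: cvg_cst.
    apply: (chain_above_cvg q_gt0 q_lt1 A_gt0 A_le B_ge0 B_le k10 k11 phi_k1) => e' e'0.
    have cF : (1 - G y) @[y --> x] --> 1 - G x.
      have : cdf W y @[y --> x] --> (1 - G x)%:E by rewrite -cdfW; exact: cx.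
      move=> /fine_cvg; apply: cvg_trans; apply: near_eq_cvg; apply: nearW => y /=.
      by rewrite cdfW.
    have /cvgrPdist_le /(_ _ e'0) := cF.
    move=> /nbhs_ballP[r /= r00 Hr].
    have xr : x - r / 2 < x by rewrite gtrBl divr_gt0.
    exists (x - r / 2) => //.
    have : ball x r (x - r / 2).
      rewrite /ball /= opprB addrC subrK gtr0_norm ?divr_gt0 //; lra.
    by move=> /Hr /=; rewrite ler_distl => /andP[]; rewrite /G; lra.
  (* K > 0 makes the tail positive arbitrarily far out, which no almost surely constant variable
     allows. *)
  + move=> c Hc.
    have : \forall x \near +oo, 0 < G x * x `^ s.
      exact: (cvgr_gt _ GK).
    move=> [M [_ HM]].
    pose x := Num.max M c + 1.
    have xM : M < x by rewrite /x ltr_pwDr // le_max lexx.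
    have xc : c < x by rewrite /x ltr_pwDr // le_max lexx orbT.
    have Gx : 0 < G x.
      rewrite ltNge; apply/negP => G0; have := HM x xM.
      by rewrite ltNge mulr_le0_ge0 // powR_ge0.
    have : ccdf W x = 0%E.
      move: Hc => [N [mN N0 HN]].
      apply/eqP; rewrite eq_le measure_ge0 andbT -N0.
      rewrite /ccdf /distribution /pushforward /=; apply: (le_measure Q); rewrite ?inE //.
        by rewrite -[X in measurable X]setTI; exact: measurable_funP.
      move=> w /=; rewrite in_itv /= andbT => xW; apply: HN => /= Wc.
      by move: xW; rewrite Wc ltNge (ltW xc).
    by rewrite ccdfW => -[] /eqP; rewrite gt_eqF.
  + exists K => //.
    have : (G x * x `^ s)%:E @[x --> +oo] --> K%:E.
      by apply: cvg_EFin => //; exact: nearW.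
    by apply: cvg_trans; apply: near_eq_cvg; apply: nearW => x /=; rewrite ccdfW EFinM.
- split.
  + apply: continuous_in_subspaceT => x; rewrite inE /= in_itv /= => /andP[x0 x1].
    apply/cvgrPdist_lt => e e0.
    have h1 : q0 < 1 - x by lra.
    have h2 : 1 - x < 1 by lra.
    have [d d0 Hd] := tail_exponent_continuous A_gt0 A_le0 ai0 li0 li1 A_ge A0 th0 th1 Asub h1 h2 e0.
    near=> y; rewrite distrC; apply: Hd.
    have -> : 1 - y - (1 - x) = x - y by ring.
    by near: y; exact: (nbhsx_ballx x d d0).
  + move=> e1 e2 e10 e12 e2s.
    have h1 : q0 < 1 - e2 by lra.
    have h2 : 0 < 1 - e2 by lra.
    have h3 : 1 - e2 < 1 - e1 by lra.
    have h4 : 1 - e1 < 1 by lra.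
    apply: (tail_exponent_incr A_gt0 A_le0 ai0 li0 li1 A0 th0 th1 Asub h2 h3 h4); apply: q_good; lra.
  + apply/cvgryPge => M.
    have [p /andP[p0 p1] Hp] := tail_exponent_near1 A_gt0 A_le0 ai0 li0 li1 A0 M.
    near=> e; apply: Hp.
      have : e < 1 - p by near: e; apply: nbhs_right_lt; lra.
      lra.
    have : 0 < e by near: e; exact: nbhs_right_gt.
    lra.
  + apply/cvgrPdist_le => e e0.
    have [p /andP[p0 p1] Hp] :=
      tail_exponent_near_threshold A_gt0 A_le0 ai0 li0 li1 A_ge A0 th0 th1 Asub e0.
    near=> x.
    have x1 : x < 1 - q0 by near: x; exact: nbhs_left_lt.
    have x2 : 1 - p < x by near: x; apply: nbhs_left_gt; rewrite /q0; lra.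
    have x3 : 0 < x by near: x; apply: nbhs_left_gt; lra.
    rewrite sub0r normrN ger0_norm; last by apply/ltW/s_gt0; lra.
    by apply: Hp; rewrite -/q0; lra.
Unshelve. all: by end_near. Qed.
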